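(* Let $B$ be a sieving set such that $\langle B\rangle$ has index $\alpha\in(0,1)$, and let $\varphi:\mathbb{R}\to\mathbb{R}$ be of bounded variation, supported in a compact subset of $[0,\infty)$, and non-vanishing on some open interval. There is a constant $c>0$ depending only on $\alpha$ such that for every positive integer $k$, \[ C_k(H;\varphi)=C_2(H;\varphi)^{\frac k2}\left(\mu_k+O\!\left(H^{-\frac ck}\right)\right). \]
   Context: A sieving set is a non-empty set $B \subset \{2,3,\dots\}$ of pairwise coprime integers with $\sum_{b\in B}1/b<\infty$. A positive integer is $B$-free if divisible by no element of $B$. $\langle B\rangle$ is the multiplicative semigroup generated by $B$ (including $1$); $J\subset\mathbb{N}$ has index $\alpha$ if $|\{n\le x:n\in J\}|=x^{\alpha+o(1)}$. Define $\mu_B(n)=0$ if $n\notin\langle B\rangle$ or some $b\in B$ has $b^2\mid n$, and $\mu_B(n)=(-1)^k$ if $n=b_1\cdots b_k$ with distinct $b_j\in B$; $[B]=\{n:\mu_B(n)^2=1\}$. Let $g(n)=\frac{\mu_B(n)}n\prod_{b\in B,\,b\nmid n}(1-b^{-1})$, $\Phi_H(t)=\sum_{m\in\mathbb{Z}}e(mt)\varphi(m/H)$ with $e(u)=e^{2\pi iu}$, for $r\in[B]$ let $\mathcal{R}_B(r)=\{a/r:1\le a\le r,\ \gcd(a,r)\ B\text{-free}\}\subset\mathbb{R}/\mathbb{Z}$, and \[ C_k(H;\varphi)=\sum_{\substack{r_1,\dots,r_k>1\\ r_j\in[B]}}\prod_{j=1}^kg(r_j)\sum_{\substack{\sigma_i\in\mathcal{R}_B(r_i)\\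 \sigma_1+\dots+\sigma_k\in\mathbb{Z}}}\prod_{j=1}^k\Phi_H(\sigma_j) \] (absolutely convergent; it equals $\lim_{X\to\infty}\frac1X\sum_{n\le X}\big(\sum_{u}\varphi(\frac{u-n}H)\mathbf{1}_{B\text{-free}}(u)-\prod_{b\in B}(1-\frac1b)\sum_h\varphi(\frac hH)\big)^k$). $\mu_k=1\cdot3\cdots(k-1)$ for even $k$ and $0$ for odd $k$. Implicit constants depend on $k,B,\varphi$. *)

(* Defs.v *)
From HB Require Import structures.
From mathcomp Require Import all_boot all_order all_algebra.
From mathcomp Require Import finmap archimedean.
From mathcomp Require Import all_classical all_reals all_analysis.
From mathcomp.analysis.showcase Require summability.
From mathcomp Require Import complex.

Set Implicit Arguments.
Unset Strict Implicit.
Unset Printing Implicit Defensive.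

Import Order.TTheory GRing.Theory Num.Theory.
Import numFieldNormedType.Exports.

Local Open Scope classical_set_scope.
Local Open Scope ring_scope.

Section Sieving.
Variable R : realType.
Implicit Types (B J : set nat) (n r a b k : nat) (alpha H t u : R)
  (phi : R -> R).

Definition sieving_set B : Prop :=
  [/\ B !=set0,
      forall b, B b -> (2 <= b)%N,
      forall b b', B b -> B b' -> b != b' -> coprime b b' &
      (\esum_(b in B) ((b%:R : R)^-1)%:E < +oo)%E].

Definition Bfree B n : Prop := (0 < n)%N /\ forall b, B b -> ~~ (b %| n)%N.

Definition semigroup_gen B : set nat :=
  [set n | exists s : seq nat, (forall b, b \in s -> B b) /\
                               n = (\prod_(b <- s) b)%N].

Definition counting_fun J (x : R) : nat :=
  (\sum_(1 <= n < (Num.truncn x).+1 | `[< J n >]) 1)%N.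

Definition has_index J alpha : Prop :=
  exists delta : R -> R, delta x @[x --> +oo] --> (0 : R) /\
    \forall x \near +oo, (counting_fun J x)%:R = x `^ (alpha + delta x).

(* For pairwise coprime elements >= 2, such a list is unique up to order. *)
Definition distinct_factorization B n (s : seq nat) : Prop :=
  [/\ uniq s, forall b, b \in s -> B b & n = (\prod_(b <- s) b)%N].

Definition muB B n : R :=
  if `[< ~ semigroup_gen B n \/ exists2 b, B b & (b ^ 2 %| n)%N >] then 0
  else (-1) ^+ size (xget [::] [set s | distinct_factorization B n s]).

Definition sqB B : set nat := [set n | muB B n ^+ 2 = 1].

Definition gB B n : R :=
  muB B n / n%:R *
  lim ((\prod_(0 <= b < N | `[< B b >] && ~~ (b %| n)%N) (1 - (b%:R : R)^-1))
        @[N --> \oo]).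

Definition e_ u : R[i] := (cos (2 * pi * u) +i* sin (2 * pi * u))%C.

(* The finitely supported sum over int is the full series whenever phi has
   bounded support and 0 < H. *)
Definition Phi phi H t : R[i] :=
  \sum_(m \in [set: int]) (e_ (m%:~R * t) * (phi (m%:~R / H))%:C%C).

(* Subset of R / Z, given by the representatives in ]0, 1]; Phi phi H is
   1-periodic. *)
Definition RB B r : set R :=
  [set x | exists a, [/\ (1 <= a <= r)%N, Bfree B (gcdn a r) &
                         x = a%:R / r%:R]].

Definition Ck_inner B phi H k (r : {ffun 'I_k -> nat}) : R[i] :=
  \sum_(sigma \in [set sigma : {ffun 'I_k -> R} |
      (forall j, RB B (r j) (sigma j)) /\
      \sum_(j < k) sigma j \is a Num.int])
    \prod_(j < k) Phi phi H (sigma j).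

Definition Ck_term B phi H k (r : {ffun 'I_k -> nat}) : R[i] :=
  if `[< forall j, (1 < r j)%N /\ sqB B (r j) >] then
    (\prod_(j < k) gB B (r j))%:C%C * Ck_inner B phi H r
  else 0.

(* Unordered summation: limit of the finite partial sums in R[i]. *)
Definition Ck B phi H k : R[i] :=
  @summability.sum {ffun 'I_k -> nat} R[i] R[i]^o (@Ck_term B phi H k).

Definition gauss_moment k : R :=
  if odd k then 0 else \prod_(i < k./2) (2 * i + 1)%:R.

Definition bounded_variation_line phi : Prop :=
  exists M : R, forall a b : R, a <= b ->
    (total_variation a b phi <= M%:E)%E.

Definition compact_support_nonneg phi : Prop :=
  exists K : set R, [/\ compact K, K `<=` [set x | 0 <= x] &
                        forall x, phi x != 0 -> K x].

Definition nonvanishing_somewhere phi : Prop :=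
  exists a b : R, a < b /\ forall x, a < x < b -> phi x != 0.

End Sieving.

Arguments sieving_set : clear implicits.

(* Main.v *)
(* Keep only the elements of B below N, with product M.  The fractions x / M then
   carry all of the sets R_B(r), and the truncated C_k is the sum over the k-tuples
   x of residues mod M with M | x_1 + ... + x_k of the products of the weights
   w(x) = g(r) Phi_H(x / M), r = rad (supp x), which satisfy
   |w(x)| << min(H, 1 / ||x / M||) / r.

   Pairing x_1 with the coordinates equal to - x_1 gives the Gaussian recursion
   C_{k+2} = (k + 1) C_2 C_k up to the tuples with no such partner of x_1 and those
   with several.  For fixed supports the sum of the bounds is estimated by choosing
   the coordinates one at a time, each one lying in a well spaced coset; doing this
   in both orders and taking the geometric mean gives S_k << H^(k alpha / 2 + e).
   A power of H is saved when some r_j lies outside [H^(1-d), H^(1+d)], when many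
   elements of B divide three of the r_j, and, for an unmatched x_1, because the
   part of r_1 shared with the tuple outside a suitable set of coordinates is either
   of middle size, so that x_1 is spaced too widely, or so small that x_1 or some x_t
   is bounded away from 0 on the scale 1 / H.

   From below, C_2 is estimated by Parseval on the subgroups of order rad D, together
   with the fact that the squarefree elements of <B> still have index alpha. *)
Require Import Defs.
From HB Require Import structures.
From mathcomp Require Import all_boot all_order all_fingroup all_algebra.
From mathcomp Require Import reals sequences exp.
From mathcomp Require Import ring lra zify.
From mathcomp Require Import complex.

Set Implicit Arguments.
Unset Strict Implicit.
Unset Printing Implicit Defensive.

Import Order.TTheory GRing.Theory Num.Theory.
Local Open Scope ring_scope.

(** The estimates see the elements of B below [N] only through a bound [Z] for the sum of [b^(-th)],
    with [th > alpha]; this uniformity lets [N] tend to infinity.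

    The exponent [k alpha / 2] arises as follows. Let [R] be the radical of the union of the
    supports and [h_j = min(H, r_j)]. Up to logarithms the geometric mean gives
    [(prod h_j)^(1/2) / R] for fixed supports, while a decay of [R^(-th)] is enough to sum over the
    supports by an Euler product. Interpolating with the trivial bound therefore leaves
    [H^(k th / 2)].

    The saving is of the form [c / k] because [d] has to be a constant over [k]. Inside the range
    the decay in [R] is inserted through [R^2 <= prod r_j <= Y^k] with [Y = H^(1+d)], which loses
    about [H^(k d alpha / 2)]; this must stay below the fixed powers gained from triple coincidences
    and unmatched coordinates, while the terms outside the range gain only a multiple of [d].

    For bounded [H] the value of [C_2] may be tiny or zero. There [C_k] is bounded above and [C_2]
    below by powers of one quantity, the sum of the squares of [phi(m / H)]. *)

Module ZeroSums.

(** * Sums over well separated integers *)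

Section FiniteSums.
Variable R : realType.

Lemma ler_sum_sub (I : finType) (P Q : pred I) (F : I -> R) :
  (forall i, P i -> Q i) -> (forall i, Q i -> 0 <= F i) ->
  \sum_(i | P i) F i <= \sum_(i | Q i) F i.
Proof.
move=> PQ F0; rewrite [leRHS](bigID P) /=.
rewrite (eq_bigl P) ?lerDl; last first.
  by move=> i /=; case: (boolP (P i)) => [/PQ ->|]; rewrite ?andbF.
by apply: sumr_ge0 => i /andP[/F0].
Qed.

Lemma ler_sum_inj (I J : finType) (A : {set I}) (p : I -> J) (F : I -> R)
    (T : J -> R) :
  {in A &, injective p} -> (forall x, x \in A -> F x <= T (p x)) ->
  (forall j, 0 <= T j) -> \sum_(x in A) F x <= \sum_j T j.
Proof.
move=> pinj FT T0; apply: (@le_trans _ _ (\sum_(x in A) T (p x))).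
  by apply: ler_sum.
rewrite -(big_imset T pinj) /=.
exact: ler_sum_sub.
Qed.

Definition harm (m : nat) : R := \sum_(i < m) (i.+1%:R)^-1.

Lemma harm_ge0 m : 0 <= harm m.
Proof. by apply: sumr_ge0 => i _; rewrite invr_ge0 ler0n. Qed.

Lemma harm_le m p : (m <= p)%N -> harm m <= harm p.
Proof.
move=> mp; rewrite /harm -(subnKC mp) big_split_ord /= lerDl.
by apply: sumr_ge0 => i _; rewrite invr_ge0 ler0n.
Qed.

(** Each bin of length [g] holds at most one point. The bin at 0 is charged [h] and the bin [j > 0]
    is charged [N / (g j)], which sums to a harmonic number. *)
Lemma bin_sum (N : nat) (A : {set 'I_N}) (p : 'I_N -> nat) (g : nat) (h : R)
    (F : 'I_N -> R) :
  (0 < g)%N -> 0 <= h -> {in A, forall x, (0 < p x <= N)%N} ->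
  {in A &, injective (fun x => p x %/ g)%N} ->
  {in A, forall x, F x <= Num.min h (N%:R / (p x)%:R)} ->
  \sum_(x in A) F x <= h + N%:R / g%:R * harm (N %/ g).
Proof.
move=> g0 h0 pA pinj FA.
pose T (j : 'I_(N %/ g).+1) : R :=
  if j == 0%N :> nat then h else N%:R / g%:R * j%:R^-1.
pose q x : 'I_(N %/ g).+1 := inord (p x %/ g).
have qE x : x \in A -> q x = (p x %/ g)%N :> nat.
  by move=> /pA /andP[_ H]; rewrite inordK // ltnS leq_div2r.
suff -> : h + N%:R / g%:R * harm (N %/ g) = \sum_j T j.
  apply: (ler_sum_inj (p := q)).
  - by move=> x y xA yA /(congr1 val) /=; rewrite !qE // => /pinj; apply.
  - move=> x xA; apply: (le_trans (FA x xA)); rewrite /T qE // ge_min.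
    case: eqP => [_|/eqP j0]; first by rewrite lexx.
    apply/orP; right; rewrite -mulrA ler_wpM2l // -invfM lef_pV2 ?posrE.
    + by rewrite -natrM ler_nat mulnC leq_trunc_div.
    + by rewrite ltr0n; case/andP: (pA x xA).
    + by rewrite -natrM ltr0n muln_gt0 g0 lt0n.
  - move=> j; rewrite /T; case: ifP => // _.
    by rewrite !mulr_ge0 ?invr_ge0 ?ler0n.
rewrite big_ord_recl /= {1}/T /=; congr (_ + _).
by rewrite mulr_sumr; apply: eq_bigr => i _; rewrite /T.
Qed.

End FiniteSums.

(** * Residues modulo a product of coprime integers *)

Section Radical.
Variables (n : nat) (b : 'I_n -> nat).
Hypothesis b_gt1 : forall i, (1 < b i)%N.
Hypothesis b_coprime : forall i j, i != j -> coprime (b i) (b j).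

(* [x < modulus] stands for the point x / modulus of R / Z: its B-denominator is
   [rad (supp x)] and its distance to 0 is [ndist x / modulus]. *)
Definition modulus : nat := \prod_i b i.
Definition rad (D : {set 'I_n}) : nat := \prod_(i in D) b i.
Lemma rad_unfold D : rad D = (\prod_(i in D) b i)%N.
Proof. by []. Qed.
Definition supp (x : nat) : {set 'I_n} := [set i | ~~ (b i %| x)%N].
Local Notation M := modulus.
Definition ndist (x : nat) : nat := minn x (M - x).

Lemma b_gt0 i : (0 < b i)%N. Proof. exact: ltnW. Qed.
Lemma modulus_gt0 : (0 < M)%N. Proof. by apply: prodn_gt0 => i; exact: b_gt0. Qed.
Lemma rad_gt0 D : (0 < rad D)%N. Proof. by apply: prodn_cond_gt0 => i _; exact: b_gt0. Qed.
Lemma rad0 : rad set0 = 1%N. Proof. by rewrite /rad big_set0. Qed.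
Lemma radT : rad setT = M. Proof. by rewrite /rad/M; apply: eq_bigl => i; rewrite inE. Qed.

Lemma radID D E : rad D = (rad (D :&: E) * rad (D :\: E))%N.
Proof. by rewrite /rad (big_setID E). Qed.

Lemma radU (D E : {set 'I_n}) :
  [disjoint D & E] -> rad (D :|: E) = (rad D * rad E)%N.
Proof.
move=> DE; rewrite (radID (D :|: E) D); congr (rad _ * rad _)%N.
  by rewrite setUK.
apply/setP => i; rewrite !inE; case: (boolP (i \in D)) => //= iD.
by rewrite (disjointFr DE iD).
Qed.

Lemma rad_sub (D E : {set 'I_n}) : D \subset E -> (rad D <= rad E)%N.
Proof.
by move=> DE; rewrite (radID E D) (setIidPr DE) leq_pmulr // rad_gt0.
Qed.

Lemma radC D : (rad D * rad (~: D))%N = M.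
Proof. by rewrite -radT (radID setT D) setTI setTD. Qed.

Lemma rad_dvd (D : {set 'I_n}) x : {in D, forall i, b i %| x}%N -> (rad D %| x)%N.
Proof.
rewrite /rad -big_enum /= => H.
have {H} : {in enum D, forall i, b i %| x}%N.
  by move=> i; rewrite mem_enum; apply: H.
have : uniq (enum D) by exact: enum_uniq.
elim: (enum D) => [|i s IH] /=; first by rewrite big_nil dvd1n.
move=> /andP[nis us] H; rewrite big_cons Gauss_dvd; last first.
  rewrite big_seq; apply: (big_ind (fun p => coprime (b i) p)) => //.
  - exact: coprimen1.
  - by move=> p q cp cq; rewrite coprimeMr cp.
  - by move=> j js; apply: b_coprime; apply: contraNneq nis => ->.
by rewrite H ?mem_head // IH // => j js; apply: H; rewrite inE js orbT.
Qed.

(** The difference is divisible by the pairwise coprime [b i] with [i \notin D]. After division by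
    [M]: points that agree outside [D] are at least [1 / rad D] apart. *)
Lemma congr_gap (D : {set 'I_n}) x y : (x < y)%N ->
  (forall i, i \notin D -> x = y %[mod b i]) -> (rad (~: D) <= y - x)%N.
Proof.
move=> xy H; apply: dvdn_leq; first by rewrite subn_gt0.
apply: rad_dvd => i; rewrite inE => /H /eqP.
by rewrite eq_sym eqn_mod_dvd // ltnW.
Qed.

Lemma ndist_gt0 x : (0 < x < M)%N -> (0 < ndist x)%N.
Proof. by rewrite /ndist; lia. Qed.

(** Both [x] and [M - x] are positive multiples of [rad (~: D)]: a nonzero fraction with denominator
    [rad D] stays at distance at least [1 / rad D] from 0. *)
Lemma ndist_ge (D : {set 'I_n}) x : (0 < x < M)%N ->
  (forall i, i \notin D -> b i %| x)%N -> (M <= rad D * ndist x)%N.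
Proof.
move=> /andP[x0 xM] H; have dx : (rad (~: D) %| x)%N.
  by apply: rad_dvd => i; rewrite inE; apply: H.
have dM : (rad (~: D) %| M - x)%N by rewrite dvdn_subr ?(ltnW xM) // -(radC D) dvdn_mull.
rewrite -{1}(radC D) leq_mul2l; apply/orP; right.
by rewrite /ndist leq_min; apply/andP; split; apply: dvdn_leq; rewrite // subn_gt0.
Qed.

Lemma suppP x (i : 'I_n) : (i \notin supp x) = (b i %| x)%N.
Proof. by rewrite inE negbK. Qed.

Lemma modulus_dvd x : supp x = set0 -> (M %| x)%N.
Proof.
move=> sx; rewrite -radT; apply: rad_dvd => i _.
by rewrite -suppP sx inE.
Qed.

Lemma supp_eq0 (x : 'I_M) : (supp x == set0) = (x == 0%N :> nat).
Proof.
apply/eqP/eqP => [/modulus_dvd|->]; last first.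
  by apply/setP => i; rewrite !inE dvdn0.
by case: (posnP x) => // x0 /(dvdn_leq x0); rewrite leqNgt ltn_ord.
Qed.

Lemma rad_gt1 (D : {set 'I_n}) : D != set0 -> (1 < rad D)%N.
Proof.
case/set0Pn => i iD; apply: leq_trans (b_gt1 i) _.
by rewrite /rad (big_setD1 i iD) /= leq_pmulr // rad_gt0.
Qed.

Variables (R : realType).

(** The two factors 2 come from cutting the circle at its midpoint: on each half [ndist] is an
    injective coordinate, [x] or [M - x], and the spacing puts distinct points into distinct
    bins. *)
Lemma spaced_sum (E : {set 'I_M}) (g : nat) (h : R) : (0 < g)%N -> 0 <= h ->
  {in E, forall x : 'I_M, 0 < x}%N ->
  {in E &, forall x y : 'I_M, x < y -> g <= y - x}%N ->
  \sum_(x in E) Num.min h (M%:R / (ndist x)%:R) <=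
    2 * h + 2 * (M%:R / g%:R * harm R (M %/ g)).
Proof.
move=> g0 h0 E0 Eg.
have half (A : {set 'I_M}) (p : 'I_M -> nat) : A \subset E ->
    {in A, forall x, (0 < p x <= M)%N} -> {in A, forall x : 'I_M, ndist x = p x} ->
    {in A &, forall x y, (p x < p y)%N -> g <= p y - p x}%N ->
    {in A &, injective p} ->
    \sum_(x in A) Num.min h (M%:R / (ndist x)%:R) <=
      h + M%:R / g%:R * harm R (M %/ g).
  move=> AE pA pE pg pinj; apply: (@bin_sum _ _ A p g h) => //; last first.
    by move=> x xA; rewrite pE.
  move=> x y xA yA /= pxy; apply: pinj => //.
  move: (pg x y xA yA) (pg y x yA xA) (divn_eq (p x) g) (divn_eq (p y) g).
  rewrite pxy; move: (ltn_pmod (p x) g0) (ltn_pmod (p y) g0).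
  by case: (ltngtP (p x) (p y)) => //; lia.
rewrite (big_setID [set x : 'I_M | x <= M - x]%N) /=.
have -> : 2 * h + 2 * (M%:R / g%:R * harm R (M %/ g)) =
  (h + M%:R / g%:R * harm R (M %/ g)) + (h + M%:R / g%:R * harm R (M %/ g)).
  by rewrite !mulr_natl !mulr2n addrACA.
apply: lerD.
- apply: (half _ (fun x => x : nat)); first exact: subsetIl.
  + by move=> x; rewrite !inE => /andP[/E0 ->] _; rewrite ltnW.
  + by move=> x; rewrite !inE /ndist => /andP[_ xM]; apply/minn_idPl.
  + by move=> x y; rewrite !inE => /andP[xE _] /andP[yE _]; apply: Eg.
  + by move=> x y _ _ /val_inj.
- apply: (half _ (fun x => M - x)%N); first exact: subsetDl.
  + by move=> x; rewrite !inE leq_subr subn_gt0 ltn_ord.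
  + move=> x; rewrite !inE /ndist -ltnNge => /andP[xM _].
    by apply/minn_idPr/ltnW.
  + move=> x y; rewrite !inE => /andP[_ xE] /andP[_ yE] xy.
    have := Eg y x yE xE; move: (ltn_ord x) (ltn_ord y); lia.
  + move=> x y _ _ xy; apply: val_inj; move: (ltn_ord x) (ltn_ord y) xy => /=; lia.
Qed.

Variable H : R.
Hypothesis H1 : 1 <= H.

(** Since [0^-1 = 0], the weight vanishes at [x = 0]; this encodes the condition [r > 1] of the
    series. *)
Definition wt (x : nat) : R := Num.min H (M%:R / (ndist x)%:R) / (rad (supp x))%:R.
Lemma wt_unfold x : wt x = Num.min H (M%:R / (ndist x)%:R) / (rad (supp x))%:R.
Proof. by []. Qed.

Lemma wt_ge0 x : 0 <= wt x.
Proof.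
rewrite /wt divr_ge0 // le_min (le_trans ler01 H1) /=.
by rewrite divr_ge0.
Qed.

Lemma ratio_ndist_le (D : {set 'I_n}) (x : 'I_M) : (forall i, i \notin D -> b i %| x)%N ->
  M%:R / (ndist x)%:R <= (rad D)%:R :> R.
Proof.
move=> Dx; case: (posnP x) => x0; first by rewrite x0 /ndist min0n invr0 mulr0.
have xM : (0 < x < M)%N by rewrite x0 ltn_ord.
rewrite ler_pdivrMr ?ltr0n ?ndist_gt0 // -natrM ler_nat.
exact: ndist_ge.
Qed.

Lemma wt0 : wt 0 = 0.
Proof. by rewrite /wt /ndist min0n invr0 mulr0 min_r ?mul0r // (le_trans ler01). Qed.

Lemma wt_le_ndist (x : 'I_M) : wt x <= M%:R / (ndist x)%:R / (rad (supp x))%:R.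
Proof. by rewrite ler_wpM2r ?invr_ge0 // ge_min lexx orbT. Qed.

(** A nonzero point of denominator [r] has distance at least [1 / r] from 0, so the cap [H] may be
    lowered to [min(H, r)]. Keeping [r] here is what later yields a gain for small denominators. *)
Definition hcap (r : nat) : R := Num.min H r%:R.

Lemma wtE (x : 'I_M) : wt x =
  Num.min (hcap (rad (supp x))) (M%:R / (ndist x)%:R) / (rad (supp x))%:R.
Proof.
rewrite /wt /hcap -minA; congr (Num.min _ _ / _); apply/esym/min_r.
by apply: ratio_ndist_le => i; rewrite suppP.
Qed.

Lemma wt_le_hcap (x : 'I_M) : wt x <= hcap (rad (supp x)) / (rad (supp x))%:R.
Proof. by rewrite wtE ler_wpM2r ?invr_ge0 // ge_min lexx. Qed.

Lemma hcap_ge1 r : (0 < r)%N -> 1 <= hcap r.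
Proof. by move=> r0; rewrite /hcap le_min H1 ler1n. Qed.

Lemma wt_le1 (x : 'I_M) : wt x <= 1.
Proof.
apply: (le_trans (wt_le_hcap x)); rewrite ler_pdivrMr ?ltr0n ?rad_gt0 // mul1r.
by rewrite /hcap ge_min lexx orbT.
Qed.

(** Cost of one coordinate of denominator [r] confined to points with mutual distance at least
    [1 / q]: the nearest point on each side of 0 costs [hcap r], the others a harmonic sum. *)
Definition stepc (r q : nat) : R :=
  (2 * hcap r + 2 * (q%:R * harm R q)) / r%:R.

Lemma coset_sum (D Q : {set 'I_n}) (E : {set 'I_M}) :
  {in E, forall x : 'I_M, supp x = D} -> D != set0 ->
  {in E &, forall x y : 'I_M, forall i, i \notin Q -> x = y %[mod b i]} ->
  \sum_(x in E) wt x <= stepc (rad D) (rad Q).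
Proof.
move=> ED D0 EQ.
rewrite (eq_bigr (fun x : 'I_M =>
   Num.min (hcap (rad D)) (M%:R / (ndist x)%:R) / (rad D)%:R)); last first.
  by move=> x /ED xD; rewrite wtE xD.
rewrite -mulr_suml ler_wpM2r ?invr_ge0 //.
have g0 := rad_gt0 (~: Q).
have -> : (rad Q)%:R = M%:R / (rad (~: Q))%:R :> R.
  by rewrite -(radC Q) natrM mulfK // pnatr_eq0 -lt0n.
have -> : harm R (rad Q) = harm R (M %/ rad (~: Q)).
  by congr harm; rewrite -(radC Q) mulnK.
apply: spaced_sum => //.
- by rewrite (le_trans ler01) // hcap_ge1 ?rad_gt0.
- move=> x /ED xD; rewrite lt0n -supp_eq0 xD; exact: D0.
- by move=> x y xE yE xy; apply: congr_gap => // i iQ; apply: EQ.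
Qed.

Lemma supp_sum (D : {set 'I_n}) : D != set0 ->
  \sum_(x : 'I_M | supp x == D) wt x <= stepc (rad D) (rad D).
Proof.
move=> D0; rewrite (eq_bigl (mem [set x : 'I_M | supp x == D])); last first.
  by move=> x; rewrite !inE.
apply: coset_sum => // [x|x y].
  by rewrite inE => /eqP.
rewrite !inE => /eqP xD /eqP yD i iD.
have := iD; rewrite -{1}xD suppP => /eqP ->.
by have := iD; rewrite -{1}yD suppP => /eqP ->.
Qed.

End Radical.

(** * Choosing the coordinates of a tuple one at a time *)

Section Potential.
Variables (R : realType) (k : nat) (G : finType).

Definition upd (y : {ffun 'I_k -> G}) (m : 'I_k) (v : G) : {ffun 'I_k -> G} :=
  [ffun i => if i == m then v else y i].

Definition agree (m : nat) (y x : {ffun 'I_k -> G}) : bool :=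
  [forall i : 'I_k, (i < m)%N ==> (x i == y i)].

Lemma agreeP m (y x : {ffun 'I_k -> G}) :
  reflect (forall i : 'I_k, (i < m)%N -> x i = y i) (agree m y x).
Proof.
apply: (iffP forallP) => [H i im|H i]; first by move/implyP: (H i) => /(_ im) /eqP.
by apply/implyP => /H ->.
Qed.

Lemma agree_upd (m : 'I_k) (y : {ffun 'I_k -> G}) v x :
  agree m.+1 (upd y m v) x = agree m y x && (x m == v).
Proof.
apply/agreeP/andP => [H|[/agreeP H /eqP xv] i].
  split; last by rewrite H // ffunE eqxx.
  apply/agreeP => i im; rewrite H ?ffunE; last exact: ltnW.
  by case: eqP im => // ->; rewrite ltnn.
rewrite ltnS leq_eqVlt => /orP[/eqP/val_inj ->|im]; first by rewrite ffunE eqxx.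
by rewrite ffunE H //; case: eqP im => // ->; rewrite ltnn.
Qed.

(** The potential [psi m y] is meant to dominate the sum over all tuples that extend the first [m]
    entries of [y]. The hypothesis says that it does not grow when one more coordinate is chosen and
    summed; induction on the number of coordinates still open concludes. *)
Lemma potential_sum (psi : nat -> {ffun 'I_k -> G} -> R) (y0 : {ffun 'I_k -> G}) :
  (forall (m : 'I_k) y, \sum_v psi m.+1 (upd y m v) <= psi m y) ->
  \sum_x psi k x <= psi 0%N y0.
Proof.
move=> step.
suff claim j m : (m + j = k)%N ->
    forall y, \sum_(x | agree m y x) psi k x <= psi m y.
  rewrite (eq_bigl (fun x => agree 0 y0 x)); first exact: (claim k 0%N).
  by move=> x; apply/esym/agreeP.
elim: j m => [|j IH] m.
  rewrite addn0 => -> y; rewrite (big_pred1 y) // => x /=.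
  by apply/agreeP/eqP => [H|-> //]; apply/ffunP => i; apply: H.
rewrite addnS => mk y; have mlt : (m < k)%N by lia.
pose o := Ordinal mlt.
rewrite (partition_big (fun x : {ffun 'I_k -> G} => x o) xpredT) //=.
apply: (le_trans _ (step o y)); apply: ler_sum => v _.
rewrite (eq_bigl (fun x => agree m.+1 (upd y o v) x)); last first.
  by move=> x; rewrite (agree_upd o).
by apply: IH; rewrite addSn.
Qed.

End Potential.

(** * Euler product over tuples of supports *)

Section EulerProduct.
Variables (R : realType) (k n : nat).

(** A tuple of [k] subsets of ['I_n] is the same as a map from ['I_n] to the subsets of ['I_k].
    After this transposition the sum is the product over [i] of [1 + (2^k - 1) t_i]. *)
Lemma sum_support_tuples (t : 'I_n -> R) : (forall i, 0 <= t i) ->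
  \sum_(D : {ffun 'I_k -> {set 'I_n}}) \prod_(i in \bigcup_j D j) t i <=
    expR (2 ^+ k * \sum_i t i).
Proof.
move=> t0.
pose F (i : 'I_n) (S : {set 'I_k}) : R := if S == set0 then 1 else t i.
pose h (E : {ffun 'I_n -> {set 'I_k}}) : {ffun 'I_k -> {set 'I_n}} :=
  [ffun j => [set i | j \in E i]].
pose h' (D : {ffun 'I_k -> {set 'I_n}}) : {ffun 'I_n -> {set 'I_k}} :=
  [ffun i => [set j | i \in D j]].
rewrite (reindex h) /=; last first.
  exists h' => E _; apply/ffunP => i; rewrite ffunE; apply/setP => j;
  by rewrite inE ffunE inE.
have -> : \sum_E \prod_(i in \bigcup_j h E j) t i = \prod_i \sum_S F i S.
  rewrite bigA_distr_bigA /=; apply: eq_bigr => E _.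
  rewrite [LHS]big_mkcond /=; apply: eq_bigr => i _; rewrite /F.
  have -> : (i \in \bigcup_j h E j) = (E i != set0).
    apply/bigcupP/set0Pn => [[j _]|[j jE]]; rewrite ?ffunE ?inE; first by exists j.
    by exists j => //; rewrite ffunE inE.
  by case: eqP.
have FE i : \sum_S F i S <= expR (2 ^+ k * t i).
  apply: le_trans (expR_ge1Dx _); rewrite (bigD1 set0) //= {1}/F eqxx lerD2l.
  apply: (@le_trans _ _ (\sum_(S : {set 'I_k}) t i)).
    rewrite [leRHS](bigD1 set0) //=; apply: ler_wpDl => //.
    by apply: ler_sum => S S0; rewrite /F (negPf S0).
  have -> : \sum_(S : {set 'I_k}) t i = 2 ^+ k * t i; last by [].
  rewrite sumr_const -natrX -[LHS]mulr_natl; congr (_%:R * _).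
  have := card_powerset [set: 'I_k]; rewrite cardsT card_ord => <-.
  apply: eq_card => S.
  by rewrite powersetE subsetT.
rewrite mulr_sumr expR_sum; apply: ler_prod => i _; rewrite FE andbT.
by apply: sumr_ge0 => S _; rewrite /F; case: ifP.
Qed.

End EulerProduct.

(** * Zero-sum tuples with prescribed supports *)

Section FundamentalLemma.
Variables (R : realType) (n : nat) (b : 'I_n -> nat).
Hypothesis b_gt1 : forall i, (1 < b i)%N.
Hypothesis b_coprime : forall i j, i != j -> coprime (b i) (b j).
Variable H : R.
Hypothesis H1 : 1 <= H.
Variable k : nat.
Local Notation M := (modulus b).
Local Notation rad := (rad b).
Local Notation supp := (supp b).
Local Notation wt := (wt b H).
Local Notation tup := {ffun 'I_k -> 'I_M}.
Local Notation stup := {ffun 'I_k -> {set 'I_n}}.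

Definition zerosum (x : tup) : bool := (M %| \sum_i x i)%N.
Lemma zerosum_unfold x : zerosum x = (M %| \sum_i x i)%N.
Proof. by []. Qed.
Definition supps (x : tup) : stup := [ffun i => supp (x i)].

Lemma b_dvd_modulus i : (b i %| M)%N.
Proof. by rewrite /modulus (bigD1 i) //= dvdn_mulr. Qed.

Definition default_tup : tup := [ffun=> Ordinal (modulus_gt0 b_gt1)].

Lemma zerosum_others (x : tup) (j : 'I_k) (i : 'I_n) : zerosum x ->
  (forall j', j' != j -> i \notin supp (x j')) -> i \notin supp (x j).
Proof.
move=> zx H0; rewrite suppP.
have /(dvdn_trans (b_dvd_modulus i)) := zx.
rewrite (bigD1 j) //= dvdn_addl //.
by apply: dvdn_sum => j' /H0; rewrite suppP.
Qed.

(** Modulo [b i] all coordinates after [m] vanish, so the zero-sum condition fixes coordinate [m] as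
    minus the sum of the earlier ones, which [x] and [y] share. *)
Lemma zerosum_congr (x y : tup) (m : 'I_k) (i : 'I_n) :
  zerosum x -> zerosum y -> (forall j : 'I_k, (j < m)%N -> x j = y j) ->
  (forall j : 'I_k, (m < j)%N -> i \notin supp (x j) /\ i \notin supp (y j)) ->
  x m = y m %[mod b i].
Proof.
move=> zx zy xy Hi.
have aux (z : tup) : zerosum z -> (forall j : 'I_k, (m < j)%N -> i \notin supp (z j)) ->
    (b i %| z m + \sum_(j < k | (j < m)%N) z j)%N.
  move=> /(dvdn_trans (b_dvd_modulus i)) zz zi; move: zz.
  rewrite (bigD1 m) //= (bigID (fun j : 'I_k => (j < m)%N)) /= addnA dvdn_addl.
    rewrite (eq_bigl (fun j : 'I_k => (j < m)%N)) // => j /=.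
    by case: (ltngtP j m) => //; rewrite ?andbT ?andbF // => jm; rewrite -val_eqE /= ltn_eqF.
  apply: dvdn_sum => j /andP[jm]; rewrite -leqNgt leq_eqVlt val_eqE eq_sym (negPf jm) /=.
  by move/zi; rewrite suppP.
have := aux x zx (fun j jm => (Hi j jm).1); have := aux y zy (fun j jm => (Hi j jm).2).
rewrite (eq_bigr (fun j => y j : nat) (F1 := fun j => x j : nat)) => [|j jm]; last first.
  by rewrite xy.
move=> /eqP yS /eqP xS; apply/eqP.
by rewrite -(eqn_modDr (\sum_(j < k | (j < m)%N) y j)) xS yS.
Qed.

Definition suppsum (D : stup) : R :=
  \sum_(x : tup | zerosum x && (supps x == D)) \prod_i wt (x i).

Lemma suppsum_ge0 D : 0 <= suppsum D.
Proof. by apply: sumr_ge0 => x _; apply: prodr_ge0 => i _; apply: wt_ge0. Qed.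

Definition after (D : stup) (j : 'I_k) : {set 'I_n} :=
  \bigcup_(i : 'I_k | (j < i)%N) D i.
Definition before (D : stup) (j : 'I_k) : {set 'I_n} :=
  \bigcup_(i : 'I_k | (i < j)%N) D i.

Lemma hcap_ge0 r : 0 <= hcap H r.
Proof. by rewrite /hcap le_min ler0n (le_trans ler01 H1). Qed.

Lemma stepc_ge0 r q : 0 <= stepc H r q.
Proof.
rewrite /stepc divr_ge0 ?ler0n // addr_ge0 ?mulr_ge0 ?hcap_ge0 ?ler0n //.
exact: harm_ge0.
Qed.

(** Once the coordinates before [m] are known, the next one is determined modulo every [b i] except
    those shared by [D m] and a later support. It lies in a coset to which [coset_sum] applies. *)
Lemma suppsum_le_after (D : stup) : (forall j, D j != set0) ->
  suppsum D <= \prod_j stepc H (rad (D j)) (rad (D j :&: after D j)).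
Proof.
move=> D0; set c := fun j : 'I_k => stepc H (rad (D j)) (rad (D j :&: after D j)).
(* The potential keeps only prefixes that extend to an admissible tuple: the congruences between two
   candidates for the next coordinate are read off from such extensions. *)
pose ex (m : nat) (y : tup) : bool :=
  [exists x : tup, [&& zerosum x, supps x == D & agree m y x]].
pose psi (m : nat) (y : tup) : R :=
  (ex m y)%:R * \prod_(i < k) (if (i < m)%N then wt (y i) else c i).
have c0 i : 0 <= c i by exact: stepc_ge0.
have psi0 : psi 0%N default_tup <= \prod_j c j.
  rewrite /psi ler_piMl //; first by apply: prodr_ge0.
  by case: (ex _ _).
apply: le_trans psi0.
have -> : suppsum D = \sum_x psi k x.
  rewrite /suppsum big_mkcond; apply: eq_bigr => x _; rewrite /psi.
  have -> : ex k x = zerosum x && (supps x == D).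
    apply/existsP/idP => [[y /and3P[zy sy /agreeP xy]]|/andP[zx sx]].
      suff -> : x = y by rewrite zy.
      by apply/ffunP => i; rewrite xy.
    by exists x; rewrite zx sx; apply/agreeP.
  case: andP => _; rewrite ?mul0r // mul1r.
  by apply: eq_bigr => i _; rewrite ltn_ord.
apply: potential_sum => m y; rewrite /psi.
have prodE v : \prod_(i < k) (if (i < m.+1)%N then wt (upd y m v i) else c i) =
    wt v * \prod_(i < k | i != m) (if (i < m)%N then wt (y i) else c i).
  rewrite (bigD1 m) //= ltnSn ffunE eqxx; congr (_ * _); apply: eq_bigr => i im.
  by rewrite ltnS leq_eqVlt val_eqE (negPf im) /= ffunE (negPf im).
under eq_bigr do rewrite prodE mulrA.
rewrite -mulr_suml [X in _ <= _ * X](bigD1 m) //= ltnn mulrA ler_wpM2r //.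
  by apply: prodr_ge0 => i _; case: ifP => // _; apply: wt_ge0.
case: (boolP (ex m y)) => exm; last first.
  rewrite mul0r big1 // => v _.
  case: (boolP (ex _ _)) => [/existsP[x /and3P[zx sx]]|_]; last by rewrite mul0r.
  rewrite agree_upd => /andP[ag _]; case/negP: exm.
  by apply/existsP; exists x; rewrite zx sx.
rewrite mul1r.
rewrite (eq_bigr (fun v : 'I_M => if ex m.+1 (upd y m v) then wt v else 0)); last first.
  by move=> v _; case: (ex _ _); rewrite ?mul1r ?mul0r.
rewrite -big_mkcond (eq_bigl (fun v => v \in [set v | ex m.+1 (upd y m v)])) => [|v]; last first.
  by rewrite inE.
have exv v : v \in [set v | ex m.+1 (upd y m v)] ->
    exists x, [/\ zerosum x, forall j, supp (x j) = D j,
      forall i : 'I_k, (i < m)%N -> x i = y i & x m = v].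
  rewrite inE => /existsP[x /and3P[zx /eqP sx]]; rewrite agree_upd.
  move=> /andP[/agreeP ag /eqP xv]; exists x; split => // j.
  by rewrite -sx ffunE.
apply: coset_sum => //.
  by move=> v /exv [x [_ sx _ <-]].
move=> v v' /exv [x [zx sx xy xv]] /exv [x' [zx' sx' xy' xv']] i iQ.
case: (boolP (i \in D m)) => iD; last first.
  move: (iD); rewrite -{1}(sx m) xv suppP => /eqP ->.
  by move: iD; rewrite -{1}(sx' m) xv' suppP => /eqP ->.
rewrite -xv -xv'; apply: zerosum_congr => //.
  by move=> j jm; rewrite xy ?xy'.
move=> j mj; rewrite sx sx'; suff ij : i \notin D j by [].
apply: contra iQ => ij; rewrite inE iD /=; by apply/bigcupP; exists j.
Qed.

Definition revD (D : stup) : stup := [ffun j => D (rev_ord j)].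

Lemma suppsum_rev D : suppsum (revD D) = suppsum D.
Proof.
pose h (x : tup) : tup := [ffun j => x (rev_ord j)].
have hh : cancel h h by move=> x; apply/ffunP => j; rewrite !ffunE rev_ordK.
rewrite /suppsum (reindex_inj (can_inj hh)) /=; apply: eq_big => x.
  congr andb.
    rewrite /zerosum; congr dvdn; rewrite (reindex_inj rev_ord_inj) /=.
    by apply: eq_bigr => i _; rewrite ffunE rev_ordK.
  apply/eqP/eqP => [E|<-].
    apply/ffunP => j; have /ffunP /(_ (rev_ord j)) := E.
    by rewrite !ffunE rev_ordK.
  by apply/ffunP => j; rewrite !ffunE.
move=> _; rewrite (reindex_inj rev_ord_inj) /=.
by apply: eq_bigr => i _; rewrite ffunE rev_ordK.
Qed.

Lemma after_rev D j : after (revD D) (rev_ord j) = before D j.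
Proof.
apply/setP => i; apply/bigcupP/bigcupP => -[j' jj' ij'].
  exists (rev_ord j'); last by move: ij'; rewrite ffunE.
  move: jj' => /=; have := ltn_ord j; have := ltn_ord j'; lia.
exists (rev_ord j') => /=; last by rewrite ffunE rev_ordK.
have := ltn_ord j; have := ltn_ord j'; lia.
Qed.

Lemma suppsum_le_before (D : stup) : (forall j, D j != set0) ->
  suppsum D <= \prod_j stepc H (rad (D j)) (rad (D j :&: before D j)).
Proof.
move=> D0; rewrite -suppsum_rev.
have := suppsum_le_after (D := revD D); rewrite (reindex_inj rev_ord_inj) /=.
under eq_bigr do rewrite after_rev ffunE rev_ordK.
by apply => j; rewrite ffunE.
Qed.

(** Each element of the union is counted exactly once, at the first coordinate whose support
    contains it. *)
Lemma prod_rad_first (D : stup) :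
  (\prod_j rad (D j :\: before D j))%N = rad (\bigcup_j D j).
Proof.
suff claim m : (m <= k)%N -> (\prod_(j < k | (j < m)%N) rad (D j :\: before D j))%N =
    rad (\bigcup_(j < k | (j < m)%N) D j).
  rewrite [RHS](_ : _ = rad (\bigcup_(j < k | (j < k)%N) D j)).
    by rewrite -claim //; apply: eq_bigl => j; rewrite ltn_ord.
  by congr rad; apply: eq_bigl => j; rewrite ltn_ord.
elim: m => [_|m IH mk]; first by rewrite !big_pred0 // rad0.
pose o := Ordinal mk.
have lts (j : 'I_k) : (j < m.+1)%N && (j != o) = (j < m)%N.
  by rewrite ltnS -val_eqE /=; case: ltngtP.
rewrite (bigD1 o) //= (eq_bigl _ _ lts) IH ?(ltnW mk) //.
rewrite [in RHS](bigD1 o) //= (eq_bigl _ _ lts) -/(before D o) mulnC.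
rewrite [RHS](radID b _ (before D o)); congr (rad _ * rad _)%N.
  by rewrite setIC setUC setUK || (apply/setP => i; rewrite !inE; case: (i \in before D o); rewrite ?orbT ?andbF).
by rewrite setDUl setDv setU0.
Qed.

Lemma prod_rad_last (D : stup) :
  (\prod_j rad (D j :\: after D j))%N = rad (\bigcup_j D j).
Proof.
have before_rev j : before (revD D) (rev_ord j) = after D j.
  rewrite -after_rev rev_ordK; congr after; apply/ffunP => i.
  by rewrite !ffunE rev_ordK.
have := prod_rad_first (revD D); rewrite (reindex_inj rev_ord_inj) /=.
under eq_bigr do rewrite before_rev ffunE rev_ordK.
move=> ->; congr rad; rewrite [RHS](reindex_inj rev_ord_inj) /=.
by apply: eq_bigr => i _; rewrite ffunE.
Qed.

Definition logf (r : nat) : R := 2 + 2 * harm R r.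

Lemma logf_ge0 r : 0 <= logf r.
Proof. by rewrite addr_ge0 // mulr_ge0 // harm_ge0. Qed.

Lemma stepc_le r q : (0 < r)%N -> (q <= r)%N ->
  stepc H r q <= logf r * (Num.max (hcap H r) q%:R / r%:R).
Proof.
move=> r0 qr; rewrite /stepc [leRHS]mulrA ler_wpM2r ?invr_ge0 // /logf [leRHS]mulrDl.
have hq := harm_le R qr; have h0 := harm_ge0 R q.
have m0 : 0 <= Num.max (hcap H r) q%:R by rewrite le_max ler0n orbT.
apply: lerD; first by rewrite ler_wpM2l // le_max lexx.
rewrite -mulrA ler_wpM2l // mulrC ler_pM // le_max lexx orbT //.
Qed.

Lemma max_div_le1 r q : (0 < r)%N -> (q <= r)%N ->
  Num.max (hcap H r) q%:R / r%:R <= 1.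
Proof.
move=> r0 qr; rewrite ler_pdivrMr ?ltr0n // mul1r ge_max ler_nat qr andbT.
by rewrite /hcap ge_min lexx orbT.
Qed.

(** If [i] lay in no other support, [b i] would divide the total and all other coordinates, hence
    [x j] as well. *)
Lemma suppsum_cover D j i : suppsum D != 0 -> i \in D j ->
  exists2 j', j' != j & i \in D j'.
Proof.
move=> A0 iD.
have [x /andP[zx /eqP sx]] : exists x : tup, zerosum x && (supps x == D).
  case: (pickP (fun x : tup => zerosum x && (supps x == D))) => [x Px|P0].
    by exists x.
  by move: A0; rewrite /suppsum big_pred0 ?eqxx.
case: (pickP (fun j' => (j' != j) && (i \in D j'))) => [j' /andP[]|P0].
  by exists j'.
have : i \notin supp (x j).
  apply: zerosum_others => // j' jj'; have := P0 j'; rewrite jj' /= => /negbT.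
  by rewrite -sx ffunE.
by move: iD; rewrite -sx ffunE => ->.
Qed.

Lemma suppsum_ne0 D j : suppsum D != 0 -> D j != set0.
Proof.
apply: contra => /eqP Dj; apply/eqP; rewrite /suppsum big1 // => x /andP[_ /eqP sx].
apply/eqP/prodf_eq0; exists j => //=.
have : supp (x j) == set0 by rewrite -Dj -sx ffunE.
by rewrite supp_eq0 // => /eqP ->; rewrite wt0.
Qed.

(** The bounds for the two orders are multiplied. The parts [l] (of [r], not shared later) and [f]
    (not shared earlier) each multiply up to the radical of the union, which accounts for its square
    in the denominator. What remains is a comparison for each coordinate, where the two maxima
    collapse to a single [hcap]. *)
Lemma fundamental_sq D :
  suppsum D ^+ 2 <= \prod_j (logf (rad (D j)) ^+ 2 * hcap H (rad (D j))) /
    (rad (\bigcup_j D j))%:R ^+ 2.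
Proof.
have hl j : 0 <= logf (rad (D j)) ^+ 2 * hcap H (rad (D j)).
  by rewrite mulr_ge0 ?exprn_ge0 ?logf_ge0 ?hcap_ge0.
case: (eqVneq (suppsum D) 0) => [->|A0].
  by rewrite expr0n /= divr_ge0 ?exprn_ge0 ?ler0n //; apply: prodr_ge0.
have D0 j := suppsum_ne0 j A0.
rewrite expr2.
apply: (le_trans (ler_pM (suppsum_ge0 D) (suppsum_ge0 D)
   (suppsum_le_after D0) (suppsum_le_before D0))).
rewrite -big_split /= [X in _ / X]expr2.
rewrite -{1}prod_rad_last -prod_rad_first !natr_prod -big_split /=.
rewrite -prodfV -big_split /=.
apply: ler_prod => j _; rewrite mulr_ge0 ?stepc_ge0 //=.
set r := rad (D j); set q := rad (_ :&: after D j); set q' := rad (_ :&: before D j).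
set l := rad (_ :\: after D j); set f := rad (_ :\: before D j).
have r0 : (0 < r)%N by exact: rad_gt0.
have rq : r = (q * l)%N by rewrite /r (radID b _ (after D j)).
have rq' : r = (q' * f)%N by rewrite /r (radID b _ (before D j)).
have l0 : (0 < l)%N by exact: rad_gt0.
have f0 : (0 < f)%N by exact: rad_gt0.
have qr : (q <= r)%N by rewrite rq leq_pmulr.
have qr' : (q' <= r)%N by rewrite rq' leq_pmulr.
(* The parts counted by [l] and [f] are disjoint: an element of both would occur in the single
   support [D j], against [suppsum_cover]. *)
have lf : (l * f <= r)%N.
  rewrite -radU; first by rewrite rad_sub // subUset !subsetDl.
  rewrite -setI_eq0; apply/eqP/setP => i; rewrite !inE.
  apply/negbTE/negP => /andP[/andP[ia iD] /andP[ib _]].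
  have [j' jj' ij'] := suppsum_cover A0 iD.
  case: (ltngtP j j') => [jj|jj|/val_inj E]; last by rewrite E eqxx in jj'.
    by case/negP: ia; apply/bigcupP; exists j'.
  by case/negP: ib; apply/bigcupP; exists j'.
apply: (le_trans (ler_pM (stepc_ge0 _ _) (stepc_ge0 _ _)
   (stepc_le r0 qr) (stepc_le r0 qr'))).
rewrite mulrACA -expr2 -[leRHS]mulrA ler_wpM2l ?exprn_ge0 ?logf_ge0 //.
have h1 : 1 <= hcap H r by exact: hcap_ge1.
have hr : hcap H r <= r%:R by rewrite /hcap ge_min lexx orbT.
set h := hcap H r in h1 hr *.
have lR : (0 : R) < l%:R by rewrite ltr0n.
have fR : (0 : R) < f%:R by rewrite ltr0n.
have rR : (0 : R) < r%:R by rewrite ltr0n.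
have lfR : l%:R * f%:R <= r%:R :> R by rewrite -natrM ler_nat.
have fr : f%:R <= r%:R :> R by rewrite ler_nat rq' leq_pmull // -(ltn_pmul2r f0) mul0n -rq'.
have lr : l%:R <= r%:R :> R by rewrite ler_nat rq leq_pmull // -(ltn_pmul2r l0) mul0n -rq.
have -> : q%:R = r%:R / l%:R :> R by rewrite rq natrM mulfK // gt_eqF.
have -> : q'%:R = r%:R / f%:R :> R by rewrite rq' natrM mulfK // gt_eqF.
(* With [q = r / l] and [q' = r / f], the four cases use in turn [1 <= h], [f <= r], [l <= r], and
   finally [h <= r] together with [l f <= r]. *)
case: (leP h (r%:R / l%:R)) => _; case: (leP h (r%:R / f%:R)) => _.
- rewrite [leLHS](_ : _ = 1 / (l%:R * f%:R)); last by field; rewrite !gt_eqF.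
  by rewrite ler_wpM2r // invr_ge0 mulr_ge0 ?ler0n.
- rewrite [leLHS](_ : _ = h / (l%:R * r%:R)); last by field; rewrite !gt_eqF.
  rewrite ler_wpM2l ?(le_trans ler01 h1) // lef_pV2 ?posrE ?mulr_gt0 //.
  by rewrite ler_wpM2l // ltW.
- rewrite [leLHS](_ : _ = h / (r%:R * f%:R)); last by field; rewrite !gt_eqF.
  rewrite ler_wpM2l ?(le_trans ler01 h1) // lef_pV2 ?posrE ?mulr_gt0 //.
  by rewrite ler_wpM2r // ltW.
- rewrite mulf_div ler_pdivrMr ?mulr_gt0 // mulrAC ler_pdivlMr ?mulr_gt0 //.
  rewrite -mulrA ler_wpM2l ?(le_trans ler01 h1) //.
  by rewrite ler_pM ?mulr_ge0 ?ler0n // (le_trans ler01 h1).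
Qed.

End FundamentalLemma.

(** * Powers with real exponents *)

Section PowR.
Variable R : realType.
Implicit Types x y r s : R.

Lemma powR_le2 r x y : 0 <= r -> 0 <= x -> x <= y -> x `^ r <= y `^ r.
Proof.
by move=> r0 x0 xy; apply: ge0_ler_powR; rewrite // nnegrE // (le_trans x0).
Qed.

Lemma powR_le2N r x y : 0 <= r -> 0 < x -> x <= y -> y `^ (- r) <= x `^ (- r).
Proof.
move=> r0 x0 xy; rewrite !powRN lef_pV2 ?posrE ?powR_gt0 //; last exact: lt_le_trans xy.
by apply: powR_le2 => //; apply: ltW.
Qed.

Lemma powR_prod (I : finType) (P : pred I) (F : I -> R) r :
  (forall i, P i -> 0 <= F i) ->
  (\prod_(i | P i) F i) `^ r = \prod_(i | P i) F i `^ r.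
Proof.
move=> F0; have [] : 0 <= \prod_(i | P i) F i /\
    (\prod_(i | P i) F i) `^ r = \prod_(i | P i) F i `^ r; last by [].
apply: (big_rec2 (fun x y => 0 <= x /\ x `^ r = y)); first by rewrite powR1.
by move=> i x y Pi [x0 <-]; rewrite mulr_ge0 ?F0 // powRM ?F0.
Qed.

Lemma powRDp x r s : 0 < x -> x `^ (r + s) = x `^ r * x `^ s.
Proof. by move=> x0; rewrite powRD // lt0r_neq0 // implybT. Qed.

Lemma powR_ge1 x r : 1 <= x -> 0 <= r -> 1 <= x `^ r.
Proof. by move=> x1 r0; rewrite -(powRr0 x) ler_powR. Qed.

(** Split [A] as [A^s A^(1-s)] and use one of the two bounds on each factor. *)
Lemma powR_interp (A a X Y s : R) : 0 <= s <= 1 -> 0 <= A -> 0 <= a -> 0 <= X ->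
  0 <= Y -> A <= a * X -> A <= a * Y -> A <= a * (X `^ s * Y `^ (1 - s)).
Proof.
move=> /andP[s0 s1] A0 a0 X0 Y0 AX AY.
rewrite le_eqVlt in A0; case/orP: A0 => [/eqP <-|A0].
  by rewrite !mulr_ge0 // powR_ge0.
have agt0 : 0 < a.
  by rewrite lt0r a0 andbT; apply: contraTneq AX => ->; rewrite mul0r -ltNge.
have -> : A = A `^ s * A `^ (1 - s) by rewrite -powRDp // addrC subrK powRr1 // ltW.
have -> : a * (X `^ s * Y `^ (1 - s)) = (a * X) `^ s * (a * Y) `^ (1 - s).
  rewrite !powRM // mulrACA -powRDp // [s + _]addrC subrK powRr1 //.
apply: ler_pM; rewrite ?powR_ge0 //; apply: powR_le2 => //; rewrite ?subr_ge0 //;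
  exact: ltW.
Qed.

End PowR.

(** * Summation over the supports: all tuples, small and large denominators, triple coincidences *)

Section SupportSums.
Variables (R : realType) (n : nat) (b : 'I_n -> nat).
Hypothesis b_gt1 : forall i, (1 < b i)%N.
Hypothesis b_coprime : forall i j, i != j -> coprime (b i) (b j).
Variable H : R.
Hypothesis H1 : 1 <= H.
Variable k : nat.
Variables (th eps Kl Z : R).
Hypotheses (th_gt0 : 0 < th) (eps_gt0 : 0 < eps) (Kl_ge0 : 0 <= Kl).
Hypothesis logf_le : forall r, (0 < r)%N -> logf R r <= Kl * r%:R `^ eps.
Hypothesis zeta_le : \sum_i (b i)%:R `^ (- th) <= Z.

Local Notation M := (modulus b).
Local Notation rad := (rad b).
Local Notation supp := (supp b).
Local Notation wt := (wt b H).
Local Notation tup := {ffun 'I_k -> 'I_M}.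
Local Notation stup := {ffun 'I_k -> {set 'I_n}}.
Local Notation zerosum := (@zerosum n b k).
Local Notation supps := (@supps n b k).
Local Notation suppsum := (@suppsum R n b H k).
Local Notation radR D := ((rad D)%:R : R).

Lemma radR_ge1 D : 1 <= radR D.
Proof. by rewrite ler1n rad_gt0. Qed.

Lemma radR_gt0 D : 0 < radR D.
Proof. by rewrite ltr0n rad_gt0. Qed.

Lemma rad_powR D (r : R) : radR D `^ r = \prod_(i in D) (b i)%:R `^ r.
Proof. by rewrite natr_prod powR_prod. Qed.

(** Reduces the estimates that follow to a single tuple of supports: a decay [R^(-th)] in the
    radical of the union is what the Euler product can sum, at the cost [exp(2^k Z)]. *)
Lemma zsum_base (P : pred stup) (Bd : R) : 0 <= Bd ->
  (forall D, P D -> suppsum D <= Bd * radR (\bigcup_j D j) `^ (- th)) ->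
  \sum_(x : tup | zerosum x && P (supps x)) \prod_i wt (x i) <=
    Bd * expR (2 ^+ k * Z).
Proof.
move=> Bd0 PB; rewrite (partition_big supps P) /=; last by move=> x /andP[].
apply: (@le_trans _ _ (\sum_(D | P D) Bd * radR (\bigcup_j D j) `^ (- th))).
  apply: ler_sum => D PD; apply: le_trans (PB D PD).
  rewrite le_eqVlt; apply/orP; left; apply/eqP; apply: eq_bigl => x.
  by case: eqP => [->|]; rewrite ?andbF ?andbT // PD andbT.
apply: (@le_trans _ _ (\sum_(D : stup) Bd * radR (\bigcup_j D j) `^ (- th))).
  by apply: ler_sum_sub => // D _; rewrite mulr_ge0 // powR_ge0.
rewrite -mulr_sumr ler_wpM2l //.
under eq_bigr do rewrite rad_powR.
apply: le_trans (sum_support_tuples _ _) _ => [i|]; first exact: powR_ge0.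
by rewrite ler_expR ler_wpM2l // exprn_ge0.
Qed.

Lemma logf_prod (D : stup) :
  \prod_j logf R (rad (D j)) <= Kl ^+ k * radR (\bigcup_j D j) `^ (k%:R * eps).
Proof.
apply: (@le_trans _ _ (\prod_(j < k) (Kl * radR (\bigcup_j D j) `^ eps))).
  apply: ler_prod => j _; rewrite logf_ge0 /=.
  apply: (le_trans (logf_le (rad_gt0 b_gt1 _))); rewrite ler_wpM2l //.
  apply: powR_le2; rewrite ?ler0n ?(ltW eps_gt0) // ler_nat rad_sub //.
  exact: bigcup_sup.
by rewrite prodr_const card_ord exprMn -[X in _ * X <= _]powR_mulrn ?powR_ge0 // -powRrM [eps * _]mulrC.
Qed.

Variable j0 : 'I_k.
Hypothesis j0E : j0 = 0%N :> nat.

(** In the order that chooses [j0] last, this coordinate is determined by the others and costs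
    [hcap r / r] up to a logarithm; every other step is bounded by its logarithmic factor. *)
Lemma suppsum_trivial (D : stup) :
  suppsum D <= \prod_j logf R (rad (D j)) * (hcap H (rad (D j0)) / radR (D j0)).
Proof.
have pl : 0 <= \prod_j logf R (rad (D j)) by apply: prodr_ge0 => j _; apply: logf_ge0.
case: (eqVneq (suppsum D) 0) => [->|A0].
  by rewrite mulr_ge0 // divr_ge0 // hcap_ge0.
have D0 j := suppsum_ne0 b_coprime H1 j A0.
apply: (le_trans (suppsum_le_before b_gt1 b_coprime H1 D0)).
have le1 (j : 'I_k) : stepc H (rad (D j)) (rad (D j :&: before D j)) <= logf R (rad (D j)).
  apply: (le_trans (stepc_le _ _ _)); rewrite ?rad_gt0 ?rad_sub ?subsetIl //.
  rewrite ler_piMr ?logf_ge0 // max_div_le1 ?rad_gt0 ?rad_sub ?subsetIl //.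
rewrite (bigD1 j0) //= [X in _ <= X * _](bigD1 j0) //= [leRHS]mulrAC.
apply: ler_pM; rewrite ?stepc_ge0 //; first by apply: prodr_ge0 => j _; apply: stepc_ge0.
  apply: (le_trans (stepc_le _ _ _)); rewrite ?rad_gt0 ?rad_sub ?subsetIl //.
  rewrite ler_wpM2l ?logf_ge0 // ler_wpM2r ?invr_ge0 // ge_max lexx /=.
  have -> : D j0 :&: before D j0 = set0.
    apply/setP => i; rewrite !inE; apply/negbTE; rewrite negb_and; apply/orP; right.
    by apply/negP => /bigcupP[j]; rewrite j0E.
  by rewrite rad0 hcap_ge1 // rad_gt0.
by apply: ler_prod => j _; rewrite stepc_ge0 // le1.
Qed.

Lemma suppsum_fundamental (D : stup) :
  suppsum D <= \prod_j logf R (rad (D j)) *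
    (\prod_j hcap H (rad (D j)) `^ (2^-1) / radR (\bigcup_j D j)).
Proof.
have pl : 0 <= \prod_j logf R (rad (D j)) by apply: prodr_ge0 => j _; apply: logf_ge0.
have ph : 0 <= \prod_j hcap H (rad (D j)) `^ (2^-1).
  by apply: prodr_ge0 => j _; apply: powR_ge0.
rewrite -(@ler_pXn2r _ 2) ?nnegrE ?suppsum_ge0 ?mulr_ge0 ?invr_ge0 //.
apply: (le_trans (fundamental_sq b_gt1 b_coprime H1 D)).
rewrite exprMn expr_div_n mulrA ler_wpM2r ?invr_ge0 ?exprn_ge0 //.
rewrite big_split /= -!prodrXl le_eqVlt; apply/orP; left; apply/eqP; congr (_ * _).
apply: eq_bigr => j _.
have h0 : 0 < hcap H (rad (D j)) by rewrite (lt_le_trans ltr01) // hcap_ge1 // rad_gt0.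
by rewrite expr2 -powRDp // -[2^-1]mul1r -splitr powRr1 // ltW.
Qed.

Let s := th + k%:R * eps.
Hypothesis s_le1 : s <= 1.

Lemma s_ge0 : 0 <= s.
Proof. by rewrite addr_ge0 ?mulr_ge0 ?ler0n ?ltW. Qed.

(** Interpolation with weight [s] on the fundamental bound and [1 - s] on the trivial one. The
    logarithms cost [R^(k eps)], so the decay [R^(-s)] becomes [R^(-th)]; this is why [s] is
    [th + k eps]. *)
Lemma zsum_le (P : pred stup) (Bd : R) : 0 <= Bd ->
  (forall D, P D -> (forall j, D j != set0) ->
    \prod_j hcap H (rad (D j)) `^ (s / 2) *
      (hcap H (rad (D j0)) / radR (D j0)) `^ (1 - s) <= Bd) ->
  \sum_(x : tup | zerosum x && P (supps x)) \prod_i wt (x i) <=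
    Kl ^+ k * Bd * expR (2 ^+ k * Z).
Proof.
move=> Bd0 PB; apply: zsum_base; first by rewrite mulr_ge0 // exprn_ge0.
move=> D PD; set RD := radR _.
have RD0 : 0 < RD by exact: radR_gt0.
case: (eqVneq (suppsum D) 0) => [->|A0].
  by rewrite !mulr_ge0 ?exprn_ge0 ?powR_ge0.
have D0 j := suppsum_ne0 b_coprime H1 j A0.
have pl : 0 <= \prod_j logf R (rad (D j)) by apply: prodr_ge0 => j _; apply: logf_ge0.
have ph : 0 <= \prod_j hcap H (rad (D j)) `^ (2^-1).
  by apply: prodr_ge0 => j _; apply: powR_ge0.
have hr : 0 <= hcap H (rad (D j0)) / radR (D j0) by rewrite divr_ge0 // hcap_ge0.
have := powR_interp (s := s) _ (suppsum_ge0 b H1 D) pl _ hr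
  (suppsum_fundamental D) (suppsum_trivial D).
rewrite s_ge0 s_le1 => /(_ isT); rewrite divr_ge0 ?(ltW RD0) // => /(_ isT) Hle.
apply: (le_trans Hle).
rewrite powRM ?invr_ge0 ?(ltW RD0) // powR_prod; last by move=> j _; apply: powR_ge0.
under [X in _ * (X * _ * _) <= _]eq_bigr do rewrite -powRrM mulrC.
have -> : RD^-1 `^ s = RD `^ (- s) by rewrite -powR_inv1 ?ltW // -powRrM mulN1r.
set u := \prod_j logf _ _; set v := \prod_i _ `^ _; set w := (_ / _) `^ _.
rewrite [leLHS](_ : _ = (u * RD `^ (- s)) * (v * w)); last by ring.
rewrite [leRHS](_ : _ = (Kl ^+ k * RD `^ (- th)) * Bd); last by ring.
apply: ler_pM => //; first by rewrite mulr_ge0 ?powR_ge0.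
- by rewrite mulr_ge0 ?powR_ge0 //; apply: prodr_ge0 => j _; apply: powR_ge0.
- apply: le_trans (ler_wpM2r (powR_ge0 _ _) (logf_prod D)) _.
  rewrite -mulrA -powRDp // ler_wpM2l ?exprn_ge0 //.
  by rewrite le_eqVlt; apply/orP; left; apply/eqP; congr powR; rewrite /s; ring.
- exact: PB.
Qed.

Lemma hcap_pow (D : {set 'I_n}) (r : R) : 0 <= r -> hcap H (rad D) `^ r <= H `^ r.
Proof. by move=> r0; apply: powR_le2; rewrite ?hcap_ge0 // /hcap ge_min lexx. Qed.

Lemma hcap_div_le1 (D : {set 'I_n}) (r : R) : 0 <= r ->
  (hcap H (rad D) / radR D) `^ r <= 1.
Proof.
move=> r0; apply: (@le_trans _ _ (1 `^ r)); last by rewrite powR1.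
apply: powR_le2 => //; first by rewrite divr_ge0 // hcap_ge0.
by rewrite ler_pdivrMr ?radR_gt0 // mul1r /hcap ge_min lexx orbT.
Qed.

Lemma zsum_all :
  \sum_(x : tup | zerosum x) \prod_i wt (x i) <=
    Kl ^+ k * H `^ (k%:R * s / 2) * expR (2 ^+ k * Z).
Proof.
rewrite (eq_bigl (fun x : tup => zerosum x && xpredT (supps x))); last first.
  by move=> x; rewrite andbT.
apply: (zsum_le (P := xpredT)) => [|D _ _]; first exact: powR_ge0.
rewrite -[leRHS]mulr1; apply: ler_pM; rewrite ?powR_ge0 //.
- by apply: prodr_ge0 => j _; apply: powR_ge0.
- apply: (@le_trans _ _ (\prod_(j < k) H `^ (s / 2))).
    by apply: ler_prod => j _; rewrite powR_ge0 hcap_pow // divr_ge0 // s_ge0.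
  by rewrite prodr_const card_ord -powR_mulrn ?powR_ge0 // -powRrM mulrC mulrA.
- by apply: hcap_div_le1; rewrite subr_ge0.
Qed.

(** The gain comes from the factor [hcap(r)^(s/2) <= Y0^(s/2)] of the coordinate [j0], in place of
    [H^(s/2)]. *)
Lemma zsum_small (Y0 : R) : 0 < Y0 <= H ->
  \sum_(x : tup | zerosum x && (radR (supp (x j0)) < Y0)) \prod_i wt (x i) <=
    Kl ^+ k * (H `^ (k%:R * s / 2) * (Y0 / H) `^ (s / 2)) * expR (2 ^+ k * Z).
Proof.
move=> /andP[Y00 Y0H]; have H0 : 0 < H by exact: lt_le_trans H1.
rewrite (eq_bigl (fun x : tup => zerosum x &&
   [pred D : stup | radR (D j0) < Y0] (supps x))); last first.
  by move=> x /=; rewrite ffunE.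
have s20 : 0 <= s / 2 by rewrite divr_ge0 // s_ge0.
apply: (zsum_le (P := [pred D : stup | radR (D j0) < Y0])) => [|D /= DY _]; first by rewrite mulr_ge0 ?powR_ge0.
rewrite -[leRHS]mulr1; apply: ler_pM; rewrite ?powR_ge0 //.
- by apply: prodr_ge0 => j _; apply: powR_ge0.
- rewrite (bigD1 j0) //=.
  apply: (@le_trans _ _ (Y0 `^ (s / 2) * \prod_(j < k | j != j0) H `^ (s / 2))).
    apply: ler_pM; rewrite ?powR_ge0 //.
    + by apply: prodr_ge0 => j _; apply: powR_ge0.
    + apply: powR_le2; rewrite ?hcap_ge0 // /hcap ge_min; apply/orP; right; exact: ltW.
    + by apply: ler_prod => j _; rewrite powR_ge0 hcap_pow.
  have -> : Y0 `^ (s / 2) = H `^ (s / 2) * (Y0 / H) `^ (s / 2).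
    by rewrite -powRM ?divr_ge0 ?ltW // mulrCA mulfV ?mulr1 // gt_eqF.
  rewrite mulrAC ler_wpM2r ?powR_ge0 //.
  rewrite [leLHS](_ : _ = \prod_(j < k) H `^ (s / 2)); last by rewrite [RHS](bigD1 j0).
  by rewrite prodr_const card_ord -powR_mulrn ?powR_ge0 // -powRrM mulrC mulrA.
- by apply: hcap_div_le1; rewrite subr_ge0.
Qed.

(** Here the gain comes from the trivial bound, whose factor [hcap(r) / r] is at most [H / Y]. *)
Lemma zsum_large (Y : R) : H <= Y ->
  \sum_(x : tup | zerosum x && (Y < radR (supp (x j0)))) \prod_i wt (x i) <=
    Kl ^+ k * (H `^ (k%:R * s / 2) * (H / Y) `^ (1 - s)) * expR (2 ^+ k * Z).
Proof.
move=> YH; have H0 : 0 < H by exact: lt_le_trans H1.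
have Y0 : 0 < Y by exact: lt_le_trans YH.
rewrite (eq_bigl (fun x : tup => zerosum x &&
   [pred D : stup | Y < radR (D j0)] (supps x))); last first.
  by move=> x /=; rewrite ffunE.
have s20 : 0 <= s / 2 by rewrite divr_ge0 // s_ge0.
apply: (zsum_le (P := [pred D : stup | Y < radR (D j0)])) => [|D /= DY _]; first by rewrite mulr_ge0 ?powR_ge0.
apply: ler_pM; rewrite ?powR_ge0 //.
- by apply: prodr_ge0 => j _; apply: powR_ge0.
- apply: (@le_trans _ _ (\prod_(j < k) H `^ (s / 2))).
    by apply: ler_prod => j _; rewrite powR_ge0 hcap_pow.
  by rewrite prodr_const card_ord -powR_mulrn ?powR_ge0 // -powRrM mulrC mulrA.
- apply: powR_le2; rewrite ?subr_ge0 ?divr_ge0 ?hcap_ge0 //.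
  apply: ler_pM; rewrite ?invr_ge0 ?hcap_ge0 ?ler0n // ?lef_pV2 ?posrE ?radR_gt0 ?(ltW DY) //.
  by rewrite /hcap ge_min lexx.
Qed.

Definition triple (D : stup) : {set 'I_n} := [set i | (2 < #|[set j | i \in D j]|)%N].

Definition doubled (D : stup) := forall j i, i \in D j -> exists2 j', j' != j & i \in D j'.

(** Exchange the products over coordinates and over elements: an element of the union occurs in at
    least two supports, one of [triple D] in at least three. *)
Lemma rad_square_le (D : stup) : doubled D ->
  (rad (\bigcup_j D j) ^ 2 * rad (triple D) <= \prod_j rad (D j))%N.
Proof.
move=> Dd.
have -> : (\prod_j rad (D j) = \prod_i b i ^ #|[set j | i \in D j]|)%N.
  rewrite /rad (exchange_big_dep xpredT) //=; apply: eq_bigr => i _.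
  by rewrite -prod_nat_const; apply: eq_bigl => j; rewrite inE.
rewrite /rad expnS expn1 -mulnA [X in (X * _)%N]big_mkcond [X in (_ * (X * _))%N]big_mkcond.
rewrite [X in (_ * (_ * X))%N]big_mkcond /= -!big_split /=.
apply: leq_prod => i _; have bi : (0 < b i)%N by exact: ltnW.
case: (boolP (i \in \bigcup_j D j)) => [/bigcupP[j _ ij]|ni]; last first.
  case: ifP => [|_]; last by rewrite !muln1 expn_gt0 bi.
  rewrite inE => /ltnW /ltnW /card_gt0P[j]; rewrite inE => ij.
  by case/negP: ni; apply/bigcupP; exists j.
have [j' jj' ij'] := Dd j i ij.
have c2 : (2 <= #|[set j | i \in D j]|)%N.
  have <- : #|[set j; j']| = 2%N by rewrite cards2 eq_sym jj'.
  by apply: subset_leq_card; apply/subsetP => l; rewrite !inE => /orP[] /eqP ->.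
case: ifP; rewrite inE => c3.
  by rewrite mulnA -expnSr || rewrite (_ : (b i * (b i * b i) = b i ^ 3)%N) ?leq_exp2l // !expnS expn1 ?muln1.
by rewrite muln1 (_ : (b i * b i = b i ^ 2)%N) ?leq_exp2l.
Qed.

Lemma zerosum_doubled (x : tup) : zerosum x -> doubled (supps x).
Proof.
move=> zx j i; rewrite ffunE => ij.
case: (pickP (fun j' => (j' != j) && (i \in supp (x j')))) => [j' /andP[jj' ij']|P0].
  by exists j'; rewrite ?ffunE.
suff : i \notin supp (x j) by rewrite ij.
by apply: (zerosum_others zx) => j' jj'; have := P0 j'; rewrite /= jj' /= => /negbT.
Qed.

(* [R^2 * R3 <= \prod r_j <= Y^k], so inserting [(Y^k / (R^2 R3))^(t/2) >= 1] is free. *)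
Lemma rankin_weight (D : stup) (Y t : R) : 0 <= t -> doubled D ->
  (forall j, radR (D j) <= Y) ->
  1 <= Y `^ (k%:R * t / 2) * radR (\bigcup_j D j) `^ (- t) * radR (triple D) `^ (- (t / 2)).
Proof.
move=> t0 Dd DY.
have Y1 : 1 <= Y by apply: le_trans (DY j0); apply: radR_ge1.
have Y0 : 0 < Y by exact: lt_le_trans Y1.
set RD := radR (\bigcup_j D j); set R3 := radR _.
have RD0 : 0 < RD by exact: radR_gt0.
have R30 : 0 < R3 by exact: radR_gt0.
have : RD ^+ 2 * R3 <= Y ^+ k.
  apply: (@le_trans _ _ (\prod_j radR (D j))).
    by rewrite -natrX -natrM -natr_prod ler_nat rad_square_le.
  rewrite -[leRHS](_ : \prod_(j < k) Y = _); last by rewrite prodr_const card_ord.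
  by apply: ler_prod => j _; rewrite ler0n DY.
move=> RDY.
have : (RD ^+ 2 * R3) `^ (t / 2) <= (Y ^+ k) `^ (t / 2).
  by apply: powR_le2 => //; rewrite ?divr_ge0 // mulr_ge0 ?exprn_ge0 ?ltW.
rewrite powRM ?exprn_ge0 ?(ltW RD0) ?(ltW R30) //.
rewrite -(powR_mulrn 2%N (ltW RD0)) -(powR_mulrn k (ltW Y0)) -!powRrM.
have -> : 2%:R * (t / 2) = t by field.
move=> RDYt; rewrite !powRN -[leRHS]mulrA -invfM ler_pdivlMr ?mulr_gt0 ?powR_gt0 //.
by rewrite mul1r -mulrA.
Qed.

(** The decay in [R] is supplied by the Rankin weight on top of the trivial bound, and the same
    weight yields the power of [N3]. The price is that [H] is replaced by [Y]. *)
Lemma zsum_triple (Y N3 : R) : 1 <= Y -> 0 < N3 ->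
  \sum_(x : tup | zerosum x && [forall j, radR (supp (x j)) <= Y] &&
      (N3 <= radR (triple (supps x)))) \prod_i wt (x i) <=
    Kl ^+ k * (Y `^ (k%:R * s / 2) * N3 `^ (- (s / 2))) * expR (2 ^+ k * Z).
Proof.
move=> Y1 N30; have Y0 : 0 < Y by exact: lt_le_trans Y1.
rewrite (eq_bigl (fun x : tup => zerosum x &&
   [pred D : stup | [forall j, radR (D j) <= Y] && (N3 <= radR (triple D))]
     (supps x))); last first.
  by move=> x /=; rewrite andbA; congr (_ && _ && _); apply: eq_forallb => j; rewrite ffunE.
apply: (zsum_base (P := [pred D : stup | [forall j, radR (D j) <= Y] && (N3 <= radR (triple D))])); first by rewrite !mulr_ge0 ?exprn_ge0 ?powR_ge0.
move=> D /andP[/forallP DY D3]; set RD := radR _.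
have RD0 : 0 < RD by exact: radR_gt0.
case: (eqVneq (suppsum D) 0) => [->|A0].
  by rewrite !mulr_ge0 ?exprn_ge0 ?powR_ge0.
have Dd : doubled D by move=> j i; apply: suppsum_cover A0.
have pl : 0 <= \prod_j logf R (rad (D j)) by apply: prodr_ge0 => j _; apply: logf_ge0.
apply: (@le_trans _ _ (\prod_j logf R (rad (D j)))).
  apply: (le_trans (suppsum_trivial D)); rewrite ler_piMr //.
  by rewrite ler_pdivrMr ?radR_gt0 // mul1r /hcap ge_min lexx orbT.
apply: (le_trans (logf_prod D)).
rewrite -mulrA -mulrA ler_wpM2l ?exprn_ge0 //.
rewrite -[leLHS]mulr1.
apply: (@le_trans _ _ (RD `^ (k%:R * eps) *
    (Y `^ (k%:R * s / 2) * RD `^ (- s) * N3 `^ (- (s / 2))))).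
  rewrite ler_wpM2l ?powR_ge0 //; apply: (le_trans (rankin_weight s_ge0 Dd DY)).
  rewrite ler_wpM2l ?mulr_ge0 ?powR_ge0 //; apply: powR_le2N => //.
  by rewrite divr_ge0 // s_ge0.
have -> : RD `^ (- th) = RD `^ (k%:R * eps) * RD `^ (- s).
  by rewrite -powRDp //; congr powR; rewrite /s; ring.
by rewrite le_eqVlt; apply/orP; left; apply/eqP; ring.
Qed.

End SupportSums.

(** * Tuples with denominators at most [Y] *)

Section RangeSums.
Variables (R : realType) (n : nat) (b : 'I_n -> nat).
Hypothesis b_gt1 : forall i, (1 < b i)%N.
Hypothesis b_coprime : forall i j, i != j -> coprime (b i) (b j).
Variable H : R.
Hypothesis H1 : 1 <= H.
Variable k : nat.
Variables (th eps Kl Kd Z Y : R).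
Hypotheses (th_gt0 : 0 < th) (eps_gt0 : 0 < eps) (Kl_ge0 : 0 <= Kl) (Kd_ge0 : 0 <= Kd).
Hypothesis Y_ge1 : 1 <= Y.
Hypothesis logf_le : forall r, (0 < r)%N -> logf R r <= Kl * r%:R `^ eps.
Hypothesis divisor_le : forall D : {set 'I_n}, 2 ^+ #|D| <= Kd * (rad b D)%:R `^ eps.
Hypothesis zeta_le : \sum_i (b i)%:R `^ (- th) <= Z.

Local Notation M := (modulus b).
Local Notation rad := (rad b).
Local Notation supp := (supp b).
Local Notation wt := (wt b H).
Local Notation tup := {ffun 'I_k -> 'I_M}.
Local Notation zerosum := (@zerosum n b k).
Local Notation supps := (@supps n b k).
Local Notation radR D := ((rad D)%:R : R).

(** An Euler product with factor 2 at [i \in U], where membership in [D] carries no weight, and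
    [1 + b_i^(-th)] elsewhere. *)
Lemma sum_rad_setD (U : {set 'I_n}) :
  \sum_(D : {set 'I_n}) radR (D :\: U) `^ (- th) <= 2 ^+ #|U| * expR Z.
Proof.
pose t i : R := (b i)%:R `^ (- th).
have t0 i : 0 <= t i by exact: powR_ge0.
pose F i : R := if i \in U then 1 else t i.
have -> : \sum_(D : {set 'I_n}) radR (D :\: U) `^ (- th) = \prod_i (F i + 1).
  rewrite bigA_distr /=; apply: eq_bigr => D _.
  rewrite rad_powR big_mkcond /=; apply: eq_bigr => i _; rewrite !inE /F.
  by case: (i \in U) => //=; case: (i \in D).
apply: (@le_trans _ _ (\prod_i ((if i \in U then 2 else 1) * expR (t i)))).
  apply: ler_prod => i _; rewrite /F; have := expR_ge1Dx (t i); have := t0 i.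
  by case: ifP => _; lra.
rewrite big_split /= -expR_sum -big_mkcond /= prodr_const.
by rewrite ler_wpM2l ?exprn_ge0 // ler_expR.
Qed.

Definition okv (v : 'I_M) : bool := (0 < v)%N && (radR (supp v) <= Y).

(** For a fixed support, a coordinate summed without any congruence condition costs only a
    logarithm. The sum over supports stays bounded because elements outside the set [U] already
    covered carry the weight [b_i^(-th)]. *)
Lemma step_sum (U : {set 'I_n}) :
  \sum_(v | okv v) wt v * radR (supp v :\: U) `^ (- th) <=
    Kl * Y `^ eps * (2 ^+ #|U| * expR Z).
Proof.
have KY : 0 <= Kl * Y `^ eps by rewrite mulr_ge0 // powR_ge0.
rewrite (partition_big (fun v : 'I_M => supp v)
   (fun D => (D != set0) && (radR D <= Y))) /=; last first.
  by move=> v /andP[v0 vY]; rewrite supp_eq0 // -lt0n v0.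
apply: (@le_trans _ _ (\sum_(D : {set 'I_n} | (D != set0) && (radR D <= Y))
    Kl * Y `^ eps * radR (D :\: U) `^ (- th))).
  apply: ler_sum => D /andP[D0 DY].
  rewrite (eq_bigr (fun v : 'I_M => wt v * radR (D :\: U) `^ (- th))); last first.
    by move=> v /andP[_ /eqP ->].
  rewrite -mulr_suml ler_wpM2r ?powR_ge0 //.
  apply: (@le_trans _ _ (\sum_(v : 'I_M | supp v == D) wt v)).
    by apply: ler_sum_sub => [v /andP[]|v _] //; apply: wt_ge0.
  apply: (le_trans (supp_sum b_gt1 b_coprime H1 D0)).
  apply: (le_trans (stepc_le H (rad_gt0 b_gt1 D) (leqnn _))).
  apply: (@le_trans _ _ (logf R (rad D))).
    by rewrite ler_piMr ?logf_ge0 // max_div_le1 // rad_gt0.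
  apply: (le_trans (logf_le (rad_gt0 b_gt1 D))); rewrite ler_wpM2l //.
  by apply: powR_le2 => //; apply: ltW.
apply: (@le_trans _ _ (\sum_(D : {set 'I_n}) Kl * Y `^ eps * radR (D :\: U) `^ (- th))).
  by apply: ler_sum_sub => // D _; rewrite mulr_ge0 // powR_ge0.
by rewrite -mulr_sumr ler_wpM2l // sum_rad_setD.
Qed.

Definition pre (m : nat) (y : tup) : {set 'I_n} :=
  \bigcup_(i < k | (i < m)%N) supp (y i).
Definition okm (m : nat) (y : tup) : bool :=
  [forall i : 'I_k, (i < m)%N ==> okv (y i)].

Lemma rad_bigcup_le (P : pred 'I_k) (D : 'I_k -> {set 'I_n}) :
  (rad (\bigcup_(i | P i) D i) <= \prod_(i | P i) rad (D i))%N.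
Proof.
apply: (big_rec2 (fun E p => rad E <= p)%N); first by rewrite rad0.
move=> i p E Pi Ep; apply: leq_trans (leq_mul (leqnn _) Ep).
rewrite (radID b _ (D i)) setUK leq_mul2l; apply/orP; right.
by apply: rad_sub => //; rewrite setDUl setDv set0U subsetDl.
Qed.

Lemma pow2_pre_le m y : okm m y -> 2 ^+ #|pre m y| <= Kd * Y `^ (k%:R * eps).
Proof.
move=> /forallP ok; apply: (le_trans (divisor_le _)); rewrite ler_wpM2l //.
rewrite powRrM powR_mulrn; last exact: le_trans ler01 Y_ge1.
apply: powR_le2; rewrite ?ler0n ?(ltW eps_gt0) //.
apply: (@le_trans _ _ (\prod_(i < k | (i < m)%N) rad (supp (y i)))%:R).
  by rewrite ler_nat rad_bigcup_le.
rewrite natr_prod big_mkcond /=.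
rewrite -[leRHS](_ : \prod_(i < k) Y = _); last by rewrite prodr_const card_ord.
apply: ler_prod => i _; have := ok i; case: ifP => _ /=.
  by move=> /andP[_ ->]; rewrite ler0n.
by move=> _; rewrite ler01.
Qed.

Lemma pre_upd_ge (m : 'I_k) j y v : (j <= m)%N -> pre j (upd y m v) = pre j y.
Proof.
move=> jm; apply: eq_bigr => i ij; rewrite ffunE; case: eqP => // E.
by move: ij; rewrite E ltnNge jm.
Qed.

Lemma pre_upd (m : 'I_k) y v : pre m.+1 (upd y m v) = pre m y :|: supp v.
Proof.
rewrite /pre (bigD1 m) //= ffunE eqxx setUC; congr (_ :|: _).
apply: eq_big => i; first by rewrite ltnS -val_eqE /=; case: ltngtP.
by move=> /andP[_ /negPf im]; rewrite ffunE im.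
Qed.

Lemma pre_sub i j y : (i <= j)%N -> pre i y \subset pre j y.
Proof.
move=> ij; apply/bigcupsP => l li; apply: (bigcup_max l) => //.
exact: leq_trans li ij.
Qed.

Lemma okm_upd (m : 'I_k) y v : okm m.+1 (upd y m v) = okm m y && okv v.
Proof.
apply/forallP/andP => [ok|[/forallP ok okvv] i].
  split; last by have := ok m; rewrite ltnSn ffunE eqxx.
  apply/forallP => i; have := ok i; rewrite ffunE ltnS; case: eqP => [->|_].
    by rewrite ltnn.
  by move=> /implyP oki; apply/implyP => im; apply: oki; exact: ltnW.
rewrite ffunE ltnS; case: eqP => [_|/eqP im]; first by rewrite okvv implybT.
by rewrite leq_eqVlt val_eqE (negPf im) /=.
Qed.

Lemma radU_setD_pow (D E : {set 'I_n}) (r : R) :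
  radR (D :|: E) `^ r = radR D `^ r * radR (E :\: D) `^ r.
Proof.
by rewrite (radID b _ D) setUK setDUl setDv set0U natrM powRM.
Qed.

Definition stepK : R := Kl * Y `^ eps * (Kd * Y `^ (k%:R * eps) * expR Z).

Lemma stepK_ge0 : 0 <= stepK.
Proof. by rewrite !mulr_ge0 ?powR_ge0 ?expR_ge0. Qed.

(** All coordinates but [a] are summed freely, each paying [stepK]; the zero-sum condition enters
    only through [Q] at step [a]. The elements first met at step [a] carry no weight, since that
    step is controlled by [Q] alone. *)
Lemma range_sum (a : 'I_k) (Q : pred tup) (ca : R) : 0 <= ca ->
  (forall x y : tup, (forall i : 'I_k, (i <= a)%N -> x i = y i) -> Q x = Q y) ->
  (forall y, okm a y -> \sum_(v | okv v && Q (upd y a v)) wt v <= ca) ->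
  \sum_(x : tup | okm k x && Q x) (\prod_i wt (x i) *
     (radR (pre a x) `^ (- th) * radR (pre k x :\: pre a.+1 x) `^ (- th)))
  <= ca * stepK ^+ k.-1.
Proof.
move=> ca0 Qdep Qsum; have c0 := stepK_ge0.
pose d (i : 'I_k) : R := if i == a then ca else stepK.
have d0 i : 0 <= d i by rewrite /d; case: ifP.
(* The part of the Rankin weight collected after [m] steps. *)
pose W (m : nat) (y : tup) : R := if (m <= a)%N then radR (pre m y) `^ (- th) else
  radR (pre a y) `^ (- th) * radR (pre m y :\: pre a.+1 y) `^ (- th).
have W0 m y : 0 <= W m y by rewrite /W; case: ifP => _; rewrite ?mulr_ge0 ?powR_ge0.
pose psi (m : nat) (y : tup) : R := (okm m y && ((a < m)%N ==> Q y))%:R *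
  \prod_(i < k) (if (i < m)%N then wt (y i) else d i) * W m y.
have psi0 : psi 0%N (default_tup b_gt1 k) <= ca * stepK ^+ k.-1.
  rewrite /psi /W leq0n /= [pre 0 _]big_pred0 // rad0 powR1 mulr1.
  rewrite (eq_bigr d) // (bigD1 a) //= {1}/d eqxx.
  rewrite (eq_bigr (fun=> stepK)); last by move=> i /negPf ia; rewrite /d ia.
  rewrite prodr_const cardC1 card_ord.
  by case: (_ && _); rewrite ?mul1r // mul0r mulr_ge0 // exprn_ge0.
apply: le_trans psi0.
have -> : \sum_(x : tup | okm k x && Q x) (\prod_i wt (x i) *
     (radR (pre a x) `^ (- th) * radR (pre k x :\: pre a.+1 x) `^ (- th)))
     = \sum_x psi k x.
  rewrite big_mkcond /=; apply: eq_bigr => x _; rewrite /psi /W ltn_ord /= leqNgt ltn_ord /=.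
  case: ifP => _; rewrite ?mul0r // mul1r; congr (_ * _).
  by apply: eq_bigr => i _; rewrite ltn_ord.
apply: potential_sum => m y; rewrite /psi.
set P' := \prod_(i < k | i != m) (if (i < m)%N then wt (y i) else d i).
have P'0 : 0 <= P'.
  by apply: prodr_ge0 => i _; case: ifP => // _; apply: wt_ge0.
have prodE v : \prod_(i < k) (if (i < m.+1)%N then wt (upd y m v i) else d i) = wt v * P'.
  rewrite (bigD1 m) //= ltnSn ffunE eqxx; congr (_ * _); apply: eq_bigr => i im.
  by rewrite ltnS leq_eqVlt val_eqE (negPf im) /= ffunE (negPf im).
have prodE0 : \prod_(i < k) (if (i < m)%N then wt (y i) else d i) = d m * P'.
  by rewrite (bigD1 m) //= ltnn.
rewrite prodE0; under eq_bigr do rewrite prodE okm_upd.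
case: (boolP (okm m y)) => okmy /=; last first.
  by rewrite mul0r mul0r big1 // => v _; rewrite mul0r mul0r.
have stp : \sum_(v | okv v) wt v * radR (supp v :\: pre m y) `^ (- th) <= stepK.
  apply: (le_trans (step_sum _)); rewrite ler_wpM2l ?mulr_ge0 ?powR_ge0 //.
  by rewrite ler_wpM2r ?expR_ge0 // pow2_pre_le.
case: (ltngtP m a) => [ma|am|/val_inj E].
- have dm : d m = stepK by rewrite /d; case: eqP ma => // ->; rewrite ltnn.
  have am1 : (a < m.+1)%N = false by rewrite ltnS leqNgt ma.
  rewrite dm /= mul1r /W (ltnW ma) ma.
  under eq_bigr do rewrite am1 pre_upd radU_setD_pow implyFb andbT.
  rewrite (eq_bigr (fun v => if okv v then P' * radR (pre m y) `^ (- th) *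
     (wt v * radR (supp v :\: pre m y) `^ (- th)) else 0)); last first.
    by move=> v _; case: okv; rewrite ?mul0r // mul1r; ring.
  rewrite -big_mkcond -mulr_sumr [leRHS](_ : _ = P' * radR (pre m y) `^ (- th) * stepK).
    by rewrite ler_wpM2l // mulr_ge0 ?powR_ge0.
  by ring.
- have dm : d m = stepK by rewrite /d; case: eqP am => // ->; rewrite ltnn.
  have QE v : Q (upd y m v) = Q y.
    apply: Qdep => i ia; rewrite ffunE; case: eqP => // E; move: am; rewrite -E ltnNge ia //.
  have am1 : (a < m.+1)%N by rewrite ltnS ltnW.
  have ma1 : (m < a)%N = false by rewrite ltnNge (ltnW am).
  have ma2 : (m <= a)%N = false by rewrite leqNgt am.
  rewrite dm /= /W ma1 ma2.
  under eq_bigr do rewrite am1 QE pre_upd !pre_upd_ge ?(ltnW am) //=.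
  case: (Q y); last first.
    by rewrite mul0r mul0r big1 // => v _; rewrite andbF mul0r mul0r.
  rewrite mul1r (eq_bigr (fun v => if okv v then P' * radR (pre a y) `^ (- th) *
     radR (pre m y :\: pre a.+1 y) `^ (- th) *
     (wt v * radR (supp v :\: pre m y) `^ (- th)) else 0)); last first.
    move=> v _; case: okv; rewrite ?mul0r //= mul1r setDUl.
    rewrite radU_setD_pow.
    have -> : supp v :\: pre a.+1 y :\: (pre m y :\: pre a.+1 y) = supp v :\: pre m y.
      apply/setP => i; rewrite !inE; have /subsetP /(_ i) := pre_sub y am.
      by case: (i \in pre a.+1 y) => /= [/(_ isT) ->|_]; rewrite ?andbF.
    by ring.
  rewrite -big_mkcond -mulr_sumr [leRHS](_ : _ = P' * radR (pre a y) `^ (- th) *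
     radR (pre m y :\: pre a.+1 y) `^ (- th) * stepK).
    by rewrite ler_wpM2l // !mulr_ge0 ?powR_ge0.
  by ring.
- rewrite E ltnSn /= mul1r /d eqxx /W leqnn ltnn.
  under eq_bigr do rewrite pre_upd_ge // setDv rad0 powR1 mulr1.
  rewrite (eq_bigr (fun v => if okv v && Q (upd y a v) then P' * radR (pre a y) `^ (- th) *
     wt v else 0)); last first.
    by move=> v _; case: (_ && _); rewrite ?mul0r // mul1r; ring.
  rewrite -big_mkcond -mulr_sumr [leRHS](_ : _ = P' * radR (pre a y) `^ (- th) * ca).
    by rewrite ler_wpM2l ?mulr_ge0 ?powR_ge0 // Qsum // -E.
  by ring.
Qed.

Variable j0 : 'I_k.

Lemma okmT x : okm k x -> forall j, radR (supps x j) <= Y.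
Proof.
by move=> /forallP ok j; have := ok j; rewrite ltn_ord ffunE => /andP[].
Qed.

Lemma preT x : \bigcup_j supps x j = pre k x.
Proof. by apply: eq_big => i; rewrite ?ltn_ord ?ffunE // => _; rewrite ffunE. Qed.

Lemma zerosum_upd (y : tup) (a : 'I_k) v v' :
  zerosum (upd y a v) -> zerosum (upd y a v') -> v = v'.
Proof.
rewrite !zerosum_unfold !(bigD1 a (P := xpredT)) //= !ffunE eqxx.
have E w : (\sum_(i < k | i != a) upd y a w i = \sum_(i < k | i != a) y i)%N.
  by apply: eq_bigr => i /negPf ia; rewrite ffunE ia.
rewrite !E => /eqP s1 /eqP s2; apply: val_inj => /=.
rewrite -(modn_small (ltn_ord v)) -(modn_small (ltn_ord v')); apply/eqP.
by rewrite -(eqn_modDr (\sum_(i < k | i != a) y i)) s1 s2.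
Qed.

(** The zero-sum condition leaves at most one value for the last coordinate, so its step costs just
    its weight, at most [kap]. The weights [R^(-th)] are inserted at the price [Y^(k th / 2)]. *)
Lemma range_last (a : 'I_k) (kap : R) : a.+1 = k -> 0 <= kap ->
  \sum_(x : tup | [&& zerosum x, okm k x & wt (x a) <= kap]) \prod_i wt (x i) <=
    Y `^ (k%:R * th / 2) * (kap * stepK ^+ k.-1).
Proof.
move=> ak kap0.
pose Q (x : tup) := zerosum x && (wt (x a) <= kap).
have main := @range_sum a Q kap kap0.
apply: (@le_trans _ _ (\sum_(x : tup | okm k x && Q x) (Y `^ (k%:R * th / 2) *
   (\prod_i wt (x i) *
     (radR (pre a x) `^ (- th) * radR (pre k x :\: pre a.+1 x) `^ (- th)))))).
  rewrite (eq_bigl (fun x => okm k x && Q x)); last first.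
    by move=> x; rewrite /Q andbCA.
  apply: ler_sum => x /andP[okx /andP[zx _]].
  have w0 : 0 <= \prod_i wt (x i) by apply: prodr_ge0 => i _; apply: wt_ge0.
  rewrite mulrCA -[leLHS]mulr1 ler_wpM2l //.
  apply: (le_trans (rankin_weight b_gt1 j0 (ltW th_gt0) (zerosum_doubled zx) (okmT okx))).
  rewrite -mulrA ler_wpM2l ?powR_ge0 // preT.
  apply: ler_pM; rewrite ?powR_ge0 //.
    apply: powR_le2N; rewrite ?(ltW th_gt0) ?radR_gt0 // ler_nat rad_sub //.
    by apply: pre_sub; exact: ltnW.
  rewrite ak setDv rad0 powR1; have := radR_ge1 R b_gt1 (triple (supps x)).
  rewrite powRN => r1; rewrite invf_le1 ?powR_gt0 ?(lt_le_trans ltr01 r1) //.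
  by apply: powR_ge1; rewrite // divr_ge0 // ltW.
rewrite -mulr_sumr ler_wpM2l ?powR_ge0 //; apply: main.
  move=> x y xy; have -> : x = y; last by [].
  by apply/ffunP => i; apply: xy; rewrite -ltnS ak.
move=> y _; case: (pickP (fun v => okv v && Q (upd y a v))) => [v0 Pv0|P0]; last first.
  by rewrite big_pred0.
rewrite (bigD1 v0) //= big1 ?addr0.
  by case/andP: Pv0 => _ /andP[_]; rewrite ffunE eqxx.
move=> v /andP[/andP[_ /andP[zv _]] /eqP nv].
by case/andP: Pv0 => _ /andP[zv0 _]; case: nv; apply: zerosum_upd zv zv0.
Qed.

(** Once the earlier coordinates are chosen, [x a] is undetermined only modulo these elements. *)
Definition midset (a : 'I_k) (x : tup) : {set 'I_n} :=
  supp (x a) :&: after (supps x) a.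

(** An element of [midset a x] either occurs also before [a], and then belongs to [triple], or is
    first met at [a]. So [N0] is at most the product of the radicals of [triple] and of the elements
    new at [a], and the Rankin factors attached to these two give [N0^(-th/2)]. *)
Lemma mid_weight (a : 'I_k) (x : tup) (N0 : R) : 0 < N0 -> zerosum x -> okm k x ->
  N0 <= radR (midset a x) ->
  1 <= Y `^ (k%:R * th / 2) * N0 `^ (- (th / 2)) *
     (radR (pre a x) `^ (- th) * radR (pre k x :\: pre a.+1 x) `^ (- th)).
Proof.
move=> N00 zx okx qN.
have th20 : 0 <= th / 2 by rewrite divr_ge0 // ltW.
apply: (le_trans (rankin_weight b_gt1 j0 (ltW th_gt0) (zerosum_doubled zx) (okmT okx))).
rewrite -!mulrA ler_wpM2l ?powR_ge0 // preT.
set A := pre a x; set S := supp (x a); set T := pre k x :\: pre a.+1 x.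
set R3 := triple (supps x).
have -> : pre k x = (A :|: S) :|: T.
  have -> : A :|: S = pre a.+1 x.
    have := pre_upd a x (x a); suff -> : upd x a (x a) = x by move=> ->.
    by apply/ffunP => i; rewrite ffunE; case: eqP => // ->.
  rewrite /T; apply/setP => i; rewrite !inE; have /subsetP /(_ i) := pre_sub x (ltn_ord a).
  by case: (i \in pre a.+1 x) => //= ->.
rewrite 2!radU_setD_pow.
have -> : T :\: (A :|: S) = T.
  have -> : A :|: S = pre a.+1 x.
    have := pre_upd a x (x a); suff -> : upd x a (x a) = x by move=> ->.
    by apply/ffunP => i; rewrite ffunE; case: eqP => // ->.
  by rewrite /T; apply/setP => i; rewrite !inE; case: (i \in pre a.+1 x).
set u := radR A `^ _; set w := radR T `^ _.
rewrite [leLHS](_ : _ = (u * w) * (radR (S :\: A) `^ (- th) * radR R3 `^ (- (th / 2)))); last by ring.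
rewrite [leRHS](_ : _ = (u * w) * N0 `^ (- (th / 2))); last by ring.
rewrite ler_wpM2l ?mulr_ge0 ?powR_ge0 //.
apply: (@le_trans _ _ ((radR (S :\: A) * radR R3) `^ (- (th / 2)))).
  rewrite powRM // ler_wpM2r ?powR_ge0 //; apply: ler_powR; first exact: radR_ge1.
  by rewrite lerN2; lra.
apply: powR_le2N => //; apply: (le_trans qN).
rewrite -natrM ler_nat /midset (radID b _ A) mulnC leq_mul //; apply: rad_sub => //.
  by apply: setSD; apply: subsetIl.
apply/subsetP => i; rewrite !inE ffunE || rewrite !inE.
move=> /andP[/andP[iS /bigcupP[j' aj' ij']] /bigcupP[j ja ij]].
have ne1 : j != a by rewrite -val_eqE neq_ltn ja.
have ne2 : j' != a by rewrite -val_eqE neq_ltn aj' orbT.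
have ne3 : j != j' by rewrite -val_eqE neq_ltn (ltn_trans ja aj').
apply: leq_trans (subset_leq_card (A := [set a; j; j']) _).
  by rewrite cardsU1 !inE cards2 ne3 eq_sym (negPf ne1) eq_sym || rewrite -setUA cardsU1 cards2 ne3 !inE negb_or ![a == _]eq_sym ne1 ne2.
apply/subsetP => l; rewrite !inE => /orP[/orP[]|] /eqP ->; rewrite ffunE //.
  by rewrite inE.
by move: ij'; rewrite ffunE.
Qed.

Definition midK (N1 Y0 : R) : R := let T := Num.truncn (N1 ^+ 2) in
  Kd * Y `^ (k%:R * eps) * ((2 * H + 2 * ((2 * T)%:R * harm R (2 * T))) / Y0).

(** Two admissible [v], [v'] agree modulo [b i] for [i] in [L] and for [i] outside both supports.
    Their difference is thus a multiple of [M / m] for a divisor [m <= N1^2] of [M], and the points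
    are spaced by about [M / T]. *)
Lemma mid_spaced (a : 'I_k) (s : nat) (L : {set 'I_n}) (N1 Y0 : R) : 1 <= N1 -> 0 < Y0 ->
  \sum_(v : 'I_M | [&& (0 < v)%N, Y0 <= radR (supp v), L \subset supp v,
      radR (supp v :\: L) <= N1 & [forall (i | i \in L), b i %| v + s]%N]) wt v <=
  (let T := Num.truncn (N1 ^+ 2) in
    (2 * H + 2 * ((2 * T)%:R * harm R (2 * T))) / Y0).
Proof.
move=> N11 Y00 /=; set T := Num.truncn _.
have N10 : 0 <= N1 by exact: le_trans ler01 N11.
have T0 : (0 < T)%N by rewrite truncn_gt0 exprn_ege1.
set E := [set v : 'I_M | [&& (0 < v)%N, Y0 <= radR (supp v), L \subset supp v,
      radR (supp v :\: L) <= N1 & [forall (i | i \in L), b i %| v + s]%N]].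
rewrite (eq_bigl (fun v => v \in E)); last by move=> v; rewrite inE.
apply: (@le_trans _ _ (\sum_(v in E) Num.min H (M%:R / (ndist b v)%:R) / Y0)).
  apply: ler_sum => v; rewrite inE => /and5P[v0 vY _ _ _].
  rewrite !wt_unfold ler_wpM2l ?lef_pV2 ?posrE ?radR_gt0 //.
  by rewrite le_min (le_trans ler01 H1) divr_ge0.
rewrite -mulr_suml ler_wpM2r ?invr_ge0 ?(ltW Y00) //.
(* The integer quotient may be 0, hence the maximum with 1; the rounding is what turns [T] into
   [2 * T] in the bound. *)
pose g := maxn 1 (M %/ T).
have g0 : (0 < g)%N by rewrite /g leq_max.
have Mg : (M <= 2 * T * g)%N.
  have := divn_eq M T; have := ltn_pmod M T0; rewrite /g; case: (M %/ T)%N => [|q].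
    by rewrite mul0n => + ->; rewrite maxn0; lia.
  by rewrite max1n || (rewrite (maxn_idPr _) //); nia.
apply: (le_trans (@spaced_sum n b R E g H g0 _ _ _)).
- exact: le_trans ler01 H1.
- by move=> v; rewrite inE => /and5P[].
- move=> v v' vE v'E vv'.
  have gap : (rad (~: ((supp v :\: L) :|: (supp v' :\: L))) <= v' - v)%N.
    apply: congr_gap => // i iD.
    move: vE v'E; rewrite !inE => /and5P[_ _ _ _ /forallP /(_ i) vL].
    move=> /and5P[_ _ _ _ /forallP /(_ i) v'L]; move: vL v'L iD.
    case: (boolP (i \in L)) => iL /=; rewrite !inE iL /=.
      by move=> /eqP v1 /eqP v2 _; apply/eqP; rewrite -(eqn_modDr s) v1 v2.
    by rewrite !negb_or !negbK => _ _ /andP[/eqP -> /eqP ->].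
  apply: leq_trans gap; rewrite geq_max rad_gt0 //=.
  have rT : (rad (supp v :\: L :|: supp v' :\: L) <= T)%N.
    rewrite truncn_ge_nat ?exprn_ge0 //.
    have le2 : (rad (supp v :\: L :|: supp v' :\: L) <=
        rad (supp v :\: L) * rad (supp v' :\: L))%N.
      rewrite (radID b _ (supp v :\: L)) setUK leq_mul2l; apply/orP; right.
      by apply: rad_sub => //; rewrite setDUl setDv set0U subsetDl.
    apply: (@le_trans _ _ (rad (supp v :\: L) * rad (supp v' :\: L))%:R).
      by rewrite ler_nat.
    move: vE v'E; rewrite !inE => /and5P[_ _ _ vN _] /and5P[_ _ _ v'N _].
    by rewrite natrM expr2 ler_pM.
  have divM X : (M %/ rad X)%N = rad (~: X) by rewrite -(radC b X) mulKn // rad_gt0.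
  by rewrite -divM leq_div2l // rad_gt0.
- rewrite lerD2l ler_wpM2l //; apply: ler_pM; rewrite ?divr_ge0 ?harm_ge0 //.
    by rewrite ler_pdivrMr ?ltr0n // -natrM ler_nat.
  by apply: harm_le; rewrite -(mulnK (2 * T)%N g0) leq_div2r.
Qed.

(** [L] is the part of the denominator of [x a] not shared later. Quantifying over [L] makes the
    condition depend on the coordinates up to [a] only, as [range_sum] demands. The zero-sum
    condition forces [L] into the earlier supports, which leaves at most [2^#|pre a x|] choices. *)
Lemma range_mid (a : 'I_k) (N0 N1 Y0 : R) : 0 < N0 -> 1 <= N1 -> 0 < Y0 ->
  \sum_(x : tup | [&& zerosum x, okm k x, Y0 <= radR (supp (x a)) &
      N0 <= radR (midset a x) <= N1]) \prod_i wt (x i) <=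
    Y `^ (k%:R * th / 2) * N0 `^ (- (th / 2)) * (midK N1 Y0 * stepK ^+ k.-1).
Proof.
move=> N00 N11 Y00.
pose S (x : tup) : nat := (\sum_(i < k | (i < a)%N) x i)%N.
pose Q (x : tup) : bool := [exists L : {set 'I_n}, (L \subset pre a x) &&
   [&& (0 < x a)%N, Y0 <= radR (supp (x a)), L \subset supp (x a),
      radR (supp (x a) :\: L) <= N1 & [forall (i | i \in L), b i %| x a + S x]%N]].
set C := _ * _ `^ _; have C0 : 0 <= C by rewrite mulr_ge0 // powR_ge0.
apply: (@le_trans _ _ (\sum_(x : tup | okm k x && Q x) (C *
   (\prod_i wt (x i) *
     (radR (pre a x) `^ (- th) * radR (pre k x :\: pre a.+1 x) `^ (- th)))))).
  apply: (@le_trans _ _ (\sum_(x : tup | [&& zerosum x, okm k x, Y0 <= radR (supp (x a)) &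
      N0 <= radR (midset a x) <= N1]) (C *
   (\prod_i wt (x i) *
     (radR (pre a x) `^ (- th) * radR (pre k x :\: pre a.+1 x) `^ (- th)))))).
    apply: ler_sum => x /and4P[zx okx _ /andP[qN _]].
    have w0 : 0 <= \prod_i wt (x i) by apply: prodr_ge0 => i _; apply: wt_ge0.
    rewrite mulrCA -[leLHS]mulr1 ler_wpM2l //.
    exact: mid_weight.
  apply: ler_sum_sub => [x /and4P[zx okx xY /andP[_ qN]]|x _]; last first.
    rewrite !mulr_ge0 ?powR_ge0 //; apply: prodr_ge0 => i _; exact: wt_ge0.
  rewrite okx /=; apply/existsP; exists (supp (x a) :\: after (supps x) a).
  have xa0 : (0 < x a)%N by move/forallP: okx => /(_ a); rewrite ltn_ord => /andP[].
  have notafter i : i \in supp (x a) :\: after (supps x) a ->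
      forall j : 'I_k, (a < j)%N -> i \notin supp (x j).
    rewrite inE => /andP[ia _] j aj; apply: contra ia => ij.
    by apply/bigcupP; exists j => //; rewrite ffunE.
  apply/andP; split.
    apply/subsetP => i iL; have := notafter i iL; move: iL; rewrite inE => /andP[_ ia] nj.
    have [j' jj' ij'] := zerosum_doubled zx (j := a) (i := i) ltac:(by rewrite ffunE).
    move: ij'; rewrite ffunE => ij'; apply/bigcupP; exists j' => //.
    case: (ltngtP j' a) => // [aj'|/val_inj E]; last by rewrite E eqxx in jj'.
    by have := nj _ aj'; rewrite ij'.
  rewrite xa0 xY subsetDl setDDr setDv set0U qN /=.
  apply/forallP => i; apply/implyP => iL.
  have /(dvdn_trans (b_dvd_modulus b i)) := zx.
  rewrite (bigD1 a) //= (bigID (fun j : 'I_k => (j < a)%N)) /= addnA dvdn_addl.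
    rewrite (eq_bigl (fun j : 'I_k => (j < a)%N)) // => j /=.
    by case: (ltngtP j a) => //; rewrite ?andbT ?andbF // => jm; rewrite -val_eqE /= ltn_eqF.
  apply: dvdn_sum => j /andP[ja]; rewrite -leqNgt leq_eqVlt val_eqE eq_sym (negPf ja) /=.
  by move/(notafter i iL); rewrite suppP.
rewrite -mulr_sumr ler_wpM2l //; apply: range_sum.
- rewrite /midK !mulr_ge0 ?powR_ge0 ?invr_ge0 ?(ltW Y00) // addr_ge0 ?mulr_ge0 ?harm_ge0 ?ler0n //.
  exact: le_trans ler01 H1.
- move=> x y xy; rewrite /Q; apply: eq_existsb => L.
  have -> : pre a x = pre a y by apply: eq_bigr => i /ltnW /xy ->.
  have -> : S x = S y by apply: eq_bigr => i /ltnW /xy ->.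
  by rewrite xy.
- move=> y oky.
  apply: (@le_trans _ _ (\sum_(L in powerset (pre a y)) \sum_(v : 'I_M | [&& (0 < v)%N, Y0 <= radR (supp v), L \subset supp v,
      radR (supp v :\: L) <= N1 & [forall (i | i \in L), b i %| v + S y]%N]) wt v)).
    rewrite (exchange_big_dep xpredT) //= big_mkcond /=; apply: ler_sum => v _.
    case: ifP => [/andP[_ /existsP[L /andP[Lp HL]]]|_]; last first.
      by apply: sumr_ge0 => L _; apply: wt_ge0.
    have SE : S (upd y a v) = S y.
      by apply: eq_bigr => i ia; rewrite ffunE; case: eqP ia => // ->; rewrite ltnn.
    move: Lp HL; rewrite pre_upd_ge // SE !ffunE eqxx => Lp HL.
    rewrite (bigD1 L) /=; last by rewrite powersetE Lp.
    by rewrite lerDl; apply: sumr_ge0 => L' _; apply: wt_ge0.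
  apply: (@le_trans _ _ (\sum_(L in powerset (pre a y)) (let T := Num.truncn (N1 ^+ 2) in
    (2 * H + 2 * ((2 * T)%:R * harm R (2 * T))) / Y0))).
    by apply: ler_sum => L _; apply: mid_spaced.
  rewrite sumr_const card_powerset /midK /= -[leLHS]mulr_natl natrX ler_wpM2r ?pow2_pre_le //.
  rewrite mulr_ge0 ?invr_ge0 ?(ltW Y00) // addr_ge0 ?mulr_ge0 ?harm_ge0 ?ler0n //.
  exact: le_trans ler01 H1.
Qed.

End RangeSums.

Section UnionBound.
Variables (R : realType) (T : finType) (F : T -> R).
Hypothesis F_ge0 : forall x, 0 <= F x.

Lemma ler_sum_or (P Q1 Q2 : pred T) :
  (forall x, P x -> F x != 0 -> Q1 x \/ Q2 x) ->
  \sum_(x | P x) F x <= \sum_(x | Q1 x) F x + \sum_(x | Q2 x) F x.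
Proof.
move=> PQ; rewrite (big_mkcond P) (big_mkcond Q1) (big_mkcond Q2) -big_split /=.
apply: ler_sum => x _; have F0 := F_ge0 x.
case: (boolP (P x)) => [Px|_]; last by case: ifP; case: ifP => _ _; rewrite ?addr0 ?add0r ?addr_ge0.
case: (eqVneq (F x) 0) => [->|Fx0]; first by do 2!case: ifP => _; rewrite addr0.
by case: (PQ x Px Fx0) => ->; case: ifP => _; rewrite ?addr0 ?add0r ?lerDl ?lerDr.
Qed.

Lemma ler_sum_exists (I : finType) (P : pred T) (Q : I -> pred T) :
  (forall x, P x -> F x != 0 -> exists i, Q i x) ->
  \sum_(x | P x) F x <= \sum_i \sum_(x | Q i x) F x.
Proof.
move=> PQ; rewrite (exchange_big_dep xpredT) //= big_mkcond /=.
apply: ler_sum => x _; case: (boolP (P x)) => [Px|_]; last first.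
  by apply: sumr_ge0.
case: (eqVneq (F x) 0) => [->|Fx0]; first by rewrite big1.
have [i Qi] := PQ x Px Fx0; rewrite (bigD1 i) //= lerDl.
by apply: sumr_ge0.
Qed.

End UnionBound.

(** * Unmatched tuples *)

Section Unmatched.
Variables (R : realType) (n : nat) (b : 'I_n -> nat).
Hypothesis b_gt1 : forall i, (1 < b i)%N.
Hypothesis b_coprime : forall i j, i != j -> coprime (b i) (b j).
Variable H : R.
Hypothesis H1 : 1 <= H.
Variable k : nat.
Local Notation M := (modulus b).
Local Notation rad := (rad b).
Local Notation supp := (supp b).
Local Notation wt := (wt b H).
Local Notation tup := {ffun 'I_k -> 'I_M}.
Local Notation zerosum := (@zerosum n b k).
Local Notation supps := (@supps n b k).
Local Notation radR D := ((rad D)%:R : R).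

Definition permt (p : 'S_k) (x : tup) : tup := [ffun i => x (p i)].

Lemma permt_inj p : injective (permt p).
Proof.
move=> x y /ffunP E; apply/ffunP => i; have := E ((p^-1)%g i).
by rewrite !ffunE permKV.
Qed.

Lemma zerosum_permt p x : zerosum (permt p x) = zerosum x.
Proof.
rewrite !zerosum_unfold [in RHS](reindex_inj (@perm_inj _ p)) /=; congr dvdn.
by apply: eq_bigr => i _; rewrite ffunE.
Qed.

Lemma prod_permt p x (F : 'I_M -> R) : \prod_i F (permt p x i) = \prod_i F (x i).
Proof.
rewrite [RHS](reindex_inj (@perm_inj _ p)) /=.
by apply: eq_bigr => i _; rewrite ffunE.
Qed.

Lemma sum_permt p (P : pred tup) :
  \sum_(x | P (permt p x)) \prod_i wt (x i) = \sum_(x | P x) \prod_i wt (x i).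
Proof.
rewrite [RHS](reindex_inj (@permt_inj p)) /=.
by apply: eq_bigr => x _; rewrite (prod_permt p x (fun v => wt v)).
Qed.

Lemma okm_permt (Y : R) p x : okm Y k (permt p x) = okm Y k x.
Proof.
apply/forallP/forallP => ok i; last by rewrite ltn_ord ffunE; have := ok (p i); rewrite ltn_ord.
by have := ok ((p^-1)%g i); rewrite !ltn_ord ffunE permKV.
Qed.

Variable j0 : 'I_k.
Hypothesis j0E : j0 = 0%N :> nat.

(** The coordinates of [A] are listed first, then [j0], then the rest. This turns [qset A] into a
    [midset], so that [range_mid] applies to any set [A]. *)
Lemma order_perm (A : {set 'I_k}) : j0 \notin A ->
  exists p : 'S_k, exists2 a : 'I_k, p a = j0 &
    forall i : 'I_k, (a < i)%N = (p i \notin A) && (p i != j0).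
Proof.
move=> jA.
pose t := enum (~: (j0 |: A)); pose s := enum A ++ j0 :: t.
have us : uniq s.
  rewrite cat_uniq /= !enum_uniq /= andbT; apply/andP; split.
    rewrite negb_or mem_enum jA /=; apply/hasPn => i; rewrite !mem_enum !inE.
    by rewrite negb_or => /andP[].
  by rewrite mem_enum !inE eqxx.
have ss : size s = k.
  have := cardsC (j0 |: A); rewrite cardsU1 jA card_ord /s size_cat /= /t -!cardE /=.
  by rewrite addnS add1n addSn.
have finj : injective (fun i : 'I_k => nth j0 s i).
  by move=> i j /eqP; rewrite nth_uniq ?ss // => /eqP /val_inj.
have lA : (#|A| < k)%N by rewrite cardE; have := ss; rewrite size_cat /=; lia.
exists (perm finj), (Ordinal lA); first by rewrite permE nth_cat -cardE /= ltnn subnn.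
move=> i; rewrite permE /=; case: (ltngtP #|A| i) => iA /=.
- have -> : nth j0 s i = nth j0 t (i - #|A|).-1.
    rewrite nth_cat -cardE ltnNge (ltnW iA) /=.
    by case: (i - #|A|)%N (subn_gt0 #|A| i) => //; rewrite iA.
  have : nth j0 t (i - #|A|).-1 \in t.
    have sE : (size (enum A) + (size t).+1 = k)%N by have := ss; rewrite size_cat.
    have iA' : (size (enum A) < i)%N by rewrite -cardE.
    have ik := ltn_ord i.
    by apply: mem_nth; rewrite cardE; move: (size _) (size t) sE iA' ik => u w; lia.
  by rewrite mem_enum !inE negb_or andbC => ->.
- apply/esym/negbTE; rewrite negb_and negbK; apply/orP; left.
  rewrite nth_cat -cardE iA -mem_enum; apply: mem_nth; by rewrite -cardE.
- by rewrite nth_cat -cardE -iA ltnn subnn /= eqxx andbF.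
Qed.

Definition qset (A : {set 'I_k}) (x : tup) : {set 'I_n} :=
  [set i in supp (x j0) | [exists j, [&& j \notin A, j != j0 & i \in supp (x j)]]].

Lemma qset_mid (A : {set 'I_k}) (p : 'S_k) (a : 'I_k) x : p a = j0 ->
  (forall i : 'I_k, (a < i)%N = (p i \notin A) && (p i != j0)) ->
  midset a (permt p x) = qset A x.
Proof.
move=> pa pA; apply/setP => i; rewrite /midset !inE ffunE pa; congr (_ && _).
apply/bigcupP/existsP => [[j aj ij]|[j /and3P[jA jj0 ij]]].
  exists (p j); move: ij; rewrite !ffunE => ->; rewrite andbT.
  by move: aj; rewrite pA.
by exists ((p^-1)%g j); rewrite ?pA ?permKV ?jA ?jj0 // !ffunE permKV.
Qed.

Lemma rad_setU_le (D E : {set 'I_n}) : (rad (D :|: E) <= rad D * rad E)%N.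
Proof.
rewrite (radID b _ D) setUK leq_mul2l; apply/orP; right.
by apply: rad_sub => //; rewrite setDUl setDv set0U subsetDl.
Qed.

Lemma trichotomy (x : tup) (N0 N1 N3 Y Y0 : R) : zerosum x -> okm Y k x ->
  Y0 <= radR (supp (x j0)) -> 1 < N0 -> N0 <= N1 -> N1 < Y0 -> 0 < N3 ->
  Y * N0 * N3 <= N1 ^+ 2 ->
  radR (triple (supps x)) < N3 ->
  (exists2 t, t != j0 & radR (qset [set t] x) < N0) \/
  (exists2 A : {set 'I_k}, j0 \notin A & N0 <= radR (qset A x) <= N1).
Proof.
move=> zx okx xY0 N01 N0N1 N1Y N30 YN tN.
pose A (m : nat) := [set j : 'I_k | (j <= m)%N & j != j0].
have dbl i : i \in supp (x j0) -> exists2 j, j != j0 & i \in supp (x j).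
  move=> ij; have [j jj] := zerosum_doubled zx (j := j0) (i := i) ltac:(by rewrite ffunE).
  by rewrite ffunE => ij'; exists j.
have N10 : 0 < N1 by rewrite (lt_le_trans _ N0N1) // (lt_trans ltr01).
have k0 : (0 < k)%N by apply: leq_ltn_trans (ltn_ord j0).
have exm : exists m, (radR (qset (A m) x) <= N1).
  exists k; have -> : qset (A k) x = set0.
    apply/setP => i; rewrite !inE; apply/negbTE; rewrite negb_and; apply/orP; right.
    by apply/existsP => -[j]; rewrite !inE ltnW //=; case: (j != j0).
  by rewrite rad0 (le_trans (ltW N01)).
case: (ex_minnP exm) => m mN mmin.
have q0 : N1 < radR (qset (A 0%N) x).
  have -> : qset (A 0%N) x = supp (x j0).
    apply/setP => i; rewrite /qset in_set; case: (boolP (i \in supp (x j0))) => //= /dbl[j jj ij].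
    apply/existsP; exists j; rewrite jj ij !inE jj andbT /= leqn0 -j0E val_eqE jj //.
  exact: lt_le_trans xY0.
have m0 : (0 < m)%N by rewrite lt0n; apply: contraTneq mN => ->; rewrite -ltNge.
case: (leP N0 (radR (qset (A m) x))) => [N0m|mN0].
  right; exists (A m); last by rewrite N0m.
  by rewrite !inE eqxx andbF.
have qm1 : N1 < radR (qset (A m.-1) x).
  by rewrite ltNge; apply/negP => /mmin; rewrite -ltnS prednK // ltnn.
have mk : (m < k)%N.
  rewrite ltnNge; apply/negP => km; have : qset (A m.-1) x = set0.
    apply/setP => i; rewrite !inE; apply/negbTE; rewrite negb_and; apply/orP; right.
    apply/existsP => -[j]; rewrite !inE; case: (j != j0) => //=; rewrite ?andbF ?andbT //.
    by rewrite -ltnS prednK // (leq_trans (ltn_ord j)).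
  by move=> E; move: qm1; rewrite E rad0 ltNge (le_trans (ltW N01)).
pose t := Ordinal mk.
have tj0 : t != j0 by rewrite -val_eqE /= j0E -lt0n.
(* An element lost together with [t] is shared with [x t]. Either a third support contains it, so
   that it lies in [triple], or it is outside [qset [set t] x]. *)
have qle : (rad (qset (A m.-1) x) <= rad (qset (A m) x) *
    (rad (triple (supps x)) * rad (supp (x j0) :\: qset [set t] x)))%N.
  apply: leq_trans (leq_mul (leqnn _) (rad_setU_le _ _)).
  apply: leq_trans (rad_setU_le _ _); apply: rad_sub => //.
  apply/subsetP => i; rewrite in_setU in_setU in_setD.
  case: (boolP (i \in qset (A m) x)) => //= iqm; rewrite {1}/qset in_set => /andP[i0].
  move=> /existsP[j /and3P[jA jj ij]]; rewrite i0 andbT.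
  have jt : j = t.
    apply: val_inj => /=; move: jA; rewrite inE jj andbT -ltnNge => mj.
    move: iqm; rewrite in_set i0 /= negb_exists => /forallP /(_ j).
    rewrite jj ij andbT inE jj !andbT negbK => jm; apply/eqP.
    by rewrite eqn_leq jm -(prednK m0).
  case: (boolP (i \in qset [set t] x)) => [|_]; last by rewrite orbT.
  rewrite in_set i0 => /existsP[l /and3P[lt lj il]].
  rewrite orbF inE; apply: leq_trans (subset_leq_card (A := [set j0; t; l]) _).
    rewrite inE in lt.
    by rewrite -setUA cardsU1 cards2 !inE negb_or ![j0 == _]eq_sym tj0 lj [t == l]eq_sym lt.
  apply/subsetP => u; rewrite !inE => /orP[/orP[]|] /eqP ->; rewrite ffunE //.
  by rewrite -jt.
(* The jump gives [d > N1 / (N0 N3)]. With [q d = r <= Y] this yields [q N1 <= Y N0 N3 <= N1^2]. *)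
have q1 : radR (qset [set t] x) <= N1.
  have sub : qset [set t] x \subset supp (x j0) by apply/subsetP => i; rewrite in_set => /andP[].
  have := radID b (supp (x j0)) (qset [set t] x); rewrite (setIidPr sub) => rE.
  have r0Y : radR (supp (x j0)) <= Y by have := okmT okx j0; rewrite ffunE.
  set q := rad (qset [set t] x) in rE *; set d := rad (_ :\: _) in rE qle.
  have d0 : (0 : R) < d%:R by rewrite ltr0n rad_gt0.
  have h1 : N1 < N0 * (N3 * d%:R).
    apply: (lt_le_trans qm1); apply: (@le_trans _ _ (radR (qset (A m) x) *
        (radR (triple (supps x)) * d%:R))).
      by rewrite -!natrM ler_nat.
    apply: ler_pM; rewrite ?mulr_ge0 ?ler0n ?(ltW mN0) //.
    by rewrite ler_wpM2r ?ler0n // ltW.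
  move: r0Y; rewrite rE natrM => qdY.
  rewrite -(ler_pM2r N10) -expr2; apply: le_trans YN.
  have q0' : (0 : R) <= q%:R by rewrite ler0n.
  apply: (@le_trans _ _ (q%:R * (N0 * (N3 * d%:R)))); first by rewrite ler_wpM2l // ltW.
  rewrite [leLHS](_ : _ = q%:R * d%:R * (N0 * N3)); last by ring.
  rewrite -[leRHS]mulrA ler_wpM2r // mulr_ge0 ?(ltW N30) //.
  exact: le_trans ler01 (ltW N01).
case: (leP N0 (radR (qset [set t] x))) => [N0q|qN0]; last by left; exists t.
by right; exists [set t]; rewrite ?inE 1?eq_sym // N0q.
Qed.

Lemma ndist_modD (x y : 'I_M) : (ndist b ((x + y) %% M) <= ndist b x + ndist b y)%N.
Proof.
rewrite /ndist; have := ltn_ord x; have := ltn_ord y.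
case: (ltnP (x + y) M) => xy; first by rewrite modn_small //; lia.
have -> : ((x + y) %% M = x + y - M)%N.
  by rewrite -{1}(subnK xy) modnDr modn_small; have := ltn_ord x; have := ltn_ord y; lia.
lia.
Qed.

(** Away from the elements shared with other coordinates, [x j0] and [x t] cancel, so their sum is a
    nonzero fraction with denominator dividing that of [qset [set t] x :|: E']. It is at distance at
    least [1 / (q e')] from 0, so one of the summands is at half that distance or more. Since the
    supports agree off the shared parts, [r_t <= Y] and [r_(j0) >= Y0] give [e' <= q Y / Y0]. *)
Lemma near_match (x : tup) (t : 'I_k) (N0 Y Y0 : R) : zerosum x -> okm Y k x ->
  (forall j, Y0 <= radR (supp (x j))) -> 0 < Y0 -> t != j0 ->
  ~~ (M %| x j0 + x t)%N -> radR (qset [set t] x) < N0 ->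
  wt (x j0) <= 2 * N0 ^+ 2 * Y / Y0 ^+ 2 \/ wt (x t) <= 2 * N0 ^+ 2 * Y / Y0 ^+ 2.
Proof.
move=> zx okx xY0 Y00 tj0 nM qN.
pose others i := [exists j, [&& j \notin [set t], j != j0 & i \in supp (x j)]].
pose E' := [set i in supp (x t) | others i].
have cong i : ~~ others i -> (b i %| x j0 + x t)%N.
  move=> ni; have /(dvdn_trans (b_dvd_modulus b i)) := zx.
  rewrite (bigD1 j0) //= (bigD1 t) //= addnA dvdn_addl //.
  apply: dvdn_sum => j /andP[jj jt]; rewrite -suppP; apply: contra ni => ij.
  by apply/existsP; exists j; rewrite inE jt jj ij.
have Ed i : i \notin qset [set t] x :|: E' -> (b i %| x j0 + x t)%N.
  rewrite !inE -/(others i); case: (boolP (others i)) => [oi|/cong //].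
  by rewrite !andbT negb_or !negbK => /andP[]; apply: dvdn_add.
have same : supp (x t) :\: E' = supp (x j0) :\: qset [set t] x.
  apply/setP => i; rewrite !inE -/(others i); case: (boolP (others i)) => [|/cong bd].
    by rewrite !andbT !andNb.
  rewrite !andbF /=; congr (~~ _); apply/idP/idP => h.
    by move: bd; rewrite dvdn_addl.
  by move: bd; rewrite dvdn_addr.
have r0 : radR (supp (x j0)) = radR (qset [set t] x) * radR (supp (x j0) :\: qset [set t] x).
  rewrite -natrM; congr (_%:R); rewrite {1}(radID b _ (qset [set t] x)); congr (_ * _)%N.
  by congr rad; apply/setIidPr/subsetP => i; rewrite in_set => /andP[].
have rt : radR (supp (x t)) = radR E' * radR (supp (x j0) :\: qset [set t] x).
  rewrite -natrM -same; congr (_%:R); rewrite {1}(radID b _ E'); congr (_ * _)%N.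
  by congr rad; apply/setIidPr/subsetP => i; rewrite in_set => /andP[].
set q := radR (qset _ _) in r0 qN; set e' := radR E' in rt; set d := radR (_ :\: _) in r0 rt.
have tY : radR (supp (x t)) <= Y by have := okmT okx t; rewrite ffunE.
have d0 : 0 < d by exact: radR_gt0.
have q0 : 0 < q by exact: radR_gt0.
have e0 : 0 < e' by exact: radR_gt0.
have N00 : 0 < N0 by exact: lt_trans qN.
have Yp : 0 < Y by rewrite (lt_le_trans _ tY) // radR_gt0.
have e'Y : e' * Y0 <= Y * q.
  have := xY0 j0; rewrite r0 => h1; move: tY; rewrite rt => h2.
  apply: (@le_trans _ _ (e' * (q * d))); first by rewrite ler_wpM2l // ltW.
  by rewrite mulrCA mulrC ler_wpM2r // ltW.
have eb : q * e' <= N0 ^+ 2 * Y / Y0.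
  rewrite ler_pdivlMr // -mulrA; apply: (@le_trans _ _ (q * (Y * q))).
    by rewrite ler_wpM2l // ltW.
  by rewrite mulrCA mulrC expr2 ler_wpM2r ?(ltW Yp) // ler_pM // ltW.
have Mnd : M%:R <= N0 ^+ 2 * Y / Y0 * ((ndist b (x j0))%:R + (ndist b (x t))%:R).
  have M0 : (0 < M)%N by exact: modulus_gt0.
  have := @ndist_ge _ b b_coprime (qset [set t] x :|: E') ((x j0 + x t) %% M).
  rewrite ltn_pmod // lt0n => /(_ _ _) Hn.
  have {Hn} Hn : (M <= rad (qset [set t] x :|: E') * ndist b ((x j0 + x t) %% M))%N.
    apply: Hn; first by rewrite andbT; exact: nM.
    move=> i /Ed bd; rewrite /dvdn modn_dvdm // b_dvd_modulus //.
  apply: (@le_trans _ _ (q * e' * ((ndist b (x j0))%:R + (ndist b (x t))%:R))).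
    rewrite -natrD -!natrM ler_nat; apply: (leq_trans Hn).
    by apply: leq_mul; [exact: rad_setU_le | exact: ndist_modD].
  by rewrite ler_wpM2r // addr_ge0.
have fin j : M%:R <= N0 ^+ 2 * Y / Y0 * (2 * (ndist b (x j))%:R) ->
    wt (x j) <= 2 * N0 ^+ 2 * Y / Y0 ^+ 2.
  move=> hM; apply: (le_trans (@wt_le_ndist n b R H (x j))).
  have nd0 : (0 : R) < (ndist b (x j))%:R.
    rewrite lt0r ler0n andbT; apply: contraTneq hM => ->; rewrite !mulr0 -ltNge.
    by rewrite ltr0n modulus_gt0.
  have -> : 2 * N0 ^+ 2 * Y / Y0 ^+ 2 = (N0 ^+ 2 * Y / Y0 * 2) / Y0.
    by field; rewrite gt_eqF.
  apply: ler_pM; rewrite ?divr_ge0 ?invr_ge0 ?ler0n //.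
    by rewrite ler_pdivrMr // -[leRHS]mulrA.
  by rewrite lef_pV2 ?posrE ?radR_gt0.
have C0 : 0 <= N0 ^+ 2 * Y / Y0 by rewrite !mulr_ge0 ?invr_ge0 ?exprn_ge0 ?ltW.
case: (leP (ndist b (x j0)) (ndist b (x t))) => ht.
  right; apply: fin; apply: (le_trans Mnd); rewrite ler_wpM2l // mulr_natl mulr2n lerD2r ler_nat //.
left; apply: fin; apply: (le_trans Mnd); rewrite ler_wpM2l // mulr_natl mulr2n lerD2l ler_nat ltnW //.
Qed.

Definition unmatched (x : tup) : bool :=
  [forall j, (j != j0) ==> ~~ (M %| x j0 + x j)%N].

Variables (th eps Kl Kd Z Y Y0 N0 Nh N1 N3 : R).
Hypotheses (th_gt0 : 0 < th) (eps_gt0 : 0 < eps) (Kl_ge0 : 0 <= Kl) (Kd_ge0 : 0 <= Kd).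
Hypothesis logf_le : forall r, (0 < r)%N -> logf R r <= Kl * r%:R `^ eps.
Hypothesis divisor_le : forall D : {set 'I_n}, 2 ^+ #|D| <= Kd * (rad D)%:R `^ eps.
Hypothesis zeta_le : \sum_i (b i)%:R `^ (- th) <= Z.
Let s := th + k%:R * eps.
Hypothesis s_le1 : s <= 1.
Hypotheses (Y0_gt0 : 0 < Y0) (Y0_le : Y0 <= H) (H_le : H <= Y).
Hypotheses (N0_gt1 : 1 < N0) (N0h : N0 <= Nh) (Nh1 : Nh <= N1) (N1_lt : N1 < Y0) (N3_gt0 : 0 < N3).
Hypothesis N_cond : Y * N0 * N3 <= N1 ^+ 2.

Let KE := expR (2 ^+ k * Z).
Definition small_bound :=
  Kl ^+ k * (H `^ (k%:R * s / 2) * (Y0 / H) `^ (s / 2)) * KE.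
Definition large_bound :=
  Kl ^+ k * (H `^ (k%:R * s / 2) * (H / Y) `^ (1 - s)) * KE.
Definition triple_bound :=
  Kl ^+ k * (Y `^ (k%:R * s / 2) * N3 `^ (- (s / 2))) * KE.
Definition last_bound := Y `^ (k%:R * th / 2) *
  (2 * N0 ^+ 2 * Y / Y0 ^+ 2 * stepK k eps Kl Kd Z Y ^+ k.-1).
Definition mid_bound (A B : R) := Y `^ (k%:R * th / 2) * A `^ (- (th / 2)) *
  (midK H k eps Kd Y B Y0 * stepK k eps Kl Kd Z Y ^+ k.-1).

Lemma wt_prod_ge0 (x : tup) : 0 <= \prod_i wt (x i).
Proof. by apply: prodr_ge0 => i _; apply: wt_ge0. Qed.

(** The middle range is cut at [Nh] because choosing a coordinate whose shared part is at most [B]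
    costs about [max(H, B^2) / Y0], against a gain that is a power of the lower end. With the values
    chosen later, [N_cond] pushes [N1] above the square root of [H]; there only a lower end as large
    as [Nh] pays for the excess of [N1^2] over [H]. *)
Lemma unmatched_sum :
  \sum_(x : tup | zerosum x && unmatched x) \prod_i wt (x i) <=
  k%:R * small_bound + (k%:R * large_bound + (triple_bound +
    (k%:R * last_bound + 2 ^+ k * (mid_bound N0 Nh + mid_bound Nh N1)))).
Proof.
have Y1 : 1 <= Y by exact: le_trans H1 H_le.
have Yp : 0 < Y by exact: lt_le_trans Y1.
pose sm j (x : tup) := zerosum x && (radR (supp (x j)) < Y0).
pose la j (x : tup) := zerosum x && (Y < radR (supp (x j))).
pose rg (x : tup) := [&& zerosum x, unmatched x, okm Y k x & [forall j, Y0 <= radR (supp (x j))]].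
pose tr (x : tup) := zerosum x && [forall j, radR (supp (x j)) <= Y] && (N3 <= radR (triple (supps x))).
pose ls j (x : tup) := [&& zerosum x, okm Y k x & wt (x j) <= 2 * N0 ^+ 2 * Y / Y0 ^+ 2].
pose md (A B : R) (E : {set 'I_k}) (x : tup) := [&& j0 \notin E, zerosum x, okm Y k x,
   Y0 <= radR (supp (x j0)) & A <= radR (qset E x) <= B].
have F0 := wt_prod_ge0.
have nz (x : tup) j : \prod_i wt (x i) != 0 -> (0 < x j)%N.
  rewrite lt0n; apply: contraNneq => xj; apply/prodf_eq0; exists j => //.
  by rewrite xj wt0.
have const (B : R) : \sum_(j < k) B = k%:R * B by rewrite sumr_const card_ord mulr_natl.
have step1 : \sum_(x | zerosum x && unmatched x) \prod_i wt (x i) <=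
   \sum_j \sum_(x | sm j x) \prod_i wt (x i) + (\sum_j \sum_(x | la j x) \prod_i wt (x i) +
   \sum_(x | rg x) \prod_i wt (x i)).
  apply: (le_trans (ler_sum_or F0 (Q1 := fun x => [exists j, sm j x]) (Q2 := fun x =>
     [exists j, la j x] || rg x) _)).
    move=> x /andP[zx ux] Fx; case: (boolP [exists j, sm j x]) => ex1; first by left.
    case: (boolP [exists j, la j x]) => ex2; first by right.
    right; rewrite /= /rg zx ux /=; apply/andP; split.
      apply/forallP => j; apply/implyP => _; rewrite /okv (nz x j Fx) /=.
      by rewrite leNgt; apply: contra ex2 => h; apply/existsP; exists j; rewrite /la zx.
    apply/forallP => j; rewrite leNgt; apply: contra ex1 => h.
    by apply/existsP; exists j; rewrite /sm zx.
  apply: lerD; first by apply: ler_sum_exists => // x /existsP.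
  apply: (le_trans (ler_sum_or F0 (Q1 := fun x => [exists j, la j x]) (Q2 := rg) _)).
    by move=> x /orP[] ->; [left|right].
  by rewrite lerD2r; apply: ler_sum_exists => // x /existsP.
apply: (le_trans step1); apply: lerD.
  rewrite -const; apply: ler_sum => j _.
  rewrite -(sum_permt (tperm j j0)) (eq_bigl (fun x => zerosum x && (radR (supp (x j0)) < Y0))).
    by apply: zsum_small => //; rewrite Y0_gt0.
  by move=> x; rewrite /sm zerosum_permt ffunE tpermL.
apply: lerD.
  rewrite -const; apply: ler_sum => j _.
  rewrite -(sum_permt (tperm j j0)) (eq_bigl (fun x => zerosum x && (Y < radR (supp (x j0))))).
    by apply: zsum_large.
  by move=> x; rewrite /la zerosum_permt ffunE tpermL.
have step2 : \sum_(x | rg x) \prod_i wt (x i) <= \sum_(x | tr x) \prod_i wt (x i) +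
   (\sum_j \sum_(x | ls j x) \prod_i wt (x i) +
    (\sum_E \sum_(x | md N0 Nh E x) \prod_i wt (x i) + \sum_E \sum_(x | md Nh N1 E x) \prod_i wt (x i))).
  pose ex3 x := [exists E, md N0 Nh E x]; pose ex4 x := [exists E, md Nh N1 E x].
  apply: (le_trans (ler_sum_or F0 (Q1 := tr) (Q2 := fun x =>
     [exists j, ls j x] || (ex3 x || ex4 x)) _)).
    move=> x /and4P[zx /forallP ux okx /forallP xY] _.
    case: (boolP (tr x)) => ntr; [by left | right].
    have tN : radR (triple (supps x)) < N3.
      rewrite ltNge; apply: contra ntr => h; rewrite /tr zx h andbT /=.
      by apply/forallP => j; have := okmT okx j; rewrite ffunE.
    have [[t tj tq]|[A jA /andP[qA qB]]] := trichotomy zx okx (xY j0) N0_gt1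
       (le_trans N0h Nh1) N1_lt N3_gt0 N_cond tN.
      have nM : ~~ (M %| x j0 + x t)%N by have := ux t; rewrite tj.
      have [h|h] := near_match zx okx xY Y0_gt0 tj nM tq.
        by apply/orP; left; apply/existsP; exists j0; rewrite /ls zx okx.
      by apply/orP; left; apply/existsP; exists t; rewrite /ls zx okx.
    apply/orP; right; case: (leP (radR (qset A x)) Nh) => hh.
      by apply/orP; left; apply/existsP; exists A; rewrite /md jA zx okx xY qA.
    by apply/orP; right; apply/existsP; exists A; rewrite /md jA zx okx xY (ltW hh) qB.
  rewrite lerD2l.
  apply: (le_trans (ler_sum_or F0 (Q1 := fun x => [exists j, ls j x]) (Q2 := fun x => ex3 x || ex4 x) _)).
    by move=> x /orP[] ->; [left|right].
  apply: lerD; first by apply: ler_sum_exists => // x /existsP.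
  apply: (le_trans (ler_sum_or F0 (Q1 := ex3) (Q2 := ex4) _)).
    by move=> x /orP[] ->; [left|right].
  by apply: lerD; apply: ler_sum_exists => // x /existsP.
apply: (le_trans step2); apply: lerD; first exact: (zsum_triple b_gt1 b_coprime H1 th_gt0 eps_gt0 Kl_ge0 logf_le zeta_le j0E Y1 N3_gt0).
have N00 : 0 < N0 by exact: lt_trans N0_gt1.
have Nh1' : 1 <= Nh by exact: le_trans (ltW N0_gt1) N0h.
apply: lerD.
  have k0 : (0 < k)%N by apply: leq_ltn_trans (ltn_ord j0).
  have klt : (k.-1 < k)%N by rewrite prednK.
  pose a := Ordinal klt.
  rewrite -const; apply: ler_sum => j _.
  rewrite -(sum_permt (tperm j a)) (eq_bigl (fun x => [&& zerosum x, okm Y k x &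
     wt (x a) <= 2 * N0 ^+ 2 * Y / Y0 ^+ 2])).
    apply: range_last => //; first by rewrite /= prednK.
    by rewrite !mulr_ge0 ?invr_ge0 ?exprn_ge0 ?(ltW Yp) ?(ltW N00) ?(ltW Y0_gt0).
  by move=> x; rewrite /ls zerosum_permt okm_permt ffunE tpermL.
have mid A B : 0 < A -> 1 <= B ->
    \sum_E \sum_(x | md A B E x) \prod_i wt (x i) <= 2 ^+ k * mid_bound A B.
  move=> A0 B1; have -> : 2 ^+ k * mid_bound A B = \sum_(E : {set 'I_k}) mid_bound A B.
    rewrite sumr_const -[RHS]mulr_natl -natrX; congr (_%:R * _).
    have := card_powerset [set: 'I_k]; rewrite cardsT card_ord => <-.
    by apply: eq_card => S; rewrite powersetE subsetT.
  apply: ler_sum => E _; case: (boolP (j0 \in E)) => jE.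
    rewrite big_pred0; last by move=> x; rewrite /md jE.
    rewrite /mid_bound /midK !mulr_ge0 ?powR_ge0 ?exprn_ge0 ?stepK_ge0 ?invr_ge0 ?(ltW Y0_gt0) //.
    rewrite addr_ge0 ?mulr_ge0 ?harm_ge0 ?ler0n //; exact: le_trans ler01 H1.
  have [p [a pa pE]] := order_perm jE.
  rewrite -(sum_permt p).
  rewrite (eq_bigl (fun x => md A B E (permt p x))) //.
  rewrite (sum_permt p) (eq_bigl (fun x => [&& zerosum (permt p x), okm Y k (permt p x),
     Y0 <= radR (supp (permt p x a)) & A <= radR (midset a (permt p x)) <= B])); last first.
    by move=> x; rewrite /md jE zerosum_permt okm_permt (qset_mid _ pa pE) ffunE pa.
  rewrite (sum_permt p (fun x => [&& zerosum x, okm Y k x,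
     Y0 <= radR (supp (x a)) & A <= radR (midset a x) <= B])).
  exact: range_mid.
rewrite mulrDr; apply: lerD; apply: mid => //; first exact: lt_le_trans N0h.
exact: le_trans Nh1' Nh1.
Qed.

End Unmatched.

(** * Logarithms and divisor counts as small powers *)

Section LogBounds.
Variable R : realType.

Lemma ln_le_powR (x eps : R) : 0 < eps -> 0 < x -> ln x <= x `^ eps / eps.
Proof.
move=> e0 x0; rewrite ler_pdivlMr // mulrC -ln_powR.
have p0 : 0 < x `^ eps by exact: powR_gt0.
have := @le_ln1Dx R (x `^ eps - 1); rewrite addrCA subrr addr0 => h.
apply: (le_trans (h _)); lra.
Qed.

Lemma ltr_powR_gt1 (a x y : R) : 1 < a -> x < y -> a `^ x < a `^ y.
Proof.
move=> a1 xy; have a0 : 0 < a by exact: lt_trans a1.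
by rewrite /powR gt_eqF // ltr_expR ltr_pM2r // ln_gt0.
Qed.

Lemma harm_ln m : harm R m.+1 <= 1 + ln m.+1%:R.
Proof.
elim: m => [|m IH]; first by rewrite /harm big_ord1 ln1 invr1 addr0.
rewrite /harm big_ord_recr /= -/(harm R m.+1).
have m0 : (0 : R) < m.+1%:R by rewrite ltr0n.
have m1 : (0 : R) < m.+2%:R by rewrite ltr0n.
have : ln (m.+1%:R / m.+2%:R : R) <= - (m.+2%:R)^-1.
  have -> : m.+1%:R / m.+2%:R = 1 + - (m.+2%:R)^-1 :> R.
    apply: (@mulIf _ m.+2%:R); first by rewrite gt_eqF.
    by rewrite mulfVK ?gt_eqF // mulrBl mul1r mulVf ?gt_eqF // -[m.+2]addn1 natrD addrK.
  by apply: le_ln1Dx; rewrite ltrN2 invf_lt1 // ltr1n.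
rewrite ln_div ?posrE // => h; apply: (le_trans (lerD IH (lexx _))).
by rewrite -addrA lerD2l; move: h; rewrite lerBlDr [- _ + _]addrC lerBrDr.
Qed.

Lemma logf_powR (eps : R) : 0 < eps ->
  forall r, (0 < r)%N -> logf R r <= (4 + 2 / eps) * r%:R `^ eps.
Proof.
move=> e0 [//|r] _; have r1 : (1 : R) <= r.+1%:R by rewrite ler1n.
have h1 := harm_ln r; have h2 := ln_le_powR e0 (lt_le_trans ltr01 r1).
have h3 := powR_ge1 r1 (ltW e0).
rewrite /logf [leRHS]mulrDl; set u := _ `^ eps in h2 h3 *.
have -> : 2 / eps * u = 2 * (u / eps) by ring.
by lra.
Qed.

(** Elements at or above [B0] satisfy [2 <= (b i)^eps]; those below are distinct integers less than
    [B0], which depends on [eps] alone. Hence [Kd] is uniform in [b]. *)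
Lemma divisor_powR (eps : R) : 0 < eps -> exists2 Kd, 0 <= Kd &
  forall n (b : 'I_n -> nat), (forall i, (1 < b i)%N) ->
    (forall i j, i != j -> coprime (b i) (b j)) ->
    forall D : {set 'I_n}, 2 ^+ #|D| <= Kd * (rad b D)%:R `^ eps.
Proof.
move=> e0; pose B0 := (Num.truncn (2 `^ eps^-1 : R)).+1.
exists (2 ^+ B0) => [|n b b1 bco D]; first by rewrite exprn_ge0.
have binj : injective b.
  move=> i j bij; apply/eqP; apply: contraT => /bco.
  by rewrite bij /coprime gcdnn; have := b1 j; case: (b j) => [|[]].
pose S := [set i | (b i < B0)%N].
have cS : (#|D :&: S| <= B0)%N.
  pose f (i : 'I_n) : 'I_B0 := inord (b i).
  have finj : {in D :&: S &, injective f}.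
    move=> i j; rewrite !inE => /andP[_ iS] /andP[_ jS] /(congr1 val) /=.
    by rewrite !inordK // => /binj.
  by rewrite -(card_in_imset finj) -[X in (_ <= X)%N]card_ord max_card.
have cD : 2 ^+ #|D :\: S| <= (rad b (D :\: S))%:R `^ eps :> R.
  rewrite rad_powR -prodr_const; apply: ler_prod => i; rewrite !inE -leqNgt => /andP[iB _].
  rewrite ler0n /=; have : 2 `^ eps^-1 <= (b i)%:R :> R.
    by apply/ltW/(lt_le_trans (truncnS_gt _)); rewrite ler_nat.
  move=> /(powR_le2 (ltW e0) (powR_ge0 _ _)); rewrite -powRrM mulVf ?gt_eqF //.
  by rewrite powRr1.
rewrite -(cardsID S D) exprD; apply: ler_pM; rewrite ?exprn_ge0 //.
  by rewrite ler_weXn2l // ler1n.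
apply: (le_trans cD); apply: powR_le2; rewrite ?(ltW e0) ?ler0n // ler_nat.
by apply: rad_sub => //; apply: subsetDl.
Qed.

End LogBounds.

(** * Choice of exponents *)

Section Exponents.
Variables (R : realType) (alpha : R).
Hypothesis alpha01 : 0 < alpha < 1.
Variables (K : nat) (e0 : R).
Hypotheses (K_gt0 : (0 < K)%N) (e0_gt0 : 0 < e0).

(** With [dl = c1 / K] and [Y = H^(1+dl)], replacing [H] by [Y] in [H^(k th / 2)] loses at most
    [H^c1]. The constant 256 keeps this, and [H^dl], below the gain [H^(alpha^2 / 64)] produced by
    [N0 = N3 = H^(alpha/32)]. *)
Definition c1 : R := alpha ^+ 2 * (1 - alpha) / 256.
(** [saving / K] equals [dl alpha (1 - alpha) / 4], which sits below the gains from denominators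
    outside [[Y0, Y]]: about [dl alpha / 2] for small ones and [dl (1 - alpha)] for large ones. *)
Definition saving : R := c1 * alpha * (1 - alpha) / 4.
Let dl : R := c1 / K%:R.
Let g : R := saving / K%:R.
(** [t] serves as every epsilon of the argument: losses of order [K^2 t] remain a small fraction of
    both the saving and the prescribed [e0]. *)
Let t : R := Num.min g e0 / (100 * (K%:R + 1) ^+ 2).
Definition expo : R := alpha + t.

Lemma c1_gt0 : 0 < c1.
Proof. by rewrite /c1; case/andP: alpha01 => a0 a1; rewrite !mulr_gt0 ?exprn_gt0 ?invr_gt0 ?subr_gt0. Qed.

Lemma saving_gt0 : 0 < saving.
Proof. by have := c1_gt0; rewrite /saving; case/andP: alpha01 => a0 a1 c0; rewrite !mulr_gt0 ?invr_gt0 ?subr_gt0. Qed.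

Let K1 : (1 : R) <= K%:R. Proof. by rewrite ler1n. Qed.
Let K0 : (0 : R) < K%:R. Proof. exact: lt_le_trans K1. Qed.

Let dl_gt0 : 0 < dl. Proof. by rewrite divr_gt0 ?c1_gt0. Qed.
Let dl_le : dl <= c1. Proof. by rewrite ler_pdivrMr // ler_peMr // ltW // c1_gt0. Qed.
Let c1_le : c1 <= alpha ^+ 2 / 256.
Proof.
rewrite /c1 ler_wpM2r ?invr_ge0 // ler_piMr ?exprn_ge0 //; case/andP: alpha01 => a0 a1; first exact: ltW.
by rewrite gerBl ltW.
Qed.
Let gE : g = dl * alpha * (1 - alpha) / 4.
Proof. by rewrite /g /saving /dl; field; rewrite gt_eqF. Qed.
Let g_gt0 : 0 < g. Proof. by rewrite divr_gt0 ?saving_gt0. Qed.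
Let m0 : 0 < Num.min g e0. Proof. by rewrite lt_min g_gt0. Qed.
Let t_gt0 : 0 < t. Proof. by rewrite divr_gt0 // mulr_gt0 // exprn_gt0 // addr_gt0. Qed.
Let tE : (K%:R + 1) ^+ 2 * t = Num.min g e0 / 100.
Proof. by rewrite /t; field; rewrite gt_eqF // addr_gt0. Qed.

Lemma expo_gt : alpha < expo.
Proof. by rewrite /expo ltrDl. Qed.

Variable k : nat.
Hypotheses (k_gt0 : (0 < k)%N) (kK : (k <= K)%N).
Let kp := k%:R : R.
Let kp1 : 1 <= kp. Proof. by rewrite ler1n. Qed.
Let kpK : kp <= K%:R. Proof. by rewrite ler_nat. Qed.
Let kdl : kp * dl <= c1.
Proof. by rewrite /dl mulrCA ler_piMr ?(ltW c1_gt0) // ler_pdivrMr // mul1r. Qed.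
Let T : R := Num.min g e0 / 100.
Let Tg : T <= g / 100. Proof. by rewrite ler_wpM2r ?invr_ge0 // ge_min lexx. Qed.
Let Te : T <= e0 / 100. Proof. by rewrite ler_wpM2r ?invr_ge0 // ge_min lexx orbT. Qed.
Let T_gt0 : 0 < T. Proof. by rewrite divr_gt0. Qed.
Let kkt : kp * (kp + 1) * t <= T.
Proof.
rewrite /T -tE ler_wpM2r ?(ltW t_gt0) // expr2; apply: ler_pM; rewrite ?addr_ge0 ?ler0n //.
  by rewrite (le_trans kpK) // lerDl.
by rewrite lerD2r.
Qed.
Let kt : kp * t <= T.
Proof. apply: le_trans kkt; rewrite ler_wpM2r ?(ltW t_gt0) // ler_peMr ?ler0n // lerDr ler0n //. Qed.
Let k1t : (kp + 1) * t <= T.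
Proof. by apply: le_trans kkt; rewrite ler_wpM2r ?(ltW t_gt0) // ler_peMl // addr_ge0 ?ler0n. Qed.
Let tT : t <= T.
Proof. by apply: le_trans kt; rewrite ler_peMl // ltW. Qed.

Let s := expo + kp * t.
Let sE : s = alpha + (kp + 1) * t. Proof. by rewrite /s /expo; ring. Qed.
Let s_lo : alpha <= s. Proof. by rewrite sE lerDl mulr_ge0 ?addr_ge0 ?ler0n // ltW. Qed.
Let s_hi : s <= alpha + T. Proof. by rewrite sE lerD2l. Qed.
Let g_small : g <= alpha ^+ 2 * (1 - alpha) / 1024.
Proof.
rewrite gE; case/andP: alpha01 => a0 a1; have := dl_le; have := c1_le; have := dl_gt0.
move: dl => u u0 cu uc; have h1 : u <= alpha ^+ 2 / 256 by exact: le_trans uc cu.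
rewrite [leRHS](_ : _ = alpha ^+ 2 / 256 * (1 - alpha) / 4); last by field.
rewrite ler_wpM2r ?invr_ge0 // ler_wpM2r ?subr_ge0 ?(ltW a1) //.
by apply: le_trans h1; rewrite ler_piMr // ltW.
Qed.
Let a2a : alpha ^+ 2 <= alpha.
Proof. by case/andP: alpha01 => a0 a1; rewrite expr2 ler_piMr // ltW. Qed.
Let g_small2 : g <= alpha ^+ 2 / 1024.
Proof.
apply: (le_trans g_small); case/andP: alpha01 => a0 a1.
by rewrite ler_wpM2r ?invr_ge0 // ler_piMr ?exprn_ge0 ?(ltW a0) // gerBl ltW.
Qed.
Let g_small3 : g <= (1 - alpha) / 1024.
Proof.
apply: (le_trans g_small); case/andP: alpha01 => a0 a1.
rewrite ler_wpM2r ?invr_ge0 // ler_piMl ?subr_ge0 ?(ltW a1) // exprn_ile1 ?ltW //.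
Qed.

Let s_le1 : s <= 1.
Proof. by move: s_hi Tg g_small3 g_gt0; case/andP: alpha01; lra. Qed.

Let ks : kp * s <= kp * alpha + T.
Proof. by rewrite sE mulrDr mulrA lerD2l. Qed.
Let kth : kp * expo <= kp * alpha + T.
Proof. by rewrite /expo mulrDr lerD2l. Qed.

Let dla : 2 * g <= dl * alpha / 2.
Proof.
rewrite gE; case/andP: alpha01 => a0 a1.
have -> : 2 * (dl * alpha * (1 - alpha) / 4) = dl * alpha / 2 * (1 - alpha) by field.
have X0 := divr_ge0 (mulr_ge0 (ltW dl_gt0) (ltW a0)) (ler0n R 2).
by rewrite ler_piMr // gerBl ltW.
Qed.
Let dlb : 2 * g <= dl * (1 - alpha) / 2.
Proof.
rewrite gE; case/andP: alpha01 => a0 a1.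
have -> : 2 * (dl * alpha * (1 - alpha) / 4) = dl * (1 - alpha) / 2 * alpha by field.
have a1' : 0 <= 1 - alpha by rewrite subr_ge0 ltW.
have X0 := divr_ge0 (mulr_ge0 (ltW dl_gt0) a1') (ler0n R 2).
by rewrite ler_piMr // ltW.
Qed.

Lemma exp_small : kp * s / 2 - dl * s / 2 <= kp * alpha / 2 - g.
Proof.
have : dl * alpha <= dl * s by rewrite ler_wpM2l // ltW.
by move: ks dla Tg g_gt0; lra.
Qed.

Lemma exp_large : kp * s / 2 - dl * (1 - s) <= kp * alpha / 2 - g.
Proof.
have : dl * ((1 - alpha) / 2) <= dl * (1 - s).
  rewrite ler_wpM2l ?(ltW dl_gt0) //; move: s_hi Tg g_small3 g_gt0; lra.
by move: ks dlb Tg g_gt0; lra.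
Qed.

Lemma exp_triple : (1 + dl) * (kp * s / 2) - alpha / 32 * (s / 2) <= kp * alpha / 2 - g.
Proof.
have h1 : kp * dl * s <= c1.
  by apply: le_trans kdl; rewrite ler_piMr // (mulr_ge0 (ler0n R k) (ltW dl_gt0)).
have h2 : alpha * alpha <= alpha * s by rewrite ler_wpM2l // ltW //; case/andP: alpha01.
move: h1 h2 ks Tg g_gt0 g_small2 c1_le; rewrite expr2; nra.
Qed.

Lemma exp_pow : (1 + dl) * (kp * expo / 2) <= kp * alpha / 2 + T + c1.
Proof.
have h1 : kp * dl * expo <= c1.
  apply: le_trans kdl; rewrite ler_piMr ?(mulr_ge0 (ler0n R k) (ltW dl_gt0)) //.
  by apply: le_trans s_le1; rewrite /s lerDl (mulr_ge0 (ler0n R k) (ltW t_gt0)).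
have : (1 + dl) * (kp * expo / 2) = kp * expo / 2 + (kp * dl * expo) / 2 by field.
by move=> ->; move: h1 kth c1_gt0 T_gt0; lra.
Qed.

Lemma exp_last : (1 + dl) * (kp * expo / 2) + (2 * (alpha / 32) + (1 + dl) - 2 * (1 - dl)) + 2 * T
  <= kp * alpha / 2 - g.
Proof.
move: exp_pow dl_le c1_le Tg g_small2 g_gt0 a2a; case/andP: alpha01; lra.
Qed.

Lemma exp_mid1 : (1 + dl) * (kp * expo / 2) - alpha / 32 * (expo / 2) +
  (2 * T + (1 + 2 * T) - (1 - dl)) + 2 * T <= kp * alpha / 2 - g.
Proof.
have h2 : alpha * alpha <= alpha * expo.
  by rewrite ler_wpM2l ?(ltW expo_gt) // ltW //; case/andP: alpha01.
move: h2 exp_pow dl_le c1_le Tg g_small2 g_gt0; rewrite expr2; lra.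
Qed.

(** The gain is about [alpha / 4], from [Nh = H^(1/2)]; the main loss is [alpha / 8], from
    [N1^2 = H^(1 + alpha/8)]. *)
Lemma exp_mid2 : (1 + dl) * (kp * expo / 2) - 2^-1 * (expo / 2) +
  (2 * T + (1 + alpha / 8 + 4 * T) - (1 - dl)) + 2 * T <= kp * alpha / 2 - g.
Proof.
move: expo_gt exp_pow dl_le c1_le Tg g_small2 g_gt0 a2a; case/andP: alpha01; lra.
Qed.

Variables (n : nat) (b : 'I_n -> nat).
Hypothesis b_gt1 : forall i, (1 < b i)%N.
Hypothesis b_coprime : forall i j, i != j -> coprime (b i) (b j).
Variable H : R.
Hypothesis H1' : 1 <= H.
Variables (Kl Kd Z : R).
Hypotheses (Kl_ge0 : 0 <= Kl) (Kd_ge0 : 0 <= Kd).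
Hypothesis logf_le : forall r, (0 < r)%N -> logf R r <= Kl * r%:R `^ t.
Hypothesis divisor_le : forall D : {set 'I_n}, 2 ^+ #|D| <= Kd * (rad b D)%:R `^ t.
Hypothesis zeta_le : \sum_i (b i)%:R `^ (- expo) <= Z.
Variable j0 : 'I_k.
Hypothesis j0E : j0 = 0%N :> nat.

Let Y := H `^ (1 + dl).
Let Y0 := H `^ (1 - dl).
Let N0 := H `^ (alpha / 32).
Let Nh := H `^ 2^-1.
Let N1 := H `^ (2^-1 + alpha / 16).
Let N3 := H `^ (alpha / 32).
Let H0 : 0 < H. Proof. exact: lt_le_trans H1'. Qed.
Let E1 : R := expR (2 ^+ k * Z).
Let sK : R := Kl * (Kd * expR Z).
Let sK_ge0 : 0 <= sK. Proof. by rewrite !mulr_ge0 ?expR_ge0. Qed.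
Let dl1 : dl <= 1.
Proof. by move: dl_le c1_le a2a; case/andP: alpha01; lra. Qed.

Let stepK_le : stepK k t Kl Kd Z Y ^+ k.-1 <= sK ^+ k.-1 * H `^ (2 * T).
Proof.
have -> : stepK k t Kl Kd Z Y = sK * H `^ ((1 + dl) * ((kp + 1) * t)).
  rewrite /stepK /sK /Y -!powRrM.
  rewrite [(1 + dl) * ((kp + 1) * t)](_ : _ = (1 + dl) * t + (1 + dl) * (kp * t)); last by ring.
  by rewrite powRDp //; ring.
rewrite exprMn ler_wpM2l ?exprn_ge0 // -powR_mulrn ?powR_ge0 // -powRrM.
apply: ler_powR => //.
have h : (kp + 1) * t * k.-1%:R <= T.
  apply: le_trans kkt; rewrite mulrC mulrA ler_wpM2r ?(ltW t_gt0) //.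
  by rewrite ler_wpM2r ?addr_ge0 ?ler0n // ler_nat leq_pred.
rewrite -mulrA; set u := _ * k.-1%:R in h *.
have u0 : 0 <= u.
  exact: (mulr_ge0 (mulr_ge0 (addr_ge0 (ler0n R k) ler01) (ltW t_gt0)) (ler0n _ _)).
by apply: ler_pM => //; move: dl1 dl_gt0; lra.
Qed.

Lemma small_boundE : small_bound H k expo t Kl Z Y0 <=
  Kl ^+ k * E1 * H `^ (kp * alpha / 2 - g).
Proof.
rewrite /small_bound -/s -/E1.
have -> : Y0 / H = H `^ (- dl).
  rewrite /Y0 -{2}(powRr1 (ltW H0)) -powRN -powRDp //; congr powR; ring.
rewrite -powRrM -powRDp // mulrAC ler_wpM2l ?mulr_ge0 ?exprn_ge0 ?expR_ge0 //.
apply: ler_powR => //; apply: le_trans exp_small; rewrite -/kp; lra.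
Qed.

Lemma large_boundE : large_bound H k expo t Kl Z Y <=
  Kl ^+ k * E1 * H `^ (kp * alpha / 2 - g).
Proof.
rewrite /large_bound -/s -/E1.
have -> : H / Y = H `^ (- dl).
  rewrite /Y -{1}(powRr1 (ltW H0)) -powRN -powRDp //; congr powR; ring.
rewrite -powRrM -powRDp // mulrAC ler_wpM2l ?mulr_ge0 ?exprn_ge0 ?expR_ge0 //.
apply: ler_powR => //; apply: le_trans exp_large; rewrite -/kp; lra.
Qed.

Lemma triple_boundE : triple_bound k expo t Kl Z Y N3 <=
  Kl ^+ k * E1 * H `^ (kp * alpha / 2 - g).
Proof.
rewrite /triple_bound -/s -/E1 /Y /N3 -!powRrM -powRDp // mulrAC.
rewrite ler_wpM2l ?mulr_ge0 ?exprn_ge0 ?expR_ge0 //.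
apply: ler_powR => //; apply: le_trans exp_triple; rewrite -/kp mulrN; lra.
Qed.

Lemma last_boundE : last_bound k expo t Kl Kd Z Y Y0 N0 <=
  2 * sK ^+ k.-1 * H `^ (kp * alpha / 2 - g).
Proof.
rewrite /last_bound.
have -> : 2 * N0 ^+ 2 * Y / Y0 ^+ 2 = 2 * H `^ (2 * (alpha / 32) + (1 + dl) - 2 * (1 - dl)).
  rewrite /N0 /Y /Y0 -![_ ^+ 2]powR_mulrn ?powR_ge0 // -!powRrM -powRN.
  rewrite -!mulrA -!powRDp //; congr (_ * powR _ _); ring.
apply: (@le_trans _ _ (Y `^ (kp * expo / 2) * (2 * H `^ (2 * (alpha / 32) + (1 + dl) - 2 * (1 - dl)) *
   (sK ^+ k.-1 * H `^ (2 * T))))).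
  apply: ler_wpM2l; first exact: powR_ge0.
  by apply: ler_wpM2l; [rewrite mulr_ge0 ?powR_ge0 | exact: stepK_le].
rewrite /Y -powRrM.
set e1 := (_ - 2 * (1 - dl)); set e2 := (1 + dl) * (kp * expo / 2).
rewrite [leLHS](_ : _ = 2 * sK ^+ k.-1 * (H `^ e2 * H `^ e1 * H `^ (2 * T))); last by ring.
rewrite ler_wpM2l ?mulr_ge0 ?exprn_ge0 // -!powRDp //.
by apply: ler_powR => //; exact: exp_last.
Qed.

Let midK_le (be e : R) : 2^-1 <= be <= 1 -> 2 * be + 4 * t <= e ->
  midK H k t Kd Y (H `^ be) Y0 <=
    Kd * (2 + 32 * Kl) * H `^ (2 * T + e - (1 - dl)).
Proof.
move=> /andP[be1 be2] ee; rewrite /midK; set B2 := (H `^ be) ^+ 2.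
have B2E : B2 = H `^ (2 * be) by rewrite /B2 -powR_mulrn ?powR_ge0 // -powRrM mulrC.
have B21 : 1 <= B2 by rewrite B2E; apply: powR_ge1 => //; move: be1; lra.
set T' := Num.truncn B2.
have T'0 : (0 < T')%N by rewrite truncn_gt0.
have T'le : T'%:R <= B2 by rewrite truncn_le (le_trans ler01).
have e1 : 1 <= e by apply: le_trans ee; have := t_gt0; lra.
have h1 : harm R (2 * T') <= Kl * (2 * H `^ (2 * t)).
  have := logf_le (r := (2 * T')%N); rewrite muln_gt0 T'0 => /(_ isT) hl.
  apply: (@le_trans _ _ (logf R (2 * T'))).
    by rewrite /logf; have := harm_ge0 R (2 * T'); lra.
  apply: (le_trans hl); rewrite ler_wpM2l // natrM powRM //.
  apply: ler_pM; rewrite ?powR_ge0 //.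
    by apply: ler1_powR => //; move: tT Tg g_small2 a2a; case/andP: alpha01; lra.
  apply: (@le_trans _ _ (B2 `^ t)); first by apply: powR_le2 => //; apply: ltW.
  rewrite B2E -powRrM; apply: ler_powR => //.
  by rewrite ler_wpM2r ?(ltW t_gt0) //; lra.
have h2 : 2 * H + 2 * ((2 * T')%:R * harm R (2 * T')) <= (2 + 32 * Kl) * H `^ e.
  rewrite [leRHS]mulrDl; apply: lerD.
    by rewrite ler_wpM2l // -{1}(powRr1 (ltW H0)) ler_powR.
  apply: (@le_trans _ _ (2 * (2 * B2 * (Kl * (2 * H `^ (2 * t)))))).
    rewrite ler_wpM2l //; apply: ler_pM; rewrite ?harm_ge0 ?ler0n // natrM ler_wpM2l //.
  have -> : 2 * (2 * B2 * (Kl * (2 * H `^ (2 * t)))) = 8 * Kl * (B2 * H `^ (2 * t)) by ring.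
  rewrite B2E -powRDp //; apply: ler_pM; rewrite ?mulr_ge0 ?powR_ge0 //.
    by rewrite ler_wpM2r // ler_nat.
  by apply: ler_powR => //; apply: le_trans ee; have := t_gt0; lra.
have h3 : Y `^ (kp * t) <= H `^ (2 * T).
  rewrite /Y -powRrM; apply: ler_powR => //; apply: ler_pM => //.
  - by rewrite addr_ge0 // ltW.
  - by rewrite mulr_ge0 ?ler0n // ltW.
  - by move: dl1; lra.
apply: (@le_trans _ _ (Kd * H `^ (2 * T) * ((2 + 32 * Kl) * H `^ e / Y0))).
  apply: ler_pM; rewrite ?mulr_ge0 ?powR_ge0 ?invr_ge0 //.
  - by rewrite addr_ge0 ?mulr_ge0 ?harm_ge0 ?ler0n // ltW.
  - exact: powR_ge0.
  - by apply: ler_wpM2l.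
  - by rewrite ler_wpM2r ?invr_ge0 ?powR_ge0.
rewrite [leLHS](_ : _ = Kd * (2 + 32 * Kl) * (H `^ (2 * T) * H `^ e / Y0)); last by ring.
rewrite ler_wpM2l ?mulr_ge0 ?addr_ge0 ?mulr_ge0 // /Y0 -powRN -!powRDp //.
Qed.

Let mid_gen (A be e ga : R) : 2^-1 <= be <= 1 -> 2 * be + 4 * t <= e -> A = H `^ ga ->
  (1 + dl) * (kp * expo / 2) - ga * (expo / 2) + (2 * T + e - (1 - dl)) + 2 * T
     <= kp * alpha / 2 - g ->
  mid_bound H k expo t Kl Kd Z Y Y0 A (H `^ be) <=
  Kd * (2 + 32 * Kl) * sK ^+ k.-1 * H `^ (kp * alpha / 2 - g).
Proof.
move=> be1 ee -> hx; rewrite /mid_bound.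
set C := Kd * (2 + 32 * Kl).
have C0 : 0 <= C by rewrite mulr_ge0 ?addr_ge0 ?mulr_ge0.
apply: (@le_trans _ _ (Y `^ (kp * expo / 2) * H `^ ga `^ (- (expo / 2)) *
   (C * H `^ (2 * T + e - (1 - dl)) * (sK ^+ k.-1 * H `^ (2 * T))))).
  rewrite ler_wpM2l ?mulr_ge0 ?powR_ge0 //; apply: ler_pM => //; rewrite ?midK_le //.
  - rewrite /midK !mulr_ge0 ?powR_ge0 ?invr_ge0 ?powR_ge0 //.
    by rewrite addr_ge0 ?mulr_ge0 ?harm_ge0 ?ler0n // ltW.
  - by rewrite exprn_ge0 // /stepK !mulr_ge0 ?powR_ge0 ?expR_ge0.
rewrite /Y -!powRrM; set e2 := _ * (kp * _ / 2); set e3 := ga * _; set e4 := (_ - _).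
rewrite [leLHS](_ : _ = C * sK ^+ k.-1 * (H `^ e2 * H `^ e3 * H `^ e4 * H `^ (2 * T))); last by ring.
apply: ler_wpM2l; first by rewrite mulr_ge0 ?exprn_ge0.
rewrite -!powRDp //.
by apply: ler_powR => //; apply: le_trans hx; rewrite /e2 /e3 /e4 mulrN.
Qed.

Lemma unmatched_le : 1 < H ->
  \sum_(x : {ffun 'I_k -> 'I_(modulus b)} | zerosum x && unmatched j0 x)
     \prod_i wt b H (x i) <=
  (2 * k%:R * (Kl ^+ k * E1) + Kl ^+ k * E1 + k%:R * (2 * sK ^+ k.-1) +
    2 ^+ k * (2 * (Kd * (2 + 32 * Kl) * sK ^+ k.-1))) * H `^ (kp * alpha / 2 - g).
Proof.
move=> H1; have a0 : 0 < alpha by case/andP: alpha01.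
have a1 : alpha < 1 by case/andP: alpha01.
have tt : 0 < t := t_gt0.
have := @unmatched_sum R n b b_gt1 b_coprime H H1' k j0 j0E expo t Kl Kd Z Y Y0 N0 Nh N1 N3.
rewrite (lt_trans a0 expo_gt) t_gt0 Kl_ge0 Kd_ge0 => /(_ isT isT isT isT logf_le divisor_le zeta_le).
rewrite -/kp -/s s_le1 => /(_ isT) main.
apply: (le_trans (main _ _ _ _ _ _ _ _ _)).
- by rewrite powR_gt0.
- by rewrite -[leRHS](powRr1 (ltW H0)) ler_powR //; have := dl_gt0; lra.
- by rewrite -[leLHS](powRr1 (ltW H0)) ler_powR //; have := dl_gt0; lra.
- have := @ltr_powR_gt1 R H 0 (alpha / 32) H1.
  by rewrite powRr0 divr_gt0 // => /(_ isT).
- by rewrite /N0 /Nh ler_powR //; lra.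
- by rewrite /Nh /N1 ler_powR //; lra.
- by rewrite /N1 /Y0 ltr_powR_gt1 //; move: dl_le c1_le a2a; lra.
- by rewrite powR_gt0.
- rewrite /Y /N0 /N3 /N1 -powR_mulrn ?powR_ge0 // -powRrM -!powRDp //.
  by apply: ler_powR => //; move: dl_le c1_le a2a; lra.
set X := H `^ (kp * alpha / 2 - g).
have X0 : 0 <= X by exact: powR_ge0.
have hs := small_boundE; have hl := large_boundE; have ht := triple_boundE.
have ha := last_boundE.
have tb : 4 * t <= 2 * T.
  have : 2 * t <= kp * (kp + 1) * t by rewrite ler_wpM2r ?(ltW tt) //; move: kp1; nra.
  by move: kkt; lra.
have m1 : mid_bound H k expo t Kl Kd Z Y Y0 N0 Nh <= Kd * (2 + 32 * Kl) * sK ^+ k.-1 * X.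
  apply: (mid_gen (be := 2^-1) (e := 1 + 2 * T) (ga := alpha / 32)) => //.
  - by apply/andP; split; lra.
  - by lra.
  - exact: exp_mid1.
have m2 : mid_bound H k expo t Kl Kd Z Y Y0 Nh N1 <= Kd * (2 + 32 * Kl) * sK ^+ k.-1 * X.
  apply: (mid_gen (be := 2^-1 + alpha / 16) (e := 1 + alpha / 8 + 4 * T) (ga := 2^-1)) => //.
  - by apply/andP; split; lra.
  - by move: T_gt0; lra.
  - exact: exp_mid2.
have k0 : (0 : R) <= k%:R by [].
apply: (@le_trans _ _ (k%:R * (Kl ^+ k * E1 * X) + (k%:R * (Kl ^+ k * E1 * X) +
   (Kl ^+ k * E1 * X + (k%:R * (2 * sK ^+ k.-1 * X) +
     2 ^+ k * (Kd * (2 + 32 * Kl) * sK ^+ k.-1 * X + Kd * (2 + 32 * Kl) * sK ^+ k.-1 * X)))))).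
  apply: lerD; first exact: ler_wpM2l.
  apply: lerD; first exact: ler_wpM2l.
  apply: lerD => //; apply: lerD; first exact: ler_wpM2l.
  by apply: ler_wpM2l; [exact: exprn_ge0 | exact: lerD].
by rewrite le_eqVlt; apply/orP; left; apply/eqP; ring.
Qed.

Lemma total_le :
  \sum_(x : {ffun 'I_k -> 'I_(modulus b)} | zerosum x) \prod_i wt b H (x i) <=
  Kl ^+ k * E1 * H `^ (kp * alpha / 2 + e0).
Proof.
have a0 : 0 < alpha by case/andP: alpha01.
have th0 : 0 < expo by exact: lt_trans expo_gt.
apply: (le_trans (zsum_all b_gt1 b_coprime H1' th0 t_gt0 Kl_ge0 logf_le zeta_le j0E s_le1)).
rewrite mulrAC ler_wpM2l ?mulr_ge0 ?exprn_ge0 ?expR_ge0 //; apply: ler_powR => //.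
by move: ks Te e0_gt0 T_gt0; rewrite /s /kp; lra.
Qed.

End Exponents.

(** The order of the quantifiers matters: [th] depends on [alpha], [K] and [e0] only, then [Z]
    bounds the sum at this [th], and [A] is uniform in the family [b], hence in the truncation. *)
Theorem core_bounds (R : realType) (alpha : R) (K : nat) (e0 : R) :
  0 < alpha < 1 -> (0 < K)%N -> 0 < e0 ->
  exists2 th, alpha < th & forall (Z : R) (k : nat), (0 < k <= K)%N ->
  exists2 A, 0 <= A & forall (n : nat) (b : 'I_n -> nat),
    (forall i, (1 < b i)%N) -> (forall i j, i != j -> coprime (b i) (b j)) ->
    \sum_i (b i)%:R `^ (- th) <= Z ->
    forall H, 1 <= H -> forall j0 : 'I_k, j0 = 0%N :> nat ->
    \sum_(x : {ffun 'I_k -> 'I_(modulus b)} | zerosum x) \prod_i wt b H (x i) <=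
      A * H `^ (k%:R * alpha / 2 + e0) /\
    \sum_(x : {ffun 'I_k -> 'I_(modulus b)} | zerosum x && unmatched j0 x)
      \prod_i wt b H (x i) <= A * H `^ (k%:R * alpha / 2 - saving alpha / K%:R).
Proof.
move=> a01 K0 e00; exists (expo alpha K e0); first exact: expo_gt.
move=> Z k /andP[k0 kK].
pose t : R := Num.min (saving alpha / K%:R) e0 / (100 * (K%:R + 1) ^+ 2).
have t0 : 0 < t.
  rewrite divr_gt0 ?mulr_gt0 ?exprn_gt0 ?addr_gt0 ?ltr0n // lt_min e00 andbT.
  by rewrite divr_gt0 ?saving_gt0 ?ltr0n.
have lf := logf_powR t0; have [Kd Kd0 dv] := divisor_powR t0.
set Kl := (4 + 2 / t) in lf.
have Kl0 : 0 <= Kl by rewrite addr_ge0 // divr_ge0 // ltW.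
pose A1 : R := Kl ^+ k * expR (2 ^+ k * Z).
pose A2 : R := 2 * k%:R * (Kl ^+ k * expR (2 ^+ k * Z)) + Kl ^+ k * expR (2 ^+ k * Z) +
  k%:R * (2 * (Kl * (Kd * expR Z)) ^+ k.-1) +
    2 ^+ k * (2 * (Kd * (2 + 32 * Kl) * (Kl * (Kd * expR Z)) ^+ k.-1)).
have A10 : 0 <= A1 by rewrite mulr_ge0 ?exprn_ge0 ?expR_ge0.
have A20 : 0 <= A2.
  have e1 := expR_ge0 (2 ^+ k * Z); have e2 := expR_ge0 Z.
  have l0 : 0 <= 2 + 32 * Kl by rewrite addr_ge0 // mulr_ge0.
  by rewrite !addr_ge0 // !mulr_ge0 ?exprn_ge0 // ?mulr_ge0 // mulr_ge0.
exists (A1 + A2) => [|n b b1 bco zb H H1 j0 j0E]; first by rewrite addr_ge0.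
have tot := total_le a01 K0 e00 k0 kK b1 bco H1 Kl0 lf zb j0E.
split.
  by apply: (le_trans tot); rewrite ler_wpM2r ?powR_ge0 // lerDl.
(* At [H = 1] the strict inequalities between the parameters fail, but all powers of [H] are 1 and
   the bound for all tuples suffices. *)
move: H1; rewrite le_eqVlt => /orP[/eqP H1|H1].
  rewrite -H1 in tot *; rewrite powR1 mulr1; apply: (@le_trans _ _ A1); last by rewrite lerDl.
  move: tot; rewrite powR1 mulr1; apply: le_trans.
  by apply: ler_sum_sub => [x /andP[] //|x _]; apply: wt_prod_ge0.
apply: (le_trans (unmatched_le a01 K0 e00 k0 kK b1 bco (ltW H1) Kl0 Kd0 lf (dv n b b1 bco) zb j0E H1)).
by rewrite ler_wpM2r ?powR_ge0 // lerDr.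
Qed.

(** * The Gaussian recursion *)

Section SplitTuples.
Variables (A : comRingType) (G : finType) (m p : nat).

Definition ltup (x : {ffun 'I_(m + p) -> G}) : {ffun 'I_m -> G} :=
  [ffun i => x (lshift p i)].
Definition rtup (x : {ffun 'I_(m + p) -> G}) : {ffun 'I_p -> G} :=
  [ffun i => x (rshift m i)].
Definition cattup (y : {ffun 'I_m -> G}) (z : {ffun 'I_p -> G}) :
    {ffun 'I_(m + p) -> G} :=
  [ffun i => match split i with inl j => y j | inr j => z j end].

Lemma ltup_cat y z : ltup (cattup y z) = y.
Proof.
by apply/ffunP => i; rewrite !ffunE; case: splitP => [j /= /val_inj -> //|j /= E]; move: (ltn_ord i); rewrite E; lia.
Qed.

Lemma rtup_cat y z : rtup (cattup y z) = z.
Proof.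
apply/ffunP => i; rewrite !ffunE; case: splitP => [j /= E|j /= E]; first by move: (ltn_ord j); rewrite -E; lia.
by congr (z _); apply: val_inj => /=; move: E; lia.
Qed.

Lemma cattupK x : cattup (ltup x) (rtup x) = x.
Proof.
apply/ffunP => i; rewrite ffunE; case: splitP => j E; rewrite ffunE; congr (x _);
  by apply: val_inj.
Qed.

Lemma sum_split_tup (F : {ffun 'I_(m + p) -> G} -> A) (P : pred {ffun 'I_m -> G})
   (Q : {ffun 'I_m -> G} -> pred {ffun 'I_p -> G}) :
  \sum_(x | P (ltup x) && Q (ltup x) (rtup x)) F x =
  \sum_(y | P y) \sum_(z | Q y z) F (cattup y z).
Proof.
rewrite pair_big_dep /= (reindex (fun u : {ffun 'I_m -> G} * {ffun 'I_p -> G} =>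
   cattup u.1 u.2)) /=.
  by apply: eq_bigl => u; rewrite ltup_cat rtup_cat.
exists (fun x => (ltup x, rtup x)) => [[y z] _|x _] /=; last exact: cattupK.
by rewrite ltup_cat rtup_cat.
Qed.

End SplitTuples.

Section Moments.
Variables (n : nat) (b : 'I_n -> nat).
Hypothesis b_gt1 : forall i, (1 < b i)%N.
Local Notation M := (modulus b).

Definition mom (A : comRingType) (w : 'I_M -> A) (k : nat) : A :=
  \sum_(x : {ffun 'I_k -> 'I_M} | zerosum x) \prod_i w (x i).

Definition partners (k : nat) (j0 : 'I_k) (x : {ffun 'I_k -> 'I_M}) : nat :=
  #|[set j | (j != j0) && (M %| x j0 + x j)%N]|.

Section Identity.
Variables (A : comRingType) (w : 'I_M -> A) (k : nat).
Local Notation tup := {ffun 'I_(2 + k) -> 'I_M}.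
Local Notation j0 := (ord0 : 'I_(2 + k)).
Local Notation j1 := (lift ord0 ord0 : 'I_(2 + k)).

Lemma zerosum_ltup (x : tup) : zerosum (ltup x) = (M %| x j0 + x j1)%N.
Proof.
rewrite /zerosum big_ord_recl big_ord1 !ffunE; congr (_ %| x _ + x _)%N; exact: val_inj.
Qed.

Lemma zerosum_split (x : tup) : zerosum (ltup x) -> zerosum x = zerosum (rtup x).
Proof.
move=> zl; rewrite {1}/zerosum big_split_ord /= dvdn_addr.
  by rewrite /zerosum; congr (_ %| _)%N; apply: eq_bigr => i _; rewrite ffunE.
by move: zl; rewrite /zerosum; under eq_bigr do rewrite ffunE.
Qed.

Lemma prod_cattup (y : {ffun 'I_2 -> 'I_M}) (z : {ffun 'I_k -> 'I_M}) :
  \prod_i w (cattup y z i) = \prod_i w (y i) * \prod_i w (z i).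
Proof.
rewrite big_split_ord /=; congr (_ * _); apply: eq_bigr => i _.
  by have /ffunP /(_ i) := ltup_cat y z; rewrite ffunE => ->.
by have /ffunP /(_ i) := rtup_cat y z; rewrite ffunE => ->.
Qed.

Lemma sum_perm_pair (Q : pred tup) (j : 'I_(2 + k)) : j != j0 ->
  (forall (p : 'S_(2 + k)) x, p j0 = j0 -> Q (permt p x) = Q x) ->
  \sum_(x : tup | [&& zerosum x, Q x & M %| x j0 + x j]%N) \prod_i w (x i) =
  \sum_(x : tup | [&& zerosum x, Q x & M %| x j0 + x j1]%N) \prod_i w (x i).
Proof.
move=> jj Qp; rewrite [RHS](reindex_inj (@permt_inj _ b _ (tperm j j1))) /=.
apply: eq_big => x; last first.
  by move=> _; rewrite [RHS](reindex_inj (@perm_inj _ (tperm j j1))) /=; apply: eq_bigr => i _; rewrite ffunE tpermK.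
have p0 : tperm j j1 j0 = j0 by rewrite tpermD // neq_lift.
by rewrite zerosum_permt (Qp _ _ p0) !ffunE tpermR p0.
Qed.

Lemma sum_first_pair :
  \sum_(x : tup | [&& zerosum x, true & M %| x j0 + x j1]%N) \prod_i w (x i) =
  mom w 2 * mom w k.
Proof.
rewrite (eq_bigl (fun x : tup => zerosum (ltup x) && zerosum (rtup x))); last first.
  move=> x; rewrite -zerosum_ltup; case: (boolP (zerosum (ltup x))) => zl; rewrite ?andbF //=.
  by rewrite andbT zerosum_split.
rewrite (sum_split_tup _ (@zerosum n b 2) (fun _ => @zerosum n b k)) /mom mulr_suml.
apply: eq_bigr => y _; rewrite mulr_sumr; apply: eq_bigr => z _.
exact: prod_cattup.
Qed.

(** Double counting of pairs consisting of a zero-sum tuple and a partner of its first coordinate.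
    By symmetry each of the [k + 1] positions contributes as much as [j1], where the sum factorises
    because both halves of the tuple are zero-sum. *)
Lemma sum_partners :
  \sum_(x : tup | zerosum x) (partners j0 x)%:R * \prod_i w (x i) =
  k.+1%:R * (mom w 2 * mom w k).
Proof.
rewrite (eq_bigr (fun x : tup => \sum_(j | (j != j0) && (M %| x j0 + x j)%N) \prod_i w (x i))).
  rewrite (exchange_big_dep (fun j => j != j0)) /=; last by move=> x j _ /andP[].
  rewrite (eq_bigr (fun=> mom w 2 * mom w k)) => [|j jj].
    rewrite sumr_const cardC1 card_ord [RHS]mulr_natl //.
  rewrite -sum_first_pair -(sum_perm_pair jj) //.
  by apply: eq_bigl => x; rewrite jj.
move=> x _; rewrite /partners mulr_natl -sumr_const; apply: eq_bigl => j.
by rewrite inE.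
Qed.

End Identity.

Section RealBound.
Variables (R : realType) (H : R).
Hypothesis b_coprime : forall i j, i != j -> coprime (b i) (b j).
Hypothesis H1 : 1 <= H.
Variable k : nat.
Local Notation tup := {ffun 'I_(2 + k) -> 'I_M}.
Local Notation j0 := (ord0 : 'I_(2 + k)).
Local Notation j1 := (lift ord0 ord0 : 'I_(2 + k)).
Local Notation wt := (wt b H).

Lemma partners_permt (p : 'S_(2 + k)) (x : tup) : p j0 = j0 ->
  partners j0 (permt p x) = partners j0 x.
Proof.
move=> p0; rewrite /partners -(card_imset _ (@perm_inj _ p)).
apply: eq_card => j; apply/imsetP/idP => [[i iP ->]|].
  by move: iP; rewrite !inE !ffunE p0 => /andP[i0 ->]; rewrite andbT -[X in _ != X]p0 (inj_eq perm_inj).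
rewrite inE => /andP[jj xj]; exists ((p^-1)%g j); last by rewrite permKV.
by rewrite !inE !ffunE p0 permKV xj andbT -(inj_eq (@perm_inj _ p)) permKV p0.
Qed.

Lemma mod_unique (u v : 'I_M) (s : nat) : (M %| u + s)%N -> (M %| v + s)%N -> u = v.
Proof.
move=> /eqP us /eqP vs; apply: val_inj => /=.
rewrite -(modn_small (ltn_ord u)) -(modn_small (ltn_ord v)); apply/eqP.
by rewrite -(eqn_modDr s) us vs.
Qed.

(** If the first coordinate is paired with the second and also with another one, then the first two
    are determined by the remaining [k] coordinates, which form a zero-sum tuple, and one index. The
    weights of the pair are at most 1, so a whole second moment is saved. *)
Lemma sum_double_partner :
  \sum_(x : tup | zerosum x && (1 < partners j0 x)%N) \prod_i wt (x i) <=
    k.+1%:R * (k%:R * mom (fun v => wt v) k).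
Proof.
have F0 m (x : {ffun 'I_m -> 'I_M}) : 0 <= \prod_i wt (x i) by apply: wt_prod_ge0.
pose Q (x : tup) := (1 < partners j0 x)%N.
have Qp (p : 'S_(2 + k)) x : p j0 = j0 -> Q (permt p x) = Q x.
  by move=> p0; rewrite /Q partners_permt.
have one : \sum_(x : tup | [&& zerosum x, Q x & M %| x j0 + x j1]%N) \prod_i wt (x i)
    <= k%:R * mom (fun v => wt v) k.
  apply: (@le_trans _ _ (\sum_(x : tup | zerosum (ltup x) && (zerosum (rtup x) &&
      [exists i, M %| x j0 + rtup x i]%N)) \prod_i wt (x i))).
    apply: ler_sum_sub => // x; rewrite -zerosum_ltup => /and3P[zx Qx zl].
    rewrite zl -zerosum_split // zx /=.
    have := Qx; rewrite /Q /partners (cardsD1 j1) => c2.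
    have /card_gt0P[j] : (0 < #|[set j | (j != j0) && (M %| x j0 + x j)%N] :\ j1|)%N.
      by move: c2; case: (j1 \in _) => /=; rewrite ?add1n ?ltnS // add0n => /ltnW.
    rewrite !inE => /and3P[jj1 jj0 xj]; apply/existsP.
    case: (splitP (j : 'I_(2 + k))) => [i E|i E].
      have : j = j0 \/ j = j1.
        case: i E => [[|[|//]] ii] /= E; [left|right]; exact: val_inj.
      by case=> jE; rewrite jE eqxx in jj0 jj1.
    exists i; rewrite ffunE; suff -> : rshift 2 i = j by [].
    by apply: val_inj.
  rewrite (eq_bigl (fun x : tup => zerosum (ltup x) && ((fun y z => zerosum z &&
     [exists i, M %| (y : {ffun 'I_2 -> 'I_M}) ord0 + z i]%N) (ltup x) (rtup x)))); last first.
    by move=> x; congr (_ && (_ && _)); apply: eq_existsb => i; rewrite [ltup x _]ffunE; congr (_ %| x _ + _)%N; apply: val_inj.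
  rewrite (sum_split_tup _ (@zerosum n b 2) (fun y z => zerosum z && [exists i, M %| y ord0 + z i]%N)).
  rewrite (exchange_big_dep (@zerosum n b k)) /=; last by move=> y z _ /andP[].
  rewrite /mom mulr_sumr; apply: ler_sum => z zz.
  apply: (@le_trans _ _ (\sum_(i < k) \prod_i wt (z i))); last first.
    by rewrite sumr_const card_ord mulr_natl.
  apply: (@le_trans _ _ (\sum_(i < k) \sum_(y : {ffun 'I_2 -> 'I_M} | zerosum y && (M %| y ord0 + z i)%N)
      \prod_i wt (cattup y z i))).
    apply: ler_sum_exists; first by move=> y; apply: (F0 (2 + k)%N).
    by move=> y /and3P[zy _ /existsP[i yi]] _; exists i; rewrite zy.
  apply: ler_sum => i _.
  case: (pickP (fun y : {ffun 'I_2 -> 'I_M} => zerosum y && (M %| y ord0 + z i)%N)) => [y0 Py0|P0]; last first.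
    by apply: (@le_trans _ _ 0 _ _ _ (F0 k z)); rewrite big_pred0.
  rewrite (bigD1 y0) //= [X in _ + X]big1 ?addr0.
    rewrite (prod_cattup (fun v => wt v)) ler_piMl //.
    rewrite -[leRHS](_ : \prod_(i < 2) 1 = 1); last by rewrite big1.
    by apply: ler_prod => l _; rewrite wt_ge0 // wt_le1.
  move=> y /andP[/andP[zy yz] /eqP nE]; case: nE; case/andP: Py0 => zy0 y0z.
  have E0 := mod_unique yz y0z.
  have E1 : y (lift ord0 ord0) = y0 (lift ord0 ord0).
    move: zy zy0; rewrite /zerosum !big_ord_recl !big_ord0 !addn0 E0 addnC [X in _ -> X]addnC || rewrite /zerosum !big_ord_recl !big_ord0 !addn0 E0 ![(y0 ord0 + _)%N]addnC.
    exact: mod_unique.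
  apply/ffunP => l; case: (unliftP ord0 l) => [l' ->|->] //.
  by rewrite (ord1 l').
apply: (@le_trans _ _ (\sum_(j | j != j0) \sum_(x : tup | [&& zerosum x, Q x & M %| x j0 + x j]%N)
    \prod_i wt (x i))).
  rewrite [leRHS]big_mkcond /=.
  apply: (@le_trans _ _ (\sum_j \sum_(x : tup | (j != j0) && [&& zerosum x, Q x & M %| x j0 + x j]%N)
    \prod_i wt (x i))).
    apply: ler_sum_exists; first by move=> x; apply: F0.
    move=> x /andP[zx c2] _.
    have /card_gt0P[j] : (0 < partners j0 x)%N by exact: ltnW.
    by rewrite inE => /andP[jj xj]; exists j; rewrite jj zx /Q c2.
  apply: ler_sum => j _; case: (j != j0) => //=.
  by rewrite big_pred0.
rewrite (eq_bigr (fun=> \sum_(x : tup | [&& zerosum x, Q x & M %| x j0 + x j1]%N) \prod_i wt (x i))).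
  by rewrite sumr_const cardC1 card_ord mulr_natl lerMn2r one orbT.
by move=> j jj; rewrite -(sum_perm_pair (fun v => wt v) jj Qp).
Qed.

Variables (w : 'I_M -> R[i]) (Kw : R).
Hypothesis w_le : forall x, `|w x| <= (Kw * wt x)%:C%C.
Hypothesis Kw_ge0 : 0 <= Kw.

Lemma norm_prod_le m (x : {ffun 'I_m -> 'I_M}) :
  `|\prod_i w (x i)| <= (Kw ^+ m * \prod_i wt (x i))%:C%C.
Proof.
rewrite normr_prod rmorphM /= rmorphXn /= rmorph_prod /=.
rewrite -[X in _ ^+ X](card_ord m) -prodr_const -big_split /=.
by apply: ler_prod => i _; rewrite normr_ge0 -rmorphM /= w_le.
Qed.

Lemma norm_mom_le m : `|mom w m| <= (Kw ^+ m * mom (fun v => wt v) m)%:C%C.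
Proof.
apply: (le_trans (ler_norm_sum _ _ _)); rewrite /mom mulr_sumr rmorph_sum /=.
by apply: ler_sum => x _; apply: norm_prod_le.
Qed.

(** Tuples with exactly one partner cancel, those with none are [unmatched], and those with [p >= 2]
    partners enter with the factor [p - 1], bounded by [k + 2]. *)
Lemma mom_recursion :
  `|mom w (2 + k) - k.+1%:R * (mom w 2 * mom w k)| <=
  (Kw ^+ (2 + k) * (\sum_(x : tup | zerosum x && unmatched j0 x) \prod_i wt (x i) +
     k.+2%:R * (k.+1%:R * (k%:R * mom (fun v => wt v) k))))%:C%C.
Proof.
rewrite -sum_partners /mom -sumrB.
apply: (le_trans (ler_norm_sum _ _ _)).
apply: (@le_trans _ _ (\sum_(x : tup | zerosum x) (Kw ^+ (2 + k) *
   ((if unmatched j0 x then \prod_i wt (x i) else 0) +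
    (if (1 < partners j0 x)%N then k.+2%:R * \prod_i wt (x i) else 0)))%:C%C)).
  apply: ler_sum => x zx.
  have F0 : 0 <= \prod_i wt (x i) by apply: wt_prod_ge0.
  rewrite -{1}[\prod_i w (x i)]mul1r -mulrBl normrM.
  have np := norm_prod_le x.
  have um : partners j0 x = 0%N -> unmatched j0 x.
    move=> /eqP; rewrite cards_eq0 => /eqP p0; apply/forallP => j; apply/implyP => jj.
    by have := in_set0 j; rewrite -p0 inE jj /= => ->.
  case: (ltngtP 1%N (partners j0 x)) => c.
  - apply: (@le_trans _ _ (k.+2%:R * (Kw ^+ (2 + k) * \prod_i wt (x i))%:C%C)).
      apply: ler_pM => //; rewrite distrC -[1]/(1%:R) -natrB ?(ltnW c) // normr_nat ler_nat.
      by rewrite (leq_trans (leq_subr _ _)) // (leq_trans (max_card _)) // card_ord.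
    rewrite -(rmorph_nat (real_complex R)) -rmorphM lecR /= mulrCA ler_wpM2l ?exprn_ge0 //.
    by rewrite lerDr; case: ifP.
  - have p0 : partners j0 x = 0%N by move: c; case: (partners _ _).
    rewrite p0 subr0 normr1 mul1r um // addr0; exact: np.
  - rewrite -c subrr normr0 mul0r.
    rewrite ler0c mulr_ge0 ?exprn_ge0 // addr0; by case: ifP.
rewrite -rmorph_sum lecR -mulr_sumr ler_wpM2l ?exprn_ge0 // big_split /= lerD //.
  by rewrite -big_mkcondr.
rewrite -big_mkcondr /= -mulr_sumr ler_wpM2l //.
exact: sum_double_partner.
Qed.

End RealBound.
End Moments.

(** * From the recursion to Gaussian moments *)

Section GaussInduction.
Variable R : realType.

Definition gmom (A : comRingType) (m2 : A) (k : nat) : A :=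
  if odd k then 0 else \prod_(i < k./2) (2 * i + 1)%:R * m2 ^+ k./2.

Lemma gmomSS (A : comRingType) (m2 : A) k :
  gmom m2 k.+2 = k.+1%:R * (m2 * gmom m2 k).
Proof.
rewrite /gmom /= negbK; case: ifP => ok; first by rewrite !mulr0.
rewrite big_ord_recr /= exprS; have -> : (2 * k./2 + 1 = k.+1)%N.
  by rewrite mul2n -[in RHS](odd_double_half k) ok add0n addn1.
by ring.
Qed.

(** The recursion has step two, so the orders [k] and [k + 1] are carried together. [G] stands for
    the square root of the variance up to a small power and [v] for the relative saving; [c] is
    chosen before the sequence [a], which keeps the bound uniform. *)
Lemma gauss_induction (B : R) (k : nat) : 0 <= B -> exists2 c, 0 <= c &
  forall (a : nat -> R[i]) (m2 : R[i]) (G v : R), 0 <= G -> 0 <= v -> a 0%N = 1 -> a 1%N = 0 ->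
    `|m2| <= (B * G ^+ 2)%:C%C ->
    (forall j, (j.+2 <= k)%N ->
       `|a j.+2 - j.+1%:R * (m2 * a j)| <= (B * G ^+ j.+2 * v)%:C%C) ->
    `|a k - gmom m2 k| <= (c * G ^+ k * v)%:C%C.
Proof.
move=> B0.
suff : (exists2 c, 0 <= c &
  forall (a : nat -> R[i]) (m2 : R[i]) (G v : R), 0 <= G -> 0 <= v -> a 0%N = 1 -> a 1%N = 0 ->
    `|m2| <= (B * G ^+ 2)%:C%C ->
    (forall j, (j.+2 <= k)%N ->
       `|a j.+2 - j.+1%:R * (m2 * a j)| <= (B * G ^+ j.+2 * v)%:C%C) ->
    `|a k - gmom m2 k| <= (c * G ^+ k * v)%:C%C) /\
  (exists2 c, 0 <= c &
  forall (a : nat -> R[i]) (m2 : R[i]) (G v : R), 0 <= G -> 0 <= v -> a 0%N = 1 -> a 1%N = 0 ->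
    `|m2| <= (B * G ^+ 2)%:C%C ->
    (forall j, (j.+2 <= k.+1)%N ->
       `|a j.+2 - j.+1%:R * (m2 * a j)| <= (B * G ^+ j.+2 * v)%:C%C) ->
    `|a k.+1 - gmom m2 k.+1| <= (c * G ^+ k.+1 * v)%:C%C) by case.
elim: k => [|k [[c c0 IHc] IH1]].
  split; exists 0 => // a m2 G v _ _ a0 a1 _ _.
    by rewrite a0 /gmom /= big_ord0 mul1r subrr normr0 ler0c !mul0r.
  by rewrite a1 /gmom /= subr0 normr0 ler0c !mul0r.
split=> //; exists (k.+1%:R * B * c + B); first by rewrite addr_ge0 // !mulr_ge0.
move=> a m2 G v G0 v0 a0 a1 m2le err.
have := IHc a m2 G v G0 v0 a0 a1 m2le (fun j jk => err j (leq_trans jk (leqW (leqnSn k)))).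
set Dk := a k - gmom m2 k => Dle.
rewrite gmomSS.
have -> : a k.+2 - k.+1%:R * (m2 * gmom m2 k) =
   (a k.+2 - k.+1%:R * (m2 * a k)) + k.+1%:R * (m2 * Dk).
  by rewrite /Dk !mulrBr; ring.
apply: (le_trans (ler_normD _ _)).
apply: (@le_trans _ _ ((B * G ^+ k.+2 * v)%:C + k.+1%:R%:C * ((B * G ^+ 2)%:C * (c * G ^+ k * v)%:C))%C).
  apply: lerD; first by apply: err.
  rewrite normrM normr_nat normrM rmorph_nat ler_wpM2l //.
  by apply: ler_pM.
rewrite -!rmorphM -rmorphD lecR /=.
by rewrite le_eqVlt; apply/orP; left; apply/eqP; rewrite !exprS; ring.
Qed.

End GaussInduction.

Lemma uniform_bound (R : realType) (K : nat) (P : nat -> R -> Prop) :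
  (forall j A A', A <= A' -> P j A -> P j A') ->
  (forall j, (0 < j <= K)%N -> exists2 A, 0 <= A & P j A) ->
  exists2 A, 0 <= A & forall j, (0 < j <= K)%N -> P j A.
Proof.
move=> Pm; elim: K => [|K IH] HK; first by exists 0 => // j; case: j.
have [A A0 PA] : exists2 A, 0 <= A & forall j, (0 < j <= K)%N -> P j A.
  by apply: IH => j /andP[j0 jK]; apply: HK; rewrite j0 leqW.
have hK : (0 < K.+1 <= K.+1)%N by rewrite leqnn.
have [A' A'0 PA'] := HK _ hK.
exists (A + A') => [|j /andP[j0]]; first by rewrite addr_ge0.
rewrite leq_eqVlt => /orP[/eqP ->|jK]; first by apply: Pm PA'; rewrite lerDr.
by apply: (Pm j A); rewrite ?lerDl //; apply: PA; rewrite j0.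
Qed.

(** Tuples with several partners save about [H^alpha]; this has to be at least as good as the saving
    for unmatched ones. *)
Lemma saving_le (R : realType) (alpha : R) : 0 < alpha < 1 -> saving alpha <= alpha.
Proof.
move=> /andP[a0 a1]; rewrite /saving /c1.
have a2 : alpha ^+ 2 <= 1 by rewrite exprn_ile1 ?ltW.
have h1 : alpha ^+ 2 * (1 - alpha) <= 1.
  by rewrite mulr_ile1 ?exprn_ge0 ?subr_ge0 ?(ltW a0) ?(ltW a1) // gerBl ltW.
have h0 : 0 <= alpha ^+ 2 * (1 - alpha) by rewrite mulr_ge0 ?exprn_ge0 ?subr_ge0 ?(ltW a0) ?(ltW a1).
set u := alpha ^+ 2 * (1 - alpha) in h0 h1 *.
have -> : u / 256 * alpha * (1 - alpha) / 4 = alpha * (u * (1 - alpha) / 1024) by field.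
rewrite ler_piMr ?(ltW a0) // ler_pdivrMr // mul1r.
have : u * (1 - alpha) <= 1 by rewrite mulr_ile1 ?subr_ge0 ?(ltW a1) // gerBl ltW.
lra.
Qed.

Theorem moments_bound (R : realType) (alpha : R) (k : nat) (e0 : R) :
  0 < alpha < 1 -> (0 < k)%N -> 0 < e0 ->
  exists2 th, alpha < th & forall Z Kw : R, 0 <= Kw ->
  exists2 A, 0 <= A & forall (n : nat) (b : 'I_n -> nat),
    (forall i, (1 < b i)%N) -> (forall i j, i != j -> coprime (b i) (b j)) ->
    \sum_i (b i)%:R `^ (- th) <= Z ->
    forall H, 1 <= H -> forall w : 'I_(modulus b) -> R[i],
    (forall x, `|w x| <= (Kw * wt b H x)%:C%C) ->
    mom (fun v : 'I_(modulus b) => wt b H v) k <= A * H `^ (k%:R * alpha / 2 + e0) /\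
    `|mom w k - gmom (mom w 2) k| <=
      (A * H `^ (k%:R * alpha / 2 + k%:R * e0 - saving alpha / k.+1%:R))%:C%C.
Proof.
move=> a01 k0 e00; have [a0 a1] := andP a01.
(* Taking [K = k + 1] makes the second moment available also when [k = 1]. *)
have [th th_gt core] := core_bounds a01 (ltn0Sn k) e00.
exists th => // Z Kw Kw0.
pose P (j : nat) (A : R) := forall (n : nat) (b : 'I_n -> nat),
    (forall i, (1 < b i)%N) -> (forall i j, i != j -> coprime (b i) (b j)) ->
    \sum_i (b i)%:R `^ (- th) <= Z ->
    forall H, 1 <= H -> forall j0 : 'I_j, j0 = 0%N :> nat ->
    \sum_(x : {ffun 'I_j -> 'I_(modulus b)} | zerosum x) \prod_i wt b H (x i) <=
      A * H `^ (j%:R * alpha / 2 + e0) /\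
    \sum_(x : {ffun 'I_j -> 'I_(modulus b)} | zerosum x && unmatched j0 x)
      \prod_i wt b H (x i) <= A * H `^ (j%:R * alpha / 2 - saving alpha / k.+1%:R).
have [A A0 PA] : exists2 A, 0 <= A & forall j, (0 < j <= k.+1)%N -> P j A.
  apply: uniform_bound; last by move=> j jK; apply: (core Z j jK).
  move=> j B B' BB' PB n b b1 bco zb H H1 j0 j0E.
  have [h1 h2] := PB n b b1 bco zb H H1 j0 j0E.
  by split; [apply: (le_trans h1) | apply: (le_trans h2)]; rewrite ler_wpM2r ?powR_ge0.
pose B : R := (1 + Kw) ^+ k.+2 * (A * (1 + (k.+2%:R) ^+ 3)).
have B0 : 0 <= B.
  by apply: mulr_ge0; [rewrite exprn_ge0 // addr_ge0 | apply: mulr_ge0 => //; rewrite addr_ge0 // exprn_ge0].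
have [c c0 ind] := gauss_induction k B0.
exists (A + c) => [|n b b1 bco zb H H1 w wle]; first by rewrite addr_ge0.
have H0 : 0 < H by exact: lt_le_trans H1.
have Sle j : (0 < j <= k.+1)%N ->
    mom (fun v : 'I_(modulus b) => wt b H v) j <= A * H `^ (j%:R * alpha / 2 + e0).
  case: j => // j jK; have [h _] := PA _ jK n b b1 bco zb H H1 ord0 erefl.
  exact: h.
split.
  apply: (le_trans (Sle k _)); first by rewrite k0 leqnSn.
  by rewrite ler_wpM2r ?powR_ge0 // lerDl.
set g := saving alpha / k.+1%:R.
have g_le : g <= alpha.
  rewrite /g ler_pdivrMr ?ltr0n //; apply: (le_trans (saving_le a01)).
  by rewrite ler_peMr ?(ltW a0) // ler1n.
pose G := H `^ (alpha / 2 + e0); pose v := H `^ (- g).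
have Gpow m : G ^+ m = H `^ (m%:R * (alpha / 2 + e0)).
  by rewrite -powR_mulrn ?powR_ge0 // -powRrM mulrC.
have Kpow m : (m <= k.+2)%N -> Kw ^+ m <= (1 + Kw) ^+ k.+2.
  move=> mk; apply: (@le_trans _ _ ((1 + Kw) ^+ m)).
    by apply: lerXn2r; rewrite ?nnegrE ?addr_ge0 // lerDr.
  by apply: ler_weXn2l => //; rewrite lerDl.
have w0 : w (Ordinal (modulus_gt0 b1)) = 0.
  apply/eqP; rewrite -normr_le0; apply: (le_trans (wle _)).
  by rewrite /= wt0 // mulr0.
have /(_ (mom w) (mom w 2) G v) := ind.
rewrite !powR_ge0 => /(_ isT isT) indw.
have -> : ((A + c) * H `^ (k%:R * alpha / 2 + k%:R * e0 - g))%:C%C =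
    (A * H `^ (k%:R * alpha / 2 + k%:R * e0 - g))%:C%C + (c * G ^+ k * v)%:C%C.
  rewrite -rmorphD /=; congr (_%:C)%C; rewrite mulrDl; congr (_ + _).
  by rewrite Gpow -[RHS]mulrA /v -powRDp //; congr (_ * powR _ _); ring.
apply: ler_wpDl; first by rewrite ler0c mulr_ge0 // powR_ge0.
apply: indw.
- rewrite /mom (big_pred1 [ffun=> Ordinal (modulus_gt0 b1)]) ?big_ord0 // => x.
  rewrite /zerosum big_ord0 dvdn0 /= ; apply/esym/eqP/ffunP; by case.
- rewrite /mom big1 // => x; rewrite /zerosum !big_ord1 => /dvdnP[q xq].
  suff -> : x ord0 = Ordinal (modulus_gt0 b1) by [].
  apply: val_inj => /=; have := ltn_ord (x ord0); rewrite xq.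
  by case: q {xq} => // q; rewrite mulSn ltnNge leq_addr.
- apply: (le_trans (norm_mom_le wle 2%N)); rewrite lecR.
  have S2 := Sle 2%N k0.
  rewrite /B -mulrA; apply: ler_pM; rewrite ?exprn_ge0 ?sumr_ge0 ?Kpow //.
    by move=> x _; apply: wt_prod_ge0.
  apply: (le_trans S2); rewrite -[leRHS]mulrA ler_wpM2l // Gpow.
  apply: (@le_trans _ _ (H `^ (2%:R * (alpha / 2 + e0)))).
    by apply: ler_powR => //; lra.
  by rewrite ler_peMl ?powR_ge0 // lerDl exprn_ge0.
- move=> j jk; apply: (le_trans (mom_recursion b1 bco H1 j wle Kw0)); rewrite lecR.
  rewrite [leRHS](_ : _ = (1 + Kw) ^+ k.+2 * ((A * (1 + k.+2%:R ^+ 3)) * (G ^+ j.+2 * v))); last first.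
    by rewrite /B; ring.
  apply: ler_pM; rewrite ?exprn_ge0 ?Kpow //.
  + rewrite addr_ge0 ?sumr_ge0 ?mulr_ge0 ?sumr_ge0 // => x _; exact: wt_prod_ge0.
  + by rewrite add2n ltnW // ltnW.
  have [_ hN] := PA j.+2 (leqW jk) n b b1 bco zb H H1 ord0 erefl.
  rewrite [A * (1 + _)]mulrDr mulr1 [leRHS]mulrDl; apply: lerD.
    apply: (le_trans hN); rewrite ler_wpM2l // Gpow -powRDp //; apply: ler_powR => //.
    have : 0 <= j.+2%:R * e0 by rewrite mulr_ge0 // ltW.
    by rewrite -/g; lra.
  case: j jk {hN} => [|j] jk; first by rewrite mul0r !mulr0 mulr_ge0 ?mulr_ge0 ?exprn_ge0 ?powR_ge0.
  have Sj := Sle j.+1 (leqW (ltnW (ltnW jk))).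
  (* Two coordinates fewer save [H^alpha], and [g <= alpha]. *)
  have Xle : H `^ (j.+1%:R * alpha / 2 + e0) <= G ^+ j.+3 * v.
    rewrite Gpow -powRDp //; apply: ler_powR => //.
    have -> : j.+3%:R = j.+1%:R + 2 :> R by rewrite -natrD addn2.
    have : 0 <= j.+1%:R * e0 by rewrite mulr_ge0 // ltW.
    by lra.
  move: Xle; set X := G ^+ j.+3 * v => Xle.
  have X0 : 0 <= X by apply: le_trans Xle; apply: powR_ge0.
  clearbody X.
  apply: (@le_trans _ _ (j.+3%:R * (j.+2%:R * (j.+1%:R * (A * X))))).
    do 3!(apply: ler_wpM2l => //); apply: (le_trans Sj); exact: ler_wpM2l.
  rewrite [leRHS](_ : _ = k.+2%:R * (k.+2%:R * (k.+2%:R * (A * X)))); last by ring.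
  have h m : (m <= j.+3)%N -> (m%:R : R) <= k.+2%:R.
    by move=> mj; rewrite ler_nat; move: jk mj; clear; lia.
  have hstep m (Y Y' : R) : (m <= j.+3)%N -> 0 <= Y -> Y <= Y' ->
      m%:R * Y <= k.+2%:R * Y'.
    by move=> mj Y0 YY; apply: ler_pM => //; apply: h.
  have AX : 0 <= A * X by exact: mulr_ge0.
  apply: (hstep j.+3) => //; first by do 2!apply: mulr_ge0 => //.
  apply: (hstep j.+2) => //; first by apply: mulr_ge0.
  by apply: (hstep j.+1) => //; apply: leqW.
Qed.

End ZeroSums.

From mathcomp Require Import all_classical all_reals all_analysis.
From mathcomp Require Import all_boot all_order all_algebra.
From mathcomp Require Import archimedean finmap complex.
From mathcomp Require Import ring lra zify.
Import Order.TTheory GRing.Theory Num.Theory.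
Import numFieldNormedType.Exports.
Import ZeroSums.
Local Open Scope ring_scope.

(** * The moments as limits of finite sums *)

Section Truncation.
Variables (R : realType) (B : set nat).
Hypothesis B_gt1 : forall c, B c -> (1 < c)%N.
Hypothesis B_coprime : forall c c', B c -> B c' -> c != c' -> coprime c c'.
Variable N : nat.

Definition trunc_seq : seq nat := [seq c <- iota 0 N | `[< B c >]].
Definition tb (i : 'I_(size trunc_seq)) : nat := nth 0%N trunc_seq i.
Local Notation n := (size trunc_seq).
Local Notation b := tb.
Local Notation M := (modulus b).

Lemma tb_mem i : b i \in trunc_seq.
Proof. exact: mem_nth. Qed.

Lemma tb_B i : B (b i).
Proof. by have := tb_mem i; rewrite mem_filter => /andP[/asboolP]. Qed.

Lemma trunc_uniq : uniq trunc_seq.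
Proof. by rewrite filter_uniq // iota_uniq. Qed.

Lemma tb_inj : injective b.
Proof. by move=> i j /eqP; rewrite nth_uniq ?trunc_uniq // => /eqP /val_inj. Qed.

Lemma tb_gt1 i : (1 < b i)%N. Proof. exact/B_gt1/tb_B. Qed.

Lemma tb_coprime i j : i != j -> coprime (b i) (b j).
Proof. by move=> ij; apply: B_coprime; rewrite ?(inj_eq tb_inj) //; apply: tb_B. Qed.

Lemma tb_ex c : B c -> (c < N)%N -> exists i, b i = c.
Proof.
move=> Bc cN; have cs : c \in trunc_seq by rewrite mem_filter mem_iota add0n cN leq0n !andbT; apply/asboolP.
have ci : (index c trunc_seq < n)%N by rewrite index_mem.
by exists (Ordinal ci); rewrite /b nth_index.
Qed.

Lemma coprime_rad c (D : {set 'I_n}) : (forall i, i \in D -> coprime c (b i)) ->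
  coprime c (rad b D).
Proof.
move=> cD; rewrite /rad; apply: (big_ind (fun p => coprime c p)) => //.
- exact: coprimen1.
- by move=> p q cp cq; rewrite coprimeMr cp.
Qed.

Lemma dvd_rad c (D : {set 'I_n}) : B c -> (c %| rad b D)%N -> exists2 i, i \in D & b i = c.
Proof.
move=> Bc cD; case: (pickP (fun i => (i \in D) && (b i == c))) => [i /andP[iD /eqP <-]|P0].
  by exists i.
have : coprime c (rad b D).
  apply: coprime_rad => i iD; apply: B_coprime => //; first exact: tb_B.
  by have := P0 i; rewrite iD /= eq_sym => /negbT.
by rewrite /coprime (gcdn_idPl cD) => /eqP c1; have := B_gt1 Bc; rewrite c1.
Qed.

Lemma b_dvd_rad i (D : {set 'I_n}) : (b i %| rad b D)%N = (i \in D).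
Proof.
apply/idP/idP => [/(dvd_rad (tb_B i)) [j jD /tb_inj <-] //|iD].
by rewrite /rad (big_setD1 i iD) /= dvdn_mulr.
Qed.

Lemma rad_inj : injective (rad b).
Proof. by move=> D E DE; apply/setP => i; rewrite -!b_dvd_rad DE. Qed.

Lemma rad_semigroup (D : {set 'I_n}) : semigroup_gen B (rad b D).
Proof.
exists [seq b i | i <- enum D]; split.
  by move=> c /mapP[i _ ->]; apply: tb_B.
by rewrite big_map /rad big_enum.
Qed.

Lemma rad_sqB (D : {set 'I_n}) : sqB R B (rad b D).
Proof.
rewrite /sqB /= /muB; case: asboolP => [[]|_]; last by rewrite -exprM mulnC exprM sqrrN !expr1n.
  by case; apply: rad_semigroup.
case=> c Bc c2; have cD : (c %| rad b D)%N by apply: dvdn_trans c2; rewrite dvdn_mulr.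
have [i iD ic] := dvd_rad Bc cD.
have : (b i %| rad b (D :\ i))%N.
  move: c2; rewrite -ic /rad (big_setD1 i iD) /= expnS expn1 dvdn_pmul2l //.
  by apply: ltnW; apply: tb_gt1.
by rewrite b_dvd_rad !inE eqxx.
Qed.

Lemma Bfree_gcd (D : {set 'I_n}) a : (0 < a)%N ->
  Bfree B (gcdn a (rad b D)) <-> forall i, i \in D -> ~~ (b i %| a)%N.
Proof.
move=> a0; split=> [[_ nb] i iD|nb].
  apply/negP => ba; have := nb _ (tb_B i); rewrite dvdn_gcd ba /=.
  by rewrite b_dvd_rad iD.
split=> [|c Bc]; first by rewrite gcdn_gt0 a0.
by apply/negP; rewrite dvdn_gcd => /andP[ca /(dvd_rad Bc) [i /nb + ic]]; rewrite ic ca.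
Qed.

Lemma modulusR_gt0 : (0 : R) < M%:R.
Proof. by rewrite ltr0n; apply: modulus_gt0; apply: tb_gt1. Qed.

(** The correspondence is [x = a * rad (~: D)]. The representative [a = r] drops out, since
    [gcd(r, r) = r] is not B-free for nonempty [D]. *)
Lemma RB_rad (D : {set 'I_n}) (y : R) : D != set0 ->
  RB B (rad b D) y <-> exists2 x : 'I_M, supp b x = D & y = x%:R / M%:R.
Proof.
move=> D0; set r := rad b D; set q := rad b (~: D).
have rq : M = (r * q)%N by rewrite -(radC b D).
have r0 : (0 < r)%N by apply: rad_gt0; apply: tb_gt1.
have q0 : (0 < q)%N by apply: rad_gt0; apply: tb_gt1.
have rR : (r%:R : R) != 0 by rewrite pnatr_eq0 -lt0n.
have qR : (q%:R : R) != 0 by rewrite pnatr_eq0 -lt0n.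
split=> [[a [/andP[a1 ar] bf ->]]|[x xD ->]].
  have nb := (Bfree_gcd D a1).1 bf.
  have ltr : (a < r)%N.
    rewrite ltn_neqAle ar andbT; apply/eqP => E; have [i iD] := set0Pn _ D0.
    by have := nb i iD; rewrite E b_dvd_rad iD.
  have xM : (a * q < M)%N by rewrite rq ltn_pmul2r.
  exists (Ordinal xM) => /=; last by rewrite rq !natrM; field; rewrite ?rR ?qR.
  apply/setP => i; rewrite inE; case: (boolP (i \in D)) => iD.
    rewrite Gauss_dvdl; first exact: nb.
    apply: coprime_rad => j; rewrite inE => jD; apply: tb_coprime.
    by apply: contraNneq jD => <-.
  by apply/negbTE; rewrite negbK dvdn_mull // b_dvd_rad inE.
have qx : (q %| x)%N.
  apply: rad_dvd; first exact: tb_coprime.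
  by move=> i; rewrite inE -xD suppP.
have x0 : (0 < x)%N by rewrite lt0n -supp_eq0 ?xD //; exact: tb_coprime.
exists (x %/ q)%N; split.
- rewrite divn_gt0 // (dvdn_leq x0 qx) /= leq_divLR // -rq; exact: ltnW.
- apply/(Bfree_gcd D); first by rewrite divn_gt0 // (dvdn_leq x0 qx).
  move=> i; rewrite -xD inE; apply: contra => bx.
  by rewrite -(divnK qx) dvdn_mulr.
- have -> : (x%:R : R) = (x %/ q)%:R * q%:R by rewrite -natrM divnK.
  by rewrite {2}rq natrM; field; rewrite ?rR ?qR.
Qed.

Lemma sum_div_int k (x : {ffun 'I_k -> 'I_M}) :
  (\sum_(j < k) ((x j)%:R / M%:R : R) \is a Num.int) = zerosum x.
Proof.
have M0 := modulusR_gt0; have M1 : (M%:R : R) != 0 by rewrite gt_eqF.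
rewrite -mulr_suml -natr_sum /zerosum; set s := (\sum_(j < k) x j)%N.
apply/idP/idP => [/intrP[z sz]|/dvdnP[q ->]]; last by rewrite natrM mulfK.
have E : s%:R = z%:~R * M%:R :> R by rewrite -sz mulfVK.
have z0 : (0 <= z)%R.
  by rewrite -(ler0z R) -(pmulr_lge0 _ M0) -E.
case: z z0 E {sz} => // z _; rewrite -pmulrn -natrM => /eqP; rewrite eqr_nat => /eqP ->.
by rewrite dvdn_mull.
Qed.

End Truncation.

(** * Unordered sums as limits along exhaustions *)

Section Summation.
Variables (R : realType) (I : choiceType) (f : I -> R[i]).

Definition cnorm (z : R[i]) : R := complex.Re `|z|.

Lemma cnormE z : `|z| = (cnorm z)%:C%C.
Proof. by rewrite /cnorm normc_def. Qed.

Lemma cnorm_ge0 z : 0 <= cnorm z.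
Proof. by rewrite -ler0c -cnormE. Qed.

Lemma fsum_diff (V : zmodType) (g : I -> V) (X Y : {fset I}) : (X `<=` Y)%fset ->
  \sum_(i <- Y) g i = \sum_(i <- X) g i + \sum_(i <- (Y `\` X)%fset) g i.
Proof.
move=> XY; rewrite (big_fsetID _ (fun i => i \in X)) /=; congr (_ + _).
  apply: eq_fbigl => i; rewrite !inE /=; apply: andb_idl; exact: (fsubsetP XY).
by apply: eq_fbigl => i; rewrite !inE /= andbC.
Qed.

Section Fsets.
Variables (A : nat -> {fset I}) (C : R).
Hypothesis A_mono : forall n m, (n <= m)%N -> (A n `<=` A m)%fset.
Hypothesis A_exh : forall i, f i != 0 -> exists n, i \in A n.
Hypothesis A_bnd : forall n, \sum_(i <- A n) `|f i| <= C%:C%C.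
Hypothesis A_real : forall n, complex.Im (\sum_(i <- A n) f i) = 0.

Let F i : R := cnorm (f i).
Let T n : R := \sum_(i <- A n) F i.
Let S n : R := complex.Re (\sum_(i <- A n) f i).

Lemma fset_exh (X : {fset I}) : exists m, forall i, i \in X -> f i != 0 -> i \in A m.
Proof.
suff [m hm] : exists m, forall i, i \in (X : seq I) -> f i != 0 -> i \in A m by exists m.
elim: (X : seq I) => [|x s [m hm]]; first by exists 0%N.
have [fx|/A_exh [p xp]] := eqVneq (f x) 0.
  by exists m => i; rewrite inE => /orP[/eqP ->|/hm //]; rewrite fx eqxx.
exists (maxn m p) => i; rewrite inE => /orP[/eqP -> _|/hm h /h].
  exact: (fsubsetP (A_mono (leq_maxr _ _))).
exact: (fsubsetP (A_mono (leq_maxl _ _))).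
Qed.

Let T_ub n : T n <= C.
Proof.
rewrite -lecR rmorph_sum /=; apply: le_trans (A_bnd n).
by rewrite le_eqVlt; apply/orP; left; apply/eqP/eq_bigr => i _; rewrite cnormE.
Qed.

Let T_mono : {homo T : n m / (n <= m)%N >-> n <= m}.
Proof.
move=> n m nm; rewrite /T (fsum_diff F (A_mono nm)) lerDl sumr_ge0 // => i _.
exact: cnorm_ge0.
Qed.

Let T_cvg : cvgn T.
Proof.
by apply: nondecreasing_is_cvgn => //; exists C => _ [n _ <-]; apply: T_ub.
Qed.

Lemma fsum_le_lim (X : {fset I}) : \sum_(i <- X) F i <= limn T.
Proof.
have [m hm] := fset_exh X.
apply: (@le_trans _ _ (T m)); last exact: nondecreasing_cvgn_le.
have XU : (X `<=` X `|` A m)%fset by apply: fsubsetUl.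
have AU : (A m `<=` X `|` A m)%fset by apply: fsubsetUr.
apply: (@le_trans _ _ (\sum_(i <- (X `|` A m)%fset) F i)).
  by rewrite (fsum_diff F XU) lerDl sumr_ge0 // => i _; exact: cnorm_ge0.
rewrite (fsum_diff F AU) gerDl big_seq big1 // => i; rewrite !inE => /andP[iA].
rewrite (negbTE iA) orbF => iX; have := hm i iX.
case: (eqVneq (f i) 0) => [fi _|_ /(_ isT)]; last by rewrite (negbTE iA).
by rewrite /F /cnorm fi normr0.
Qed.

Lemma Re_sum (s : seq I) : complex.Re (\sum_(i <- s) f i) = \sum_(i <- s) complex.Re (f i).
Proof. by rewrite raddf_sum. Qed.

Lemma Re_ge_cnorm z : - cnorm z <= complex.Re z <= cnorm z.
Proof.
rewrite -ler_norml -lecR -cnormE; have := normc_ge_Re z.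
by rewrite !cnormE.
Qed.

Let S_cvg : cvgn S.
Proof.
(* Since [|f i| + Re (f i) >= 0], adding the absolute values makes the sequence monotone;
   subtracting the convergent [T] gives back [S]. *)
have U_cvg : cvgn (T \+ S).
  apply: nondecreasing_is_cvgn => [n m nm|].
    rewrite /= /T /S !Re_sum -!big_split /= (fsum_diff _ (A_mono nm)) lerDl.
    apply: sumr_ge0 => i _; rewrite -lerBlDl sub0r.
    by have /andP[] := Re_ge_cnorm (f i).
  exists (C + C) => _ [n _ <-] /=; apply: lerD => //.
  apply: le_trans (T_ub n); rewrite /S Re_sum; apply: ler_sum => i _.
  by have /andP[] := Re_ge_cnorm (f i).
have -> : S = (T \+ S) \- T by apply/funext => n /=; rewrite addrAC subrr add0r.
exact: is_cvgB.
Qed.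

(** Beyond [A n] the rest of any finite partial sum has norm at most [limn T - T n], so the filter
    of finite sets and the sequence [A n] lead to the same limit. It is real because the sums over
    [A n] are. *)
Lemma sum_fsets : exists2 L : R, @summability.sum I R[i] R[i]^o f = L%:C%C &
  (complex.Re (\sum_(i <- A n) f i) @[n --> \oo] --> L)%classic.
Proof.
exists (limn S); last exact: S_cvg.
have FF := @summability.totally_filter I.
apply: cvg_lim; first exact: norm_hausdorff.
have F' : Filter (@summability.totally I) by case: FF.
apply/(@cvgrPdist_le R[i] R[i]^o _ _ F') => e e0.
have eE : e = (complex.Re e)%:C%C.
  by move: e0; case: e => x y; rewrite ltcE /= => /andP[/eqP -> _].
set d := complex.Re e in eE.
have d0 : 0 < d / 2 by move: e0; rewrite eE ltcR => d0; rewrite divr_gt0.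
have [n1 _ hT] := (@cvgrPdist_le R R _ _ _ _ _).1 T_cvg _ d0.
have [n2 _ hS] := (@cvgrPdist_le R R _ _ _ _ _).1 S_cvg _ d0.
pose n := maxn n1 n2.
have {}hT := hT n (leq_maxl _ _); have {}hS := hS n (leq_maxr _ _).
exists (A n) => // X AX.
have -> : summability.partial_sum f X = \sum_(i <- X) f i.
  by rewrite /summability.partial_sum big_seq_fsetE.
rewrite (fsum_diff f AX).
have -> : \sum_(i <- A n) f i = (S n)%:C%C.
  by rewrite /S; move: (A_real n); case: (\sum_(i <- A n) f i) => x y /= ->.
rewrite opprD addrA -rmorphB /=; apply: (le_trans (ler_normB _ _)).
rewrite eE (_ : d = d / 2 + d / 2); last by rewrite -splitr.
have -> : (d / 2 + d / 2)%:C%C = (d / 2)%:C%C + (d / 2)%:C%C :> R[i] by rewrite -rmorphD.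
apply: (@lerD R[i]).
  by rewrite normc_def /= expr0n addr0 sqrtr_sqr lecR.
apply: (le_trans (ler_norm_sum _ _ _)).
under eq_bigr do rewrite cnormE.
rewrite -rmorph_sum lecR -(lerD2l (T n)) /T -(fsum_diff F AX).
apply: (le_trans (fsum_le_lim X)).
rewrite -lerBlDl; exact: le_trans (ler_norm _) hT.
Qed.

End Fsets.

Lemma sum_seqs (A : nat -> seq I) (C : R) :
    (forall n, uniq (A n)) ->
    (forall n m, (n <= m)%N -> {subset A n <= A m}) ->
    (forall i, f i != 0 -> exists n, i \in A n) ->
    (forall n, \sum_(i <- A n) `|f i| <= C%:C%C) ->
    (forall n, complex.Im (\sum_(i <- A n) f i) = 0) ->
  exists2 L : R, @summability.sum I R[i] R[i]^o f = L%:C%C &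
  (complex.Re (\sum_(i <- A n) f i) @[n --> \oo] --> L)%classic.
Proof.
move=> Au Am Ae Ab Ar; pose A' n := [fset x in A n]%fset.
have AE n (V : zmodType) (g : I -> V) : \sum_(i <- A' n) g i = \sum_(i <- A n) g i.
  apply: perm_big; apply: uniq_perm; rewrite ?fset_uniq // => i.
  by rewrite in_fset_ /= ?inE.
have h1 n m : (n <= m)%N -> (A' n `<=` A' m)%fset.
  by move=> nm; apply/fsubsetP => i; rewrite !inE; apply: Am.
have h2 i : f i != 0 -> exists n, i \in A' n.
  by move=> /Ae[n iA]; exists n; rewrite !inE.
have h3 n : \sum_(i <- A' n) `|f i| <= C%:C%C by rewrite AE.
have h4 n : complex.Im (\sum_(i <- A' n) f i) = 0 by rewrite AE.
have [L hL cL] := sum_fsets h1 h2 h3 h4.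
exists L => //; apply: cvg_trans cL; apply: near_eq_cvg.
by near=> n; rewrite AE.
Unshelve. all: by end_near.
Qed.

End Summation.

Lemma conjcM (R : rcfType) (x y : R[i]) : (x * y)^*%C = x^*%C * y^*%C.
Proof. exact: rmorphM. Qed.

Lemma conjc_sum (R : rcfType) (I : Type) (r : seq I) (P : pred I) (F : I -> R[i]) :
  (\sum_(i <- r | P i) F i)^*%C = \sum_(i <- r | P i) (F i)^*%C.
Proof. by apply: big_morph => [x y|]; [apply: rmorphD|apply: conjc0]. Qed.

Lemma conjc_prod (R : rcfType) (I : Type) (r : seq I) (P : pred I) (F : I -> R[i]) :
  (\prod_(i <- r | P i) F i)^*%C = \prod_(i <- r | P i) (F i)^*%C.
Proof. by apply: big_morph => [x y|]; [apply: conjcM|apply: conjc1]. Qed.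

(** * Conjugation symmetry *)

Section RealMoments.
Variables (R : realType) (n : nat) (b : 'I_n -> nat).
Hypothesis b_gt1 : forall i, (1 < b i)%N.
Local Notation M := (modulus b).

Definition negM (x : 'I_M) : 'I_M :=
  Ordinal (ltn_pmod (M - x) (modulus_gt0 b_gt1)).

Lemma negM_add (x : 'I_M) : (M %| x + negM x)%N.
Proof.
by rewrite /dvdn /= modnDmr subnKC ?modnn // ltnW.
Qed.

Lemma negMK : involutive negM.
Proof.
move=> x; apply: val_inj => /=.
have := ltn_ord x; case: (posnP x) => [-> _|x0 xM].
  by rewrite subn0 modnn subn0 modnn.
rewrite (@modn_small (M - x)); last by rewrite -subn_gt0 subKn // ltnW.
by rewrite subKn ?modn_small // ltnW.
Qed.

(** Negating all coordinates preserves zero-sum tuples and conjugates every product, so the moment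
    equals its conjugate. *)
Lemma mom_conj (w : 'I_M -> R[i]) k : (forall x, w (negM x) = (w x)^*%C) ->
  complex.Im (mom w k) = 0.
Proof.
move=> wc; suff /(congr1 (@complex.Im R)) : (mom w k)^*%C = mom w k.
  by case: (mom w k) => x y /= /eqP; rewrite eq_sym -subr_eq0 opprK -mulr2n mulrn_eq0 => /eqP.
pose h (x : {ffun 'I_k -> 'I_M}) := [ffun j => negM (x j)].
have hK : involutive h by move=> x; apply/ffunP => j; rewrite !ffunE negMK.
rewrite /mom conjc_sum (reindex_inj (inv_inj hK)) /=; apply: eq_big => x.
  rewrite /zerosum; apply/idP/idP => H.
    rewrite -(dvdn_addl _ H) -big_split; apply: (big_ind (fun p => M %| p)%N) => // [p q|i _].
      exact: dvdn_add.
    by rewrite ffunE; apply: negM_add.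
  rewrite -(dvdn_addr _ H) -big_split; apply: (big_ind (fun p => M %| p)%N) => // [p q|i _].
    exact: dvdn_add.
  by rewrite ffunE; apply: negM_add.
by move=> _; rewrite conjc_prod; apply: eq_bigr => j _; rewrite ffunE wc conjcK.
Qed.

End RealMoments.

(** * Truncated series as moments *)

Section Bridge.
Variables (R : realType) (B : set nat).
Hypothesis B_gt1 : forall c, B c -> (1 < c)%N.
Hypothesis B_coprime : forall c c', B c -> B c' -> c != c' -> coprime c c'.
Local Notation nN N := (size (trunc_seq B N)).
Local Notation bN N := (@tb B N).
Local Notation MN N := (modulus (bN N)).
Variables (phi : R -> R) (H : R).

(** The residue 0 has empty support and would correspond to [r = 1], which the series omits. *)
Definition wN N (x : 'I_(MN N)) : R[i] :=
  if x == 0%N :> nat then 0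
  else (gB R B (rad (bN N) (supp (bN N) x)))%:C%C * Phi phi H (x%:R / (MN N)%:R).

Lemma tb_ltN N i : (bN N i < N)%N.
Proof. by have := tb_mem i; rewrite mem_filter mem_iota add0n => /andP[_ /andP[]]. Qed.

(** Absence of square divisors makes the factors of [r] distinct, and the bound on its divisors in B
    puts them all into the truncation. *)
Lemma sqB_rad N r : sqB R B r -> (forall c, B c -> (c %| r)%N -> (c < N)%N) ->
  exists D : {set 'I_(nN N)}, r = rad (bN N) D.
Proof.
rewrite /sqB /= /muB; case: asboolP => [_|nP _ cN].
  by rewrite expr0n => /eqP; rewrite eq_sym oner_eq0.
have {nP}[[s [sB rE]] nsq] : semigroup_gen B r /\ ~ exists2 c, B c & (c ^ 2 %| r)%N.
  by split=> [|h]; [apply: contrapT => h|]; apply: nP; [left|right].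
have us : uniq s.
  apply/negPn/negP => /uniqPn - /(_ 0%N)[i [j [ij js E]]].
  apply: nsq; exists (nth 0%N s i); first by apply/sB/mem_nth; exact: ltn_trans js.
  rewrite rE (big_nth 0%N) big_mkord.
  rewrite (bigD1 (Ordinal (ltn_trans ij js))) //= (bigD1 (Ordinal js)) /=; last first.
    by rewrite -val_eqE /= gtn_eqF.
  by rewrite -E mulnA dvdn_mulr // expnS expn1.
exists [set i | bN N i \in s]; rewrite rE /rad -big_enum -(big_map (bN N) xpredT id) /=.
apply: perm_big; apply: uniq_perm => //.
  by rewrite map_inj_uniq ?enum_uniq //; exact: tb_inj.
move=> c; apply/idP/mapP => [cs|[i + ->]]; last by rewrite mem_enum inE.
have [|i ic] := @tb_ex B N c (sB _ cs).
  apply: cN; first exact: sB.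
  by rewrite rE (big_rem c) //= dvdn_mulr.
by exists i => //; rewrite mem_enum inE ic.
Qed.

Definition radf N k (D : {ffun 'I_k -> {set 'I_(nN N)}}) : {ffun 'I_k -> nat} :=
  [ffun j => rad (bN N) (D j)].

Definition nonempties N k : pred {ffun 'I_k -> {set 'I_(nN N)}} :=
  fun D => [forall j, D j != finset.set0].

Definition index_seq N k : seq {ffun 'I_k -> nat} :=
  [seq radf D | D <- enum (@nonempties N k)].

Lemma index_uniq N k : uniq (index_seq N k).
Proof.
rewrite map_inj_uniq ?enum_uniq // => D E /ffunP DE; apply/ffunP => j.
by apply: (rad_inj B_gt1 B_coprime); have := DE j; rewrite !ffunE.
Qed.

Lemma mem_index N k (r : {ffun 'I_k -> nat}) : r \in index_seq N k <->
  forall j, [/\ (1 < r j)%N, sqB R B (r j) &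
                forall c, B c -> (c %| r j)%N -> (c < N)%N].
Proof.
split=> [/mapP[D] + -> j|h].
  rewrite mem_enum => /forallP /(_ j) D0; rewrite ffunE; split.
  - by apply: rad_gt1 => //; apply: tb_gt1.
  - exact: rad_sqB.
  - by move=> c Bc /(dvd_rad B_gt1 B_coprime Bc)[i _ <-]; apply: tb_ltN.
have /fin_all_exists[D hD] : forall j, exists D : {set 'I_(nN N)}, r j = rad (bN N) D.
  by move=> j; have [_ rj cj] := h j; apply: sqB_rad.
apply/mapP; exists [ffun j => D j]; last by apply/ffunP => j; rewrite !ffunE.
rewrite mem_enum; apply/forallP => j; rewrite ffunE; apply/eqP => D0.
by have [+ _ _] := h j; rewrite hD D0 rad0.
Qed.

(** Division by [M] maps the zero-sum tuples with supports [D] bijectively onto the tuples of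
    fractions of the inner sum. *)
Lemma Ck_term_rad N k (D : {ffun 'I_k -> {set 'I_(nN N)}}) : nonempties D ->
  Ck_term B phi H (radf D) =
  \sum_(x : {ffun 'I_k -> 'I_(MN N)} | zerosum x && (supps x == D))
     \prod_j wN (x j).
Proof.
move=> /forallP D0; rewrite /Ck_term asboolT; last first.
  move=> j; rewrite ffunE; split; last exact: rad_sqB.
  by apply: rad_gt1 => //; apply: tb_gt1.
rewrite /Ck_inner.
pose h (x : {ffun 'I_k -> 'I_(MN N)}) : {ffun 'I_k -> R} := [ffun j => (x j)%:R / (MN N)%:R].
pose P : pred {ffun 'I_k -> 'I_(MN N)} := fun x => zerosum x && (supps x == D).
have M0 : (MN N)%:R != 0 :> R by rewrite gt_eqF // modulusR_gt0.
have h_inj : injective h.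
  move=> x y /ffunP E; apply/ffunP => j; apply: val_inj; have := E j; rewrite !ffunE.
  by move=> /(mulIf (invr_neq0 M0)) /eqP; rewrite eqr_nat => /eqP.
rewrite [X in \sum_(_ \in X) _](_ : _ = (h @` [set x | P x])%classic); last first.
  apply/seteqP; split=> [s [sRB sint]|_ [x /andP[xz /eqP xD] <-]] /=; last first.
    split=> [j|].
      rewrite !ffunE; apply/(RB_rad B_gt1 B_coprime) => //.
      by exists (x j) => //; rewrite -xD ffunE.
    by under eq_bigr do rewrite ffunE; rewrite sum_div_int.
  have /fin_all_exists2[x xD xs] : forall j, exists2 x : 'I_(MN N),
      supp (bN N) x = D j & s j = x%:R / (MN N)%:R.
    by move=> j; apply/(RB_rad B_gt1 B_coprime) => //; have := sRB j; rewrite ffunE.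
  have hs : h [ffun j => x j] = s by apply/ffunP => j; rewrite !ffunE xs.
  exists [ffun j => x j] => //; apply/andP; split.
    rewrite -(sum_div_int R B_gt1).
    rewrite (_ : \sum_(j < k) _ = \sum_(j < k) s j) //.
    by apply: eq_bigr => j _; rewrite !ffunE xs.
  by apply/eqP/ffunP => j; rewrite !ffunE xD.
rewrite fsbig_image; last by move=> x y _ _; apply: h_inj.
rewrite (fsbig_fwiden (enum P)); first last.
- by move=> x [/= + nP]; rewrite mem_enum.
- exact: enum_uniq.
- by move=> x /= Px; rewrite mem_enum.
rewrite big_enum /= mulr_sumr; apply: eq_bigr => x /andP[_ /eqP xD].
rewrite rmorph_prod -big_split /=; apply: eq_bigr => j _; rewrite !ffunE.
have sj : supp (bN N) (x j) = D j by rewrite -xD ffunE.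
rewrite /wN sj ifF //; apply/negbTE.
by rewrite -supp_eq0 ?sj //; apply: tb_coprime.
Qed.

Lemma sum_by_supps (V : zmodType) N k (G : {ffun 'I_k -> 'I_(MN N)} -> V) :
  \sum_(D | nonempties D) \sum_(x | zerosum x && (supps x == D)) G x =
  \sum_(x | zerosum x && nonempties (supps x)) G x.
Proof.
rewrite (partition_big (@supps _ _ _) (@nonempties N k)) /=; last by move=> x /andP[].
apply: eq_bigr => D D0; apply: eq_bigl => x.
by case: eqVneq => [->|]; rewrite ?D0 ?andbT ?andbF.
Qed.

Lemma sum_index N k : \sum_(r <- index_seq N k) Ck_term B phi H r = mom (@wN N) k.
Proof.
rewrite big_map big_enum /=; under eq_bigr => D D0 do rewrite Ck_term_rad //.
rewrite sum_by_supps /mom [RHS](bigID (fun x => nonempties (supps x))) /=.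
rewrite [X in _ = _ + X]big1 ?addr0 // => x /andP[_]; rewrite negb_forall => /existsP[j].
rewrite negbK ffunE supp_eq0; last exact: tb_coprime.
by move=> xj; rewrite (bigD1 j) //= /wN xj mul0r.
Qed.

Lemma sum_index_norm N k (Kw : R) : 0 <= Kw -> 1 <= H ->
    (forall x, `|@wN N x| <= (Kw * wt (bN N) H x)%:C%C) ->
  \sum_(r <- index_seq N k) `|Ck_term B phi H r| <=
    (Kw ^+ k * mom (fun v : 'I_(MN N) => wt (bN N) H v) k)%:C%C.
Proof.
move=> Kw0 H1 wle; rewrite big_map big_enum /=.
apply: (@le_trans _ _ (\sum_(D | nonempties D)
   \sum_(x : {ffun 'I_k -> 'I_(MN N)} | zerosum x && (supps x == D))
      (Kw ^+ k * \prod_j wt (bN N) H (x j))%:C%C)).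
  apply: ler_sum => D D0; rewrite Ck_term_rad //.
  apply: (le_trans (ler_norm_sum _ _ _)); apply: ler_sum => x _.
  rewrite normr_prod -[k in Kw ^+ k]card_ord -prodr_const -big_split rmorph_prod /=.
  by apply: ler_prod => j _; rewrite normr_ge0 wle.
rewrite sum_by_supps -rmorph_sum lecR -mulr_sumr ler_wpM2l ?exprn_ge0 // /mom.
rewrite [leRHS](bigID (fun x => nonempties (supps x))) /= lerDl sumr_ge0 // => x _.
by apply: prodr_ge0 => j _; apply: wt_ge0 => //; apply: tb_gt1.
Qed.

Lemma wN_conj N (x : 'I_(MN N)) : (forall t, Phi phi H (1 - t) = (Phi phi H t)^*%C) ->
  wN (negM (@tb_gt1 B B_gt1 N) x) = (wN x)^*%C.
Proof.
move=> Pc; rewrite /wN /=; have [->|x0] := eqVneq (x : nat) 0%N.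
  by rewrite subn0 modnn eqxx conjc0.
have xM := ltn_ord x; have x0' : (0 < x)%N by rewrite lt0n.
rewrite modn_small; last by rewrite -subn_gt0 subKn // ltnW.
rewrite gtn_eqF ?subn_gt0 // conjcM conjc_real -Pc.
have M0 : (MN N)%:R != 0 :> R by rewrite gt_eqF // modulusR_gt0.
congr (_ * _).
  congr ((gB R B (rad _ _))%:C)%C; apply/setP => i; rewrite !inE; congr (~~ _).
  have bM : (bN N i %| MN N)%N by rewrite /modulus (bigD1 i) //= dvdn_mulr.
  exact: (dvdn_subr (ltnW xM) bM).
by congr (Phi _ _ _); rewrite natrB ?(ltnW xM) // mulrBl divff.
Qed.

(** The lists [index_seq N k] exhaust the indices of nonzero terms, the uniform bound on the moments
    of [wt] gives absolute convergence, and conjugation symmetry makes the partial sums real. *)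
Theorem Ck_limit k (Kw C : R) : 0 <= Kw -> 1 <= H ->
    (forall t, Phi phi H (1 - t) = (Phi phi H t)^*%C) ->
    (forall N x, `|@wN N x| <= (Kw * wt (bN N) H x)%:C%C) ->
    (forall N, mom (fun v : 'I_(MN N) => wt (bN N) H v) k <= C) ->
  exists2 L : R, Ck B phi H k = L%:C%C &
    (complex.Re (mom (@wN N) k) @[N --> \oo] --> L)%classic.
Proof.
move=> Kw0 H1 Pc wle S_le.
have [|||||L hL cL] := @sum_seqs R _ (@Ck_term R B phi H k) (fun N => index_seq N k) (Kw ^+ k * C).
- by move=> N; apply: index_uniq.
- move=> N N' NN r /mem_index h; apply/mem_index => j; have [r1 rB cN] := h j.
  by split=> // c Bc cr; apply: leq_trans NN; apply: cN.
- move=> r; rewrite /Ck_term; case: asboolP => [h _|]; last by rewrite eqxx.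
  exists (\sum_j r j).+1; apply/mem_index => j; have [r1 rB] := h j; split=> // c Bc cr.
  rewrite ltnS (bigD1 j) //=; apply: leq_trans (leq_addr _ _); apply: dvdn_leq => //.
  exact: ltnW.
- move=> N; apply: (le_trans (sum_index_norm _ Kw0 H1 (wle N))).
  by rewrite lecR ler_wpM2l ?exprn_ge0.
- by move=> N; rewrite sum_index; apply: (@mom_conj R _ _ (@tb_gt1 B B_gt1 N)) => x; apply: wN_conj.
exists L => //; apply: cvg_trans cL; apply: near_eq_cvg.
by near=> N; rewrite sum_index.
Unshelve. all: by end_near.
Qed.

End Bridge.

(** * The kernel Phi *)

Section Exponential.
Variable R : realType.
Implicit Types t u v : R.

Lemma eD u v : e_ (u + v) = e_ u * e_ v.
Proof.
apply/eqP; rewrite eq_complex /= mulrDr cosD sinD.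
by apply/andP; split; apply/eqP; ring.
Qed.

Lemma e0 : e_ (0 : R) = 1.
Proof. by rewrite /e_ mulr0 cos0 sin0. Qed.

Lemma e1 : e_ (1 : R) = 1.
Proof.
by rewrite /e_ mulr1 mulr_natl mulr2n cosDpi sinDpi cospi sinpi opprK oppr0.
Qed.

Lemma eN t : e_ (- t) = (e_ t)^*%C.
Proof. by rewrite /e_ mulrN cosN sinN. Qed.

Lemma norm_e t : `|e_ t| = 1.
Proof. by rewrite normc_def /= cos2Dsin2 sqrtr1. Qed.

Lemma eX n t : e_ (n%:R * t) = e_ t ^+ n.
Proof.
by elim: n => [|n IH]; rewrite ?mul0r ?e0 // -addn1 natrD mulrDl mul1r eD IH addn1 exprSr.
Qed.

Lemma e_nat n : e_ (n%:R : R) = 1.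
Proof. by rewrite -[n%:R]mulr1 eX e1 expr1n. Qed.

Lemma normc_sq (z : R[i]) : `|z| ^+ 2 = z * z^*%C.
Proof.
rewrite normc_def -rmorphXn /= sqr_sqrtr ?addr_ge0 ?sqr_ge0 //.
by case: z => a b; apply/eqP; rewrite eq_complex /=; apply/andP; split; apply/eqP; ring.
Qed.

Lemma one_sub_expr (z : R[i]) n : `|z| = 1 -> `|1 - z ^+ n| <= n%:R * `|1 - z|.
Proof.
move=> z1; elim: n => [|n IH]; first by rewrite expr0 subrr normr0 mul0r.
have -> : 1 - z ^+ n.+1 = (1 - z) + z * (1 - z ^+ n) by rewrite exprS; ring.
apply: (le_trans (ler_normD _ _)); rewrite normrM z1 mul1r.
by rewrite -natr1 mulrDl mul1r addrC lerD2r.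
Qed.

Lemma one_sub_e_ge1 t : 4^-1 <= t <= 2^-1 -> 1 <= `|1 - e_ t|.
Proof.
move=> /andP[t1 t2]; apply: le_trans (normc_ge_Re _); rewrite /= -(rmorph1 (@real_complex R)) lecR.
apply: le_trans (ler_norm _); rewrite lerDl oppr_ge0.
have -> : 2 * trigo.pi * t = (2 * trigo.pi * t - trigo.pi) + trigo.pi by rewrite subrK.
rewrite cosDpi oppr_le0; apply: cos_ge0_pihalf.
by have := pi_gt0 R; nra.
Qed.

(** Some multiple [n t] lies in [[1/4, 1/2]], where [|1 - e(n t)| >= 1]. As
    [|1 - e(n t)| <= n |1 - e(t)|], it follows that [|1 - e(t)| >= 1 / n >= t]. *)
Lemma one_sub_e_half t : 0 <= t <= 2^-1 -> t%:C%C <= `|1 - e_ t|.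
Proof.
move=> /andP[t0 t2]; move: t0; rewrite le_eqVlt => /orP[/eqP <-|t0].
  by rewrite e0 subrr normr0.
have [n [nt n0]] : exists n, 4^-1 <= n%:R * t <= 2^-1 /\ (0 < n)%N.
  have [t4|t4] := leP t 4^-1; last by exists 1%N; rewrite mul1r ltW.
  exists (Num.truncn (4 * t)^-1).+1; split=> //.
  have /truncn_itv : 0 <= (4 * t)^-1 by rewrite invr_ge0 mulr_ge0 // ltW.
  set q := Num.truncn _; rewrite -[q.+1%:R]natr1 => /andP[q1 q2].
  have t40 : 0 < 4 * t by rewrite mulr_gt0.
  move: q1 q2; rewrite -[X in _ <= X]mul1r ler_pdivlMr // -[X in X < _]mul1r ltr_pdivrMr //.
  by move=> q1 q2; apply/andP; split; nra.
have h := one_sub_e_ge1 nt; rewrite eX in h.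
have {h}h := le_trans h (one_sub_expr n (norm_e t)).
have nR : 0 < n%:R :> R[i] by rewrite ltr0n.
rewrite -(ler_pM2l nR); apply: le_trans h.
rewrite -(rmorph_nat (@real_complex R)) -rmorphM -(rmorph1 (@real_complex R)) lecR.
by case/andP: nt => _ /le_trans; apply; lra.
Qed.

Lemma one_sub_e_conj t : `|1 - e_ (1 - t)| = `|1 - e_ t|.
Proof.
rewrite eD e1 mul1r eN.
have -> : 1 - (e_ t)^*%C = (1 - e_ t)^*%C by apply/eqP; rewrite eq_complex /=; apply/andP; split; apply/eqP; ring.
by rewrite !normc_def /= sqrrN.
Qed.

Lemma one_sub_e t : 0 <= t <= 1 -> (Num.min t (1 - t))%:C%C <= `|1 - e_ t|.
Proof.
move=> /andP[t0 t1]; have [t2|t2] := leP t 2^-1.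
  apply: le_trans (one_sub_e_half _); last by rewrite t0.
  by rewrite lecR ge_min lexx.
rewrite -one_sub_e_conj; apply: le_trans (one_sub_e_half _); last by apply/andP; split; lra.
by rewrite lecR ge_min lexx orbT.
Qed.

Lemma e_neq1 t : 0 < t < 1 -> e_ t != 1.
Proof.
move=> /andP[t0 t1]; apply/eqP => E.
have /one_sub_e : 0 <= t <= 1 by rewrite !ltW.
rewrite E subrr normr0 -(rmorph0 (@real_complex R)) lecR ge_min; apply/negP.
by rewrite negb_or -!ltNge t0 subr_gt0.
Qed.

Lemma sum_expr_unity (w : R[i]) r : w ^+ r = 1 -> w != 1 -> \sum_(a < r) w ^+ a = 0.
Proof.
move=> wr w1; have := subrX1 w r; rewrite wr subrr => /esym/eqP.
by rewrite mulf_eq0 subr_eq0 (negbTE w1) => /eqP.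
Qed.

(** The condition [m0 <= r] keeps the frequencies distinct modulo [r], so the characters are
    orthogonal on the [r]-th roots of unity. *)
Lemma parseval (r m0 : nat) (c : nat -> R) : (m0 <= r)%N -> (0 < r)%N ->
  \sum_(a < r) `|\sum_(m < m0) (c m)%:C%C * e_ (a%:R / r%:R) ^+ m| ^+ 2 =
  (r%:R * \sum_(m < m0) c m ^+ 2)%:C%C.
Proof.
move=> mr r0; have rR : (r%:R : R) != 0 by rewrite pnatr_eq0 -lt0n.
pose w (m p : nat) : R[i] := e_ ((m%:R - p%:R) / r%:R).
have wE m p a : e_ (a%:R / r%:R) ^+ m * ((e_ (a%:R / r%:R)) ^+ p)^*%C = w m p ^+ a.
  by rewrite -!eX -eN -eD /w; congr e_; field.
have -> : \sum_(a < r) `|\sum_(m < m0) (c m)%:C%C * e_ (a%:R / r%:R) ^+ m| ^+ 2 =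
    \sum_(m < m0) \sum_(p < m0) (c m * c p)%:C%C * \sum_(a < r) w m p ^+ a.
  under eq_bigr => a _.
    rewrite normc_sq conjc_sum mulr_suml.
    under eq_bigr => m _ do rewrite mulr_sumr.
    over.
  rewrite exchange_big; apply: eq_bigr => m _; rewrite exchange_big; apply: eq_bigr => p _.
  rewrite mulr_sumr; apply: eq_bigr => a _.
  by rewrite conjcM conjc_real mulrACA wE rmorphM.
rewrite rmorphM rmorph_sum mulr_sumr; apply: eq_bigr => m _.
rewrite (bigD1 m) //= [X in _ + X]big1 ?addr0.
  rewrite /w subrr mul0r e0; under eq_bigr do rewrite expr1n.
  by rewrite sumr_const card_ord -expr2 mulrC rmorph_nat.
move=> p pm; rewrite sum_expr_unity ?mulr0 //.
  by rewrite /w -eX mulrCA divff // mulr1 eD eN !e_nat conjc1 mulr1.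
have rP : 0 < r%:R :> R by rewrite ltr0n.
have lt1 (x y : nat) : (x < y)%N -> (y < m0)%N -> 0 < ((y%:R - x%:R) / r%:R : R) < 1.
  move=> xy ym; rewrite divr_gt0 ?subr_gt0 ?ltr_nat // ltr_pdivrMr // mul1r.
  apply: (@le_lt_trans _ _ y%:R); first by rewrite gerBl.
  by rewrite ltr_nat (leq_trans ym).
case: (ltngtP p m) => pm'; last by move/eqP: pm; case; apply: val_inj.
  by apply: e_neq1; apply: lt1.
rewrite /w -opprB mulNr eN; apply/eqP => /(congr1 (@conjc R)); rewrite conjcK conjc1.
by apply/eqP/e_neq1/lt1.
Qed.

(** Summation by parts, which trades cancellation in the exponential sum for the variation of the
    coefficients. *)
Lemma abel_sum (z : R[i]) (c : nat -> R) n :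
  (1 - z) * \sum_(m < n) (c m)%:C%C * z ^+ m =
  (c 0%N)%:C%C + \sum_(m < n) (c m.+1 - c m)%:C%C * z ^+ m.+1 - (c n)%:C%C * z ^+ n.
Proof.
elim: n => [|n IH]; first by rewrite !big_ord0 mulr0 addr0 expr0 mulr1 subrr.
by rewrite !big_ord_recr /= mulrDr IH exprS rmorphB /=; ring.
Qed.

Lemma norm_real_complex (x : R) : `|x%:C%C| = `|x|%:C%C :> R[i].
Proof. by rewrite normc_def /= expr0n addr0 sqrtr_sqr. Qed.

Lemma abel_bound (z : R[i]) (c : nat -> R) n : `|z| = 1 ->
  `|1 - z| * `|\sum_(m < n) (c m)%:C%C * z ^+ m| <=
  (`|c 0%N| + \sum_(m < n) `|c m.+1 - c m| + `|c n|)%:C%C.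
Proof.
move=> z1; have zX m : `|z ^+ m| = 1 by rewrite normrX z1 expr1n.
rewrite -normrM abel_sum; apply: (le_trans (ler_normB _ _)).
rewrite !rmorphD /= normrM zX mulr1 norm_real_complex lerD2r.
apply: (le_trans (ler_normD _ _)); rewrite norm_real_complex lerD2l.
apply: (le_trans (ler_norm_sum _ _ _)); rewrite rmorph_sum; apply: ler_sum => m _.
by rewrite normrM zX mulr1 norm_real_complex.
Qed.

Lemma sqr_sum_le (c : nat -> R) n :
  (\sum_(m < n) c m) ^+ 2 <= n%:R * \sum_(m < n) c m ^+ 2.
Proof.
elim: n => [|n IH]; first by rewrite !big_ord0 expr0n mul0r.
rewrite !big_ord_recr /=; set S := \sum_(m < n) c m; set Q := \sum_(m < n) c m ^+ 2.
have Q0 : 0 <= Q by apply: sumr_ge0 => i _; apply: sqr_ge0.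
have [n00|n0] := posnP n.
  by rewrite /S /Q n00 !big_ord0; nra.
have nR : 0 < n%:R :> R by rewrite ltr0n.
have key : 2 * S * c n <= Q + n%:R * c n ^+ 2.
  rewrite -(ler_pM2l nR); have := sqr_ge0 (S - n%:R * c n).
  by rewrite -/S -/Q in IH; nra.
by rewrite -natr1; rewrite -/S -/Q in IH; nra.
Qed.

Lemma norm_sum_sq_le (z : R[i]) (c : nat -> R) n : `|z| = 1 ->
  `|\sum_(m < n) (c m)%:C%C * z ^+ m| ^+ 2 <= (n%:R * \sum_(m < n) c m ^+ 2)%:C%C.
Proof.
move=> z1; apply: (@le_trans _ _ ((\sum_(m < n) `|c m|)%:C%C ^+ 2)).
  apply: lerXn2r; first by rewrite nnegrE normr_ge0.
    by rewrite nnegrE ler0c sumr_ge0.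
  apply: (le_trans (ler_norm_sum _ _ _)); rewrite rmorph_sum; apply: ler_sum => m _.
  by rewrite normrM normrX z1 expr1n mulr1 norm_real_complex.
rewrite -rmorphXn lecR; apply: (le_trans (sqr_sum_le (fun m => `|c m|) n)).
by under eq_bigr do rewrite real_normK ?num_real //.
Qed.

End Exponential.

Section Kernel.
Variables (R : realType) (phi : R -> R) (L Mv H : R) (m0 : nat).
Hypothesis phi_supp : forall x, phi x != 0 -> 0 <= x <= L.
Hypothesis phi_var : forall a b : R, a <= b -> (total_variation a b phi <= Mv%:E)%E.
Hypothesis H1 : 1 <= H.
Hypothesis m0_gt : L * H < m0%:R.

Let H0 : 0 < H. Proof. exact: lt_le_trans H1. Qed.

Definition coef (m : nat) : R := phi (m%:R / H).

Lemma Phi_sum t : Phi phi H t = \sum_(m < m0) (coef m)%:C%C * e_ t ^+ m.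
Proof.
rewrite /Phi (fsbigE [seq Posz i | i <- iota 0 m0]) /=.
- rewrite big_map /= -[m0 in iota 0 m0]subn0 -/(index_iota 0 m0) big_mkord; apply: eq_big => [i|i _].
    exact: mem_set.
  by rewrite -pmulrn eX mulrC.
- by rewrite map_inj_uniq ?iota_uniq // => i j [].
- by [].
- move=> z _ zn; case: (eqVneq (phi (z%:~R / H)) 0) => [->|/phi_supp/andP[z0 zL]].
    by rewrite mulr0.
  case/negP: zn; rewrite pmulr_lge0 ?invr_gt0 // ler0z in z0.
  case: z z0 zL => // z _; rewrite -pmulrn ler_pdivrMr // => zL.
  rewrite mem_map; last by move=> ? ? [].
  by rewrite mem_iota add0n /= -(ltr_nat R) (le_lt_trans zL).
Qed.

Lemma Phi_conj t : Phi phi H (1 - t) = (Phi phi H t)^*%C.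
Proof.
rewrite !Phi_sum conjc_sum; apply: eq_bigr => m _.
rewrite conjcM conjc_real; congr (_ * _).
by rewrite -!eX mulrBr mulr1 eD e_nat mul1r eN.
Qed.

Lemma variation_sum (u : nat -> R) n : (forall i, u i <= u i.+1) ->
  \sum_(i < n) `|phi (u i.+1) - phi (u i)| <= Mv.
Proof.
move=> um; have um0 i : u 0%N <= u i by elim: i => // i /le_trans; apply.
suff h : ((\sum_(i < n) `|phi (u i.+1) - phi (u i)|)%:E <= total_variation (u 0%N) (u n) phi)%E.
  by rewrite -lee_fin; apply: le_trans h (phi_var _).
elim: n => [|n IH]; first by rewrite big_ord0 total_variation_ge0.
rewrite big_ord_recr /= (@total_variationD _ _ _ (u n)) // EFinD leeD //.
exact: total_variation_ge.
Qed.

Lemma Mv_ge0 : 0 <= Mv.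
Proof. by have := @variation_sum (fun=> 0) 0%N (fun i => lexx (0 : R)); rewrite big_ord0. Qed.

(** The point [-1] lies outside the support, so the variation between [-1] and [x] controls the
    value at [x]. *)
Lemma phi_bound x : `|phi x| <= Mv.
Proof.
have [->|px] := eqVneq (phi x) 0; first by rewrite normr0 Mv_ge0.
have /andP[x0 _] := phi_supp px.
have p1 : phi (-1) = 0.
  by apply/eqP/negPn/negP => /phi_supp/andP[]; rewrite leNgt ltrN10.
have xm : -1 <= x by apply: le_trans x0; rewrite lerN10.
have := le_trans (total_variation_ge phi xm) (phi_var xm).
by rewrite lee_fin p1 subr0.
Qed.

Lemma Phi_norm_le t : `|Phi phi H t| <= (m0%:R * Mv)%:C%C.
Proof.
rewrite Phi_sum; apply: (le_trans (ler_norm_sum _ _ _)).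
rewrite -[m0 in leRHS]card_ord mulr_natl -sumr_const rmorph_sum; apply: ler_sum => m _.
by rewrite normrM normrX norm_e expr1n mulr1 norm_real_complex lecR phi_bound.
Qed.

(** The constant 3 collects the two boundary terms and the total variation of the sampled values. *)
Lemma Phi_abel t : `|1 - e_ t| * `|Phi phi H t| <= (3 * Mv)%:C%C.
Proof.
rewrite Phi_sum; apply: (le_trans (abel_bound _ _ (norm_e t))); rewrite lecR.
have h1 := phi_bound (0%N%:R / H); have h2 := phi_bound (m0%:R / H).
have h3 : \sum_(m < m0) `|coef m.+1 - coef m| <= Mv.
  apply: (variation_sum (u := fun m => m%:R / H)) => i.
  by rewrite ler_pM2r ?invr_gt0 // ler_nat.
rewrite /coef in h3 *; rewrite -/(coef _) in h3; lra.
Qed.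

Lemma Phi_sq_le t : `|Phi phi H t| ^+ 2 <= (m0%:R * \sum_(m < m0) coef m ^+ 2)%:C%C.
Proof. by rewrite Phi_sum; apply: norm_sum_sq_le; apply: norm_e. Qed.

Lemma Phi_kernel_le (x M : nat) : (0 < x < M)%N ->
  `|Phi phi H (x%:R / M%:R)| <=
    ((m0%:R / H + 3) * Mv * Num.min H (M%:R / (minn x (M - x))%:R))%:C%C.
Proof.
move=> /andP[x0 xM]; have M0 : 0 < M%:R :> R by rewrite ltr0n (leq_trans _ xM).
have Mv0 := Mv_ge0; set K := (m0%:R / H + 3) * Mv.
set d := minn x (M - x).
have d0 : 0 < d%:R :> R by rewrite ltr0n leq_min x0 subn_gt0.
have mH : 0 <= m0%:R / H by rewrite divr_ge0 // ltW.
rewrite minr_pMr ?mulr_ge0 ?addr_ge0 // /Num.min; case: ifP => _.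
  apply: (le_trans (Phi_norm_le _)); rewrite lecR /K.
  have -> : (m0%:R / H + 3) * Mv * H = m0%:R * Mv + 3 * Mv * H.
    by field; rewrite gt_eqF.
  by rewrite lerDl !mulr_ge0 // ltW.
set t := x%:R / M%:R.
have dt : d%:R / M%:R = Num.min t (1 - t).
  have -> : 1 - t = (M - x)%:R / M%:R.
    by rewrite natrB ?(ltnW xM) // mulrBl divff ?gt_eqF.
  rewrite /d /t; case: (leqP x (M - x)) => h; [rewrite min_l|rewrite min_r] => //.
    by rewrite ler_pM2r ?invr_gt0 // ler_nat.
  by rewrite ler_pM2r ?invr_gt0 // ler_nat ltnW.
have tb : 0 <= t <= 1.
  by rewrite divr_ge0 ?(ltW M0) //= ler_pdivrMr // mul1r ler_nat ltnW.
have dM : 0 < d%:R / M%:R :> R by rewrite divr_gt0.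
have := one_sub_e tb; rewrite -dt => h.
have dC : 0 < (d%:R / M%:R)%:C%C :> R[i] by rewrite ltcR.
rewrite -(ler_pM2l dC).
apply: (@le_trans _ _ (3 * Mv)%:C%C).
  by apply: le_trans (Phi_abel t); rewrite ler_wpM2r.
rewrite -rmorphM lecR /K.
have -> : d%:R / M%:R * ((m0%:R / H + 3) * Mv * (M%:R / d%:R)) = (m0%:R / H + 3) * Mv.
  by field; rewrite !gt_eqF.
by rewrite ler_wpM2r // lerDr.
Qed.

End Kernel.

(** * Lower bound for the energy of [phi] *)

Section NonVanishing.
Variables (R : realType) (phi : R -> R) (Mv : R).
Hypothesis phi_var : forall a b : R, a <= b -> (total_variation a b phi <= Mv%:E)%E.

(* Otherwise bisecting n times shows that the variation is at least n * e. *)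
Lemma variation_oscillation (e u v : R) : 0 < e -> u < v ->
  exists x y, [/\ u <= x, x < y, y <= v & forall s t, x <= s <= y -> x <= t <= y ->
    `|phi s - phi t| < e].
Proof.
move=> e0 uv; apply: contrapT => no.
have osc x y : u <= x -> x < y -> y <= v ->
    exists s t, [/\ x <= s, s <= t, t <= y & e <= `|phi t - phi s|].
  move=> ux xy yv; apply: contrapT => nst; apply: no; exists x, y; split=> // s t.
  move=> /andP[xs sy] /andP[xt ty]; rewrite ltNge; apply/negP => le.
  apply: nst; case: (leP s t) => st; first by exists s, t; rewrite distrC.
  by exists t, s; split=> //; apply: ltW.
have [n nM] : exists n : nat, Mv < n%:R * e.
  exists (Num.truncn (Mv / e)).+1; rewrite -ltr_pdivrMr //; exact: truncnS_gt.
suff h x : u <= x -> x < v -> ((n%:R * e)%:E <= total_variation x v phi)%E.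
  have := le_trans (h u (lexx u) uv) (phi_var (ltW uv)).
  by rewrite lee_fin leNgt nM.
elim: n {nM} x => [|n IH] x ux xv; first by rewrite mul0r total_variation_ge0 // ltW.
pose m := (x + v) / 2.
have xm : x < m by rewrite /m; lra.
have mv : m < v by rewrite /m; lra.
have [s [t [xs st tm le]]] := osc x m ux xm (ltW mv).
rewrite (@total_variationD _ _ _ m) ?(ltW xm) ?(ltW mv) // -natr1 mulrDl mul1r addrC EFinD.
apply: leeD; last by apply: IH => //; apply: le_trans ux (ltW xm).
rewrite (@total_variationD _ _ _ s) //; last exact: le_trans tm.
rewrite (@total_variationD _ s m t) //.
apply: (@le_trans _ _ (total_variation s t phi)).
  by apply: le_trans (total_variation_ge phi st); rewrite lee_fin.
have h1 : (0 <= total_variation x s phi)%E by apply: total_variation_ge0.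
have h2 : (0 <= total_variation t m phi)%E by apply: total_variation_ge0.
by apply: le_trans (leeDr _ h1); apply: leeDl.
Qed.

(** Otherwise [|phi|] takes arbitrarily small values on every subinterval, and small oscillation
    spreads each of them over a smaller interval. This builds nested intervals on which
    [|phi| < 1 / (n + 1)]; their common point is a zero of [phi] strictly between [a] and [b]. *)
Lemma nonvanishing_subinterval (a b : R) : a < b ->
    (forall x, a < x < b -> phi x != 0) ->
  exists u v c, [/\ a < u, u < v, v < b, 0 < c & forall x, u <= x <= v -> c <= `|phi x|].
Proof.
move=> ab nz; apply: contrapT => no.
have dip u v c : a < u -> u < v -> v < b -> 0 < c -> exists2 x, u <= x <= v & `|phi x| < c.
  move=> au uv vb c0; apply: contrapT => nd; apply: no; exists u, v, c; split=> // x xuv.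
  by rewrite leNgt; apply/negP => lt; apply: nd; exists x.
have step (n : nat) (p : R * R) : exists q : R * R, (a < p.1) && (p.1 < p.2) && (p.2 < b) ->
    [/\ (a < q.1) && (q.1 < q.2) && (q.2 < b), p.1 <= q.1, q.2 <= p.2 &
        forall s, q.1 <= s <= q.2 -> `|phi s| < n.+1%:R^-1].
  case: (boolP ((a < p.1) && (p.1 < p.2) && (p.2 < b))) => [/andP[/andP[ap pp] pb]|_];
    last by exists p.
  have e0 : 0 < (n.+1%:R^-1 : R) / 2 by rewrite divr_gt0 // invr_gt0.
  have [x [y [px xy yp osc]]] := variation_oscillation e0 pp.
  have ax : a < x by apply: lt_le_trans px.
  have yb : y < b by apply: le_lt_trans pb.
  exists (x, y) => _; split=> //=; first by rewrite ax xy.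
  have [t txy pt] := dip x y _ ax xy yb e0.
  move=> s sxy; have := osc s t sxy txy => h.
  apply: (@le_lt_trans _ _ (`|phi s - phi t| + `|phi t|)).
    by rewrite -{1}[phi s](subrK (phi t)) ler_normD.
  by rewrite [ltRHS]splitr; apply: ltrD.
(* The middle third, so that both ends stay strictly inside. *)
pose p0 : R * R := ((2 * a + b) / 3, (a + 2 * b) / 3).
have p0P : (a < p0.1) && (p0.1 < p0.2) && (p0.2 < b) by rewrite /p0 /=; apply/andP; split; [apply/andP; split|]; lra.
pose next n p := projT1 (cid (step n p)).
pose seq_ := fix F n := if n is m.+1 then next m (F m) else p0.
have sP n : (a < (seq_ n).1) && ((seq_ n).1 < (seq_ n).2) && ((seq_ n).2 < b).
  elim: n => [|n IH] //=; rewrite /next.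
  by case: cid => q /= /(_ IH)[].
have sS n : [/\ (seq_ n).1 <= (seq_ n.+1).1, (seq_ n.+1).2 <= (seq_ n).2 &
    forall s, (seq_ n.+1).1 <= s <= (seq_ n.+1).2 -> `|phi s| < n.+1%:R^-1].
  by rewrite /= /next; case: cid => q /= /(_ (sP n))[].
have mono1 n m : (n <= m)%N -> (seq_ n).1 <= (seq_ m).1.
  by move=> /subnK <-; elim: (m - n)%N => // d /le_trans; apply; have [] := sS (d + n)%N.
have mono2 n m : (n <= m)%N -> (seq_ m).2 <= (seq_ n).2.
  move=> /subnK <-; elim: (m - n)%N => // d IH.
  by have [_ h _] := sS (d + n)%N; apply: le_trans IH.
have cross n m : (seq_ n).1 <= (seq_ m).2.
  have lt k : (seq_ k).1 <= (seq_ k).2 by have /andP[/andP[_ /ltW]] := sP k.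
  case: (leqP n m) => nm; first by apply: le_trans (mono1 _ _ nm) (lt m).
  by apply: le_trans (lt n) (mono2 _ _ (ltnW nm)).
pose E : set R := range (fun n => (seq_ n).1).
have Esup : has_sup E.
  by split; [exists (seq_ 0).1; exists 0%N|exists (seq_ 0).2 => _ [n _ <-]; apply: cross].
pose x := sup E.
have x1 n : (seq_ n).1 <= x by apply: ub_le_sup => //; [case: Esup|exists n].
have x2 n : x <= (seq_ n).2.
  by apply: ge_sup; [case: Esup|move=> _ [m _ <-]; apply: cross].
have xab : a < x < b.
  have /andP[/andP[h1 _] h2] := sP 0%N.
  by rewrite (lt_le_trans h1 (x1 0%N)) (le_lt_trans (x2 0%N) h2).
have px : 0 < `|phi x| by rewrite normr_gt0 nz.
pose n := Num.truncn (`|phi x|)^-1.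
have [_ _ /(_ x)] := sS n; rewrite x1 x2 => /(_ isT).
apply/negP; rewrite -leNgt -[leRHS]invrK lef_pV2 ?posrE ?invr_gt0 // ltW //; exact: truncnS_gt.
Qed.

(** At least [(v - u) H - 1] grid points [m / H] fall into [[u, v]], and this is at least half of
    [(v - u) H] once [H >= 2 / (v - u)]. *)
Lemma sum_sq_lower (a b L : R) : a < b -> (forall x, a < x < b -> phi x != 0) ->
    (forall x, phi x != 0 -> 0 <= x <= L) ->
  exists c H0, [/\ 0 < c, 1 <= H0 & forall H (m0 : nat), H0 <= H -> L * H < m0%:R ->
     c * H <= \sum_(m < m0) phi (m%:R / H) ^+ 2].
Proof.
move=> ab nz supp; have [u [v [d [au uv vb d0 dle]]]] := nonvanishing_subinterval ab nz.
have u0 : 0 <= u.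
  by have /supp/andP[] : phi u != 0 by apply: nz; rewrite au (lt_trans uv).
exists (d ^+ 2 * ((v - u) / 2)), (Num.max 1 (2 / (v - u))); split.
- by rewrite mulr_gt0 ?exprn_gt0 // divr_gt0 // subr_gt0.
- by rewrite le_max lexx.
move=> H m0; rewrite ge_max => /andP[H1 H2] Lm.
have H0 : 0 < H by apply: lt_le_trans H1.
have uvH : 2 <= (v - u) * H by rewrite mulrC -ler_pdivrMr // subr_gt0.
pose p := (Num.truncn (u * H)).+1; pose q := Num.truncn (v * H).
have /truncn_itv/andP[p1 p2] : 0 <= u * H by rewrite mulr_ge0 // ltW.
have vH0 : 0 <= v * H by rewrite mulr_ge0 ?(ltW H0) // (le_trans u0) // ltW.
have /andP[q1 q2] := truncn_itv vH0.
have inP m : (p <= m < q.+1)%N -> (m < m0)%N /\ d ^+ 2 <= phi (m%:R / H) ^+ 2.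
  move=> /andP[pm mq].
  have um : u <= m%:R / H.
    by rewrite ler_pdivlMr // (le_trans (ltW p2)) // ler_nat.
  have mv : m%:R / H <= v.
    by rewrite ler_pdivrMr // (le_trans _ q1) // ler_nat.
  have dm : d <= `|phi (m%:R / H)| by apply: dle; rewrite um.
  split; last by rewrite -(real_normK (num_real (phi _))) lerXn2r ?nnegrE ?(ltW d0).
  have /supp/andP[_] : phi (m%:R / H) != 0 by rewrite -normr_gt0 (lt_le_trans d0).
  by rewrite ler_pdivrMr // => mL; rewrite -(ltr_nat R) (le_lt_trans mL).
apply: (@le_trans _ _ (\sum_(p <= m < q.+1) d ^+ 2)).
  rewrite sumr_const_nat -[leRHS]mulr_natr -mulrA ler_wpM2l ?sqr_ge0 //.
  have pq : (p <= q.+1)%N.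
    by rewrite /p ltnS; apply: le_truncn; rewrite ler_pM2r // ltW.
  have pE : p%:R = (Num.truncn (u * H))%:R + 1 :> R by rewrite natr1.
  rewrite natrB // pE; move: p1 q2 uvH; rewrite -/q.
  by move: (Num.truncn (u * H))%:R (q.+1)%:R => x y; clear; nra.
rewrite -(big_mkord xpredT (fun m => phi (m%:R / H) ^+ 2)).
have sq0 (x y : nat) : 0 <= \sum_(x <= m < y) phi (m%:R / H) ^+ 2.
  by apply: sumr_ge0 => m _; apply: sqr_ge0.
case: (leqP p q) => pq; last by rewrite [leLHS]big_geq.
have [qm _] := inP q ltac:(by rewrite pq /=).
rewrite [leRHS](big_cat_nat (n := p)) //=; last by rewrite (leq_trans pq) // ltnW.
rewrite ler_wpDl // [leRHS](big_cat_nat (n := q.+1)) //=; last exact: leqW.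
rewrite ler_wpDr // big_nat [leRHS]big_nat; apply: ler_sum => m /inP[] //.
Qed.

End NonVanishing.

Definition cnt (J : set nat) (m : nat) : nat :=
  (\sum_(1 <= n < m.+1 | `[< J n >]) 1)%N.

(** * Counting the semigroup and its squarefree elements *)

Section IndexBounds.
Variables (R : realType) (J : set nat) (alpha : R).
Hypothesis alpha01 : 0 < alpha < 1.
Hypothesis J1 : J 1%N.
Hypothesis J_index : has_index J alpha.

Lemma cnt_le m : (cnt J m <= m)%N.
Proof.
rewrite /cnt sum1_count; apply: leq_trans (count_size _ _) _.
by rewrite size_iota subSS subn0.
Qed.

Lemma cnt_ge1 m : (0 < m)%N -> (0 < cnt J m)%N.
Proof.
by case: m => // m _; rewrite /cnt big_ltn_cond // asboolT.
Qed.

(** Past a threshold [x0] the exponent is within [e] of [alpha]; below it [1 <= cnt J m <= m <= x0],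
    so the constant [max(x0, 1)] covers every [m]. *)
Lemma cnt_bounds (e : R) : 0 < e -> exists2 C : R, 1 <= C & forall m, (0 < m)%N ->
  (cnt J m)%:R <= C * m%:R `^ (alpha + e) /\ m%:R `^ (alpha - e) <= C * (cnt J m)%:R.
Proof.
move=> e0; have [a0 a1] := andP alpha01; have [delta [dl hx]] := J_index.
have hd : \forall t \near +oo, `|0 - delta t| <= e by move/cvgrPdist_le : dl; apply.
have [x0 [_ hx0]] := filterI hx hd.
exists (Num.max x0 1) => [|m m0]; first by rewrite le_max lexx orbT.
have C1 : 1 <= Num.max x0 1 by rewrite le_max lexx orbT.
have C0 := le_trans ler01 C1.
have m1 : 1 <= m%:R :> R by rewrite ler1n.
have mp : 0 < m%:R :> R by apply: lt_le_trans m1.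
have [mx|xm] := leP m%:R x0.
  have mC : m%:R <= Num.max x0 1 by rewrite le_max mx.
  split.
    apply: (@le_trans _ _ m%:R); first by rewrite ler_nat cnt_le.
    apply: (le_trans mC); rewrite ler_peMr // powR_ge1 // addr_ge0 // ltW //.
  apply: (@le_trans _ _ (Num.max x0 1)); last by rewrite ler_peMr // ler1n cnt_ge1.
  apply: le_trans mC; rewrite -[leRHS]powRr1 ?(ltW mp) //; apply: ler_powR => //; lra.
have [cE dE] := hx0 _ xm.
have {cE} : (cnt J m)%:R = m%:R `^ (alpha + delta m%:R).
  by rewrite -cE /counting_fun natrK.
move: dE; rewrite sub0r normrN ler_norml => /andP[d1 d2] ->.
split; (apply: (@le_trans _ _ (1 * _)); [rewrite mul1r|apply: ler_wpM2r => //; exact: powR_ge0]).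
  by apply: ler_powR => //; rewrite lerD2l.
by apply: ler_powR => //; rewrite lerD2l.
Qed.

End IndexBounds.

Section Zeta.
Variables (R : realType) (J : set nat).

Lemma geom_sum_le (q : R) n : 0 <= q < 1 -> \sum_(j < n) q ^+ j <= (1 - q)^-1.
Proof.
move=> /andP[q0 q1]; have q1' : 0 < 1 - q by rewrite subr_gt0.
rewrite -[leRHS]mul1r ler_pdivlMr // mulrC.
have -> : (1 - q) * (\sum_(j < n) q ^+ j) = 1 - q ^+ n.
  by rewrite -opprB mulNr -subrX1 opprB.
by rewrite gerBl exprn_ge0.
Qed.

(** The dyadic block starting at [2^K] contributes at most [C 2^be 2^(K (be - th))], the term of a
    geometric series. *)
Lemma zeta_bound (C be th : R) : 0 <= C -> 0 <= be -> be < th ->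
    (forall m, (0 < m)%N -> (cnt J m)%:R <= C * m%:R `^ be) ->
  exists2 Z : R, 0 <= Z & forall N, \sum_(1 <= n < N | `[< J n >]) n%:R `^ (- th) <= Z.
Proof.
move=> C0 b0 bth hC; pose q : R := 2 `^ (be - th).
have th0 : 0 <= th by apply: le_trans b0 (ltW bth).
have q0 : 0 <= q by exact: powR_ge0.
have q1 : q < 1.
  by rewrite -(powRr0 (2 : R)); apply: ltr_powR_gt1; rewrite ?subr_lt0 // ltr1n.
pose D : R := C * 2 `^ be.
have D0 : 0 <= D by rewrite mulr_ge0 // powR_ge0.
have dy K : \sum_(1 <= n < 2 ^ K | `[< J n >]) (n%:R : R) `^ (- th) <= D * \sum_(j < K) q ^+ j.
  elim: K => [|K IH]; first by rewrite expn0 big_geq // big_ord0 mulr0.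
  have h2 : (2 ^ K <= 2 ^ K.+1)%N by rewrite leq_exp2l.
  have h1 : (1 <= 2 ^ K)%N by rewrite expn_gt0.
  rewrite (big_cat_nat h1 h2) big_ord_recr /= mulrDr; apply: lerD => //.
  have p0 : 0 < (2 ^ K)%N%:R :> R by rewrite ltr0n.
  apply: (@le_trans _ _ ((2 ^ K)%N%:R `^ (- th) * (cnt J (2 ^ K.+1))%:R)).
    rewrite /cnt natr_sum mulr_sumr.
    rewrite (@big_cat_nat _ _ _ (2 ^ K)%N 1 (2 ^ K.+1).+1) //=; last exact: leqW.
    apply: ler_wpDl; first by apply: sumr_ge0 => i _; rewrite mulr1 powR_ge0.
    rewrite [leRHS](big_cat_nat h2 (leqnSn _)) /=; apply: ler_wpDr.
      by apply: sumr_ge0 => i _; rewrite mulr1 powR_ge0.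
    rewrite big_nat_cond [leRHS]big_nat_cond; apply: ler_sum => n /andP[/andP[nK _] _].
    by rewrite mulr1; apply: powR_le2N => //; rewrite ler_nat.
  apply: (@le_trans _ _ ((2 ^ K)%N%:R `^ (- th) * (C * (2 ^ K.+1)%N%:R `^ be))).
    by rewrite ler_wpM2l ?powR_ge0 // hC // expn_gt0.
  rewrite le_eqVlt; apply/orP; left; apply/eqP.
  have -> : (2 ^ K.+1)%N%:R `^ be = (2 `^ be) * (2 ^ K)%N%:R `^ be :> R.
    by rewrite expnS natrM powRM.
  rewrite /D.
  have -> : q ^+ K = (2 ^ K)%N%:R `^ (- th) * (2 ^ K)%N%:R `^ be.
    rewrite -powRDp // -powR_mulrn // /q -powRrM natrX -powR_mulrn // -powRrM.
    by congr powR; ring.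
  by ring.
exists (D * (1 - q)^-1) => [|N].
  by rewrite mulr_ge0 // invr_ge0 subr_ge0 ltW.
apply: (@le_trans _ _ (D * \sum_(j < N) q ^+ j)); last first.
  by rewrite ler_wpM2l // geom_sum_le // q0.
apply: le_trans (dy N).
case: (posnP N) => [->|N0]; first by rewrite big_geq // sumr_ge0 // => i _; apply: powR_ge0.
rewrite [leRHS](@big_cat_nat _ _ _ N) //=; last by rewrite ltnW // ltn_expl.
by rewrite lerDl sumr_ge0 // => i _; apply: powR_ge0.
Qed.

End Zeta.

Section Squarefree.
Variables (R : realType) (B : set nat).
Hypothesis B_gt1 : forall c, B c -> (1 < c)%N.
Hypothesis B_coprime : forall c c', B c -> B c' -> c != c' -> coprime c c'.
Local Notation J := (semigroup_gen B).

Lemma semigroup1 : J 1%N.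
Proof. by exists [::]; split=> //; rewrite big_nil. Qed.

Lemma semigroup_sub c : B c -> J c.
Proof. by move=> Bc; exists [:: c]; split=> [b|]; rewrite ?inE ?big_seq1 // => /eqP ->. Qed.

Lemma semigroupM c n : B c -> J n -> J (c * n)%N.
Proof.
move=> Bc [s [sB ->]]; exists (c :: s); split=> [b|]; last by rewrite big_cons.
by rewrite inE => /orP[/eqP -> //|/sB].
Qed.

Lemma semigroup_gt0 n : J n -> (0 < n)%N.
Proof.
move=> [s [sB ->]]; rewrite big_seq; apply: prodn_cond_gt0 => c cs.
exact/ltnW/B_gt1/sB.
Qed.

Lemma semigroup_div c n : B c -> J (c * n)%N -> J n.
Proof.
move=> Bc [s [sB E]]; have c1 := B_gt1 Bc; have c0 := ltnW c1.
have cs : c \in s.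
  apply/negPn/negP => cs; have : coprime c (\prod_(b <- s) b).
    rewrite big_seq; apply: (big_ind (fun p => coprime c p)) => [|p q cp cq|b bs].
    - exact: coprimen1.
    - by rewrite coprimeMr cp.
    - by apply: B_coprime => //; [exact: sB|apply: contraNneq cs => ->].
  rewrite -E /coprime (gcdn_idPl (dvdn_mulr _ (dvdnn c))) => /eqP c1'.
  by rewrite c1' in c1.
exists (rem c s); split=> [b /mem_rem /sB //|].
by apply/eqP; rewrite -(eqn_pmul2l c0) E (big_rem c).
Qed.

Lemma sqB_semigroup n : sqB R B n -> J n.
Proof.
rewrite /sqB /= /muB; case: asboolP => [_|nP _]; first by rewrite expr0n => /eqP; rewrite eq_sym oner_eq0.
by apply: contrapT => h; apply: nP; left.
Qed.

Lemma sqB_of n : J n -> ~ (exists2 b, B b & (b ^ 2 %| n)%N) -> sqB R B n.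
Proof.
move=> Jn nsq; rewrite /sqB /= /muB asboolF; last by case.
by rewrite -exprM mulnC exprM sqrrN !expr1n.
Qed.

(** Squares of elements of B are split off one at a time and collected in [q]. *)
Lemma square_decomposition n : J n ->
  exists q s, [/\ J q, sqB R B s & n = (s * q ^ 2)%N].
Proof.
elim/ltn_ind: n => n IH Jn.
have [[c Bc /dvdnP[m nE]]|nsq] := pselect (exists2 b, B b & (b ^ 2 %| n)%N); last first.
  by exists 1%N, n; split; rewrite ?exp1n ?muln1 //; [exact: semigroup1|exact: sqB_of].
have c1 := B_gt1 Bc; have n0 := semigroup_gt0 Jn.
have Jm : J m.
  by apply/(semigroup_div Bc)/(semigroup_div Bc); rewrite mulnA mulnn mulnC -nE.
have mn : (m < n)%N.
  have m0 := semigroup_gt0 Jm; rewrite nE -[X in (X < _)%N]muln1 ltn_pmul2l //.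
  by rewrite (ltn_exp2l 0 2).
have [q [s [Jq sB E]]] := IH m mn Jm.
exists (c * q)%N, s; split=> //; first exact: semigroupM.
by rewrite nE E expnMn; ring.
Qed.

Definition sqcnt (m : nat) : nat := (\sum_(1 <= s < m.+1 | `[< sqB R B s >]) 1)%N.
Definition sqpart (m q : nat) : nat :=
  (\sum_(1 <= s < m.+1 | `[< sqB R B s >] && (s * q ^ 2 <= m)%N) 1)%N.

(** Every [n] counted on the left is [s q^2] for at least one admissible pair, while each pair
    accounts for a single [n]. *)
Lemma cnt_decomposition m : (cnt J m <= \sum_(1 <= q < m.+1 | `[< J q >]) sqpart m q)%N.
Proof.
have exq n : (1 <= n < m.+1)%N && `[< J n >] ->
    (1 <= \sum_(1 <= q < m.+1 | `[< J q >])
        \sum_(1 <= s < m.+1 | `[< sqB R B s >]) (n == s * q ^ 2)%N)%N.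
  move=> /andP[/andP[n0 nm] /asboolP /square_decomposition[q [s [Jq sB nE]]]].
  have q0 := semigroup_gt0 Jq; have s0 := semigroup_gt0 (sqB_semigroup sB).
  have qn : (q <= n)%N.
    by rewrite nE expnS expn1 mulnCA -{1}[q]muln1 leq_pmul2l // muln_gt0 s0.
  have sn : (s <= n)%N by rewrite nE leq_pmulr // expn_gt0 q0.
  rewrite (big_rem q) /=; last by rewrite mem_index_iota q0 ltnS (leq_trans qn).
  rewrite asboolT //; apply: leq_trans (leq_addr _ _).
  rewrite (big_rem s) /=; last by rewrite mem_index_iota s0 ltnS (leq_trans sn).
  by rewrite asboolT // -nE eqxx leq_addr.
rewrite /cnt big_nat_cond.
apply: (@leq_trans (\sum_(1 <= n < m.+1 | (1 <= n < m.+1) && `[< J n >])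
  \sum_(1 <= q < m.+1 | `[< J q >])
    \sum_(1 <= s < m.+1 | `[< sqB R B s >]) (n == s * q ^ 2))%N).
  exact: leq_sum.
rewrite -big_nat_cond exchange_big /=; apply: leq_sum => q _.
rewrite exchange_big /= /sqpart [leqRHS]big_mkcondr /=; apply: leq_sum => s _.
have le1 (P : pred nat) : (\sum_(1 <= n < m.+1 | P n) (n == s * q ^ 2)%N <= 1)%N.
  rewrite -big_filter -big_mkcond /= sum1_count.
  by apply: leq_trans (leq_b1 (s * q ^ 2 \in filter P (index_iota 1 m.+1)))%N;
    rewrite -count_uniq_mem ?filter_uniq ?iota_uniq //; apply: eq_leq; apply: eq_count.
case: ifP => [_|/negbT]; first exact: le1.
rewrite -ltnNge => lt.
rewrite big_nat_cond big1 // => n /andP[/andP[_ nm] _]; apply/eqP; rewrite eqb0.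
by rewrite neq_ltn; apply/orP; left; apply: leq_trans lt.
Qed.

Lemma sqpart_le m q : (sqpart m q <= sqcnt m)%N.
Proof. by rewrite /sqpart big_mkcondr /=; apply: leq_sum => s _; case: ifP. Qed.

Lemma sqpart_le_cnt m q : (0 < q)%N -> (sqpart m q <= cnt J (m %/ q ^ 2))%N.
Proof.
move=> q0; have q2 : (0 < q ^ 2)%N by rewrite expn_gt0 q0.
rewrite /cnt (@big_nat_widen _ _ _ _ _ m.+1) ?ltnS ?leq_div //= /sqpart.
rewrite big_mkcond [leqRHS]big_mkcond /=; apply: leq_sum => s _.
case: ifP => // /andP[/asboolP sB sm]; rewrite asboolT /=; last exact: sqB_semigroup sB.
by rewrite ltnS leq_divRL // sm.
Qed.

Variable alpha : R.
Hypothesis alpha01 : 0 < alpha < 1.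
Hypothesis B_index : has_index J alpha.

(* Interpolates sqpart m q between sqcnt m and the trivial bound in such a way
   that the sum over q converges. *)
Lemma sqcnt_lower (e : R) : 0 < e -> exists2 K : R, 0 < K & forall m, (0 < m)%N ->
  m%:R `^ (alpha - e) <= K * (sqcnt m)%:R.
Proof.
move=> e0; have [a0 a1] := andP alpha01; pose d := e / 5.
have d0 : 0 < d by rewrite divr_gt0.
have [C C1 hC] := cnt_bounds alpha01 semigroup1 B_index d0.
have C0 : 0 < C by apply: lt_le_trans C1.
pose be := alpha + d.
have be0 : 0 < be by rewrite addr_gt0.
have hz m : (0 < m)%N -> (cnt J m)%:R <= C * m%:R `^ be by move=> /hC[].
(* Weight 1/3 goes to [sqcnt m] and 2/3 to the bound of order [(m / q^2)^be]; the resulting decay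
   [q^(-4 be / 3)] beats the exponent [be] of the count. Cubing at the end removes the exponent
   1/3. *)
have [Z Z0 hZ] := zeta_bound (th := 4 / 3 * be) (ltW C0) (ltW be0) ltac:(lra) hz.
pose c := C * (C `^ (2 / 3) * (Z + 1)).
have c0 : 0 < c by rewrite !mulr_gt0 ?powR_gt0 // ltr_wpDl.
exists (c ^+ 3) => [|m m0]; first by rewrite exprn_gt0.
have mp : 0 < m%:R :> R by rewrite ltr0n.
have Q0 : 0 <= (sqcnt m)%:R :> R by [].
have part q : (0 < q)%N -> (sqpart m q)%:R <=
    (sqcnt m)%:R `^ (1 / 3) * (C `^ (2 / 3) * m%:R `^ (2 / 3 * be)) * q%:R `^ (- (4 / 3 * be)) :> R.
  move=> q0; have qp : 0 < q%:R :> R by rewrite ltr0n.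
  have h1 : (sqpart m q)%:R <= 1 * (sqcnt m)%:R :> R by rewrite mul1r ler_nat sqpart_le.
  have h2 : (sqpart m q)%:R <= 1 * (C * (m%:R `^ be * q%:R `^ (- (2 * be)))).
    rewrite mul1r; apply: (@le_trans _ _ (cnt J (m %/ q ^ 2))%:R).
      by rewrite ler_nat sqpart_le_cnt.
    have [->|mq] := posnP (m %/ q ^ 2)%N.
      rewrite /cnt big_geq // !mulr_ge0 ?powR_ge0 // ltW //.
    apply: (le_trans (hz _ mq)); rewrite ler_wpM2l ?(ltW C0) //.
    have -> : q%:R `^ (- (2 * be)) = (q%:R ^+ 2)^-1 `^ be.
      by rewrite -powR_mulrn ?(ltW qp) // -powR_inv1 ?powR_ge0 // -!powRrM; congr powR; ring.
    rewrite -powRM ?invr_ge0 ?exprn_ge0 ?(ltW qp) //.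
    apply: powR_le2; rewrite ?(ltW be0) //.
    rewrite ler_pdivlMr ?exprn_gt0 // -natrX -natrM ler_nat.
    exact: leq_divM.
  have s01 : 0 <= (1 / 3 : R) <= 1 by apply/andP; split; lra.
  have Y0 : 0 <= C * (m%:R `^ be * q%:R `^ (- (2 * be))).
    by rewrite !mulr_ge0 ?powR_ge0 // ltW.
  have := powR_interp s01 (ler0n _ _) ler01 Q0 Y0 h1 h2; rewrite !mul1r => /le_trans; apply.
  rewrite le_eqVlt; apply/orP; left; apply/eqP; rewrite -[RHS]mulrA; congr (_ * _); rewrite -[RHS]mulrA.
  rewrite powRM ?(ltW C0) ?mulr_ge0 ?powR_ge0 // powRM ?powR_ge0 // -!powRrM.
  by congr (_ `^ _ * (_ `^ _ * _ `^ _)); lra.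
have main : m%:R `^ (alpha - d) <= c * ((sqcnt m)%:R `^ (1 / 3) * m%:R `^ (2 / 3 * be)).
  have [_ /le_trans] := hC m m0; apply.
  rewrite /c -[leRHS]mulrA ler_wpM2l ?(ltW C0) //.
  apply: (@le_trans _ _ (\sum_(1 <= q < m.+1 | `[< J q >]) (sqpart m q)%:R)).
    by rewrite -natr_sum ler_nat cnt_decomposition.
  apply: (@le_trans _ _ (\sum_(1 <= q < m.+1 | `[< J q >])
     (sqcnt m)%:R `^ (1 / 3) * (C `^ (2 / 3) * m%:R `^ (2 / 3 * be)) * q%:R `^ (- (4 / 3 * be)))).
    rewrite big_nat_cond [leRHS]big_nat_cond; apply: ler_sum => q /andP[/andP[q1 _] _].
    exact: part.
  rewrite -mulr_sumr.
  apply: (@le_trans _ _ ((sqcnt m)%:R `^ (1 / 3) * (C `^ (2 / 3) * m%:R `^ (2 / 3 * be)) * (Z + 1))).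
    rewrite ler_wpM2l ?mulr_ge0 ?powR_ge0 //.
    by apply: (le_trans (hZ _)); rewrite lerDl.
  by rewrite le_eqVlt; apply/orP; left; apply/eqP; ring.
have L0 : 0 <= m%:R `^ (alpha - d) by exact: powR_ge0.
have := lerXn2r 3 L0 (le_trans L0 main) main.
have pow3 (x y : R) : (x `^ y) ^+ 3 = x `^ (y * 3%:R).
  by rewrite -powR_mulrn ?powR_ge0 // powRrM.
rewrite !exprMn !pow3.
have -> : 1 / 3 * 3%:R = 1 :> R by lra.
rewrite powRr1 // => h.
have P0 : 0 < m%:R `^ (2 / 3 * be * 3%:R) by rewrite powR_gt0.
rewrite -(ler_pM2r P0) -powRDp // -[leRHS]mulrA; apply: le_trans h.
by apply: ler_powR; rewrite ?ler1n // /be /d; lra.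
Qed.

(** The lower end [2 * m0] serves twice: radicals beyond it admit Parseval with [m0] frequencies,
    and the term at 0 is then at most half of the total. *)
Definition window (m0 m : nat) : nat :=
  (\sum_(1 <= s < m.+1 | `[< sqB R B s >] && (2 * m0 <= s)%N) 1)%N.

Lemma window_ge m0 m : (sqcnt m <= window m0 m + cnt J (2 * m0))%N.
Proof.
rewrite /sqcnt (bigID (fun s => (2 * m0 <= s)%N)) /= leq_add2l.
case: (leqP m (2 * m0)) => h.
  rewrite /cnt (@big_cat_nat _ _ _ m.+1 1 (2 * m0).+1) //=.
  apply: leq_trans (leq_addr _ _); rewrite big_mkcond [leqRHS]big_mkcond /=.
  apply: leq_sum => s _; case: ifP => // /andP[/asboolP sB _].
  by rewrite asboolT //; apply: sqB_semigroup sB.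
rewrite /cnt [leqRHS](@big_nat_widen _ _ _ 1 (2 * m0).+1 m.+1) ?ltnS ?(ltnW h) //=.
rewrite big_mkcond [leqRHS]big_mkcond /=; apply: leq_sum => s _.
case: ifP => // /andP[/asboolP sB]; rewrite -ltnNge => lt.
by rewrite asboolT ?ltnS ?(ltnW lt) //; apply: sqB_semigroup sB.
Qed.

(** Take [m] about [m0^(1+et)]: the squarefree elements up to [m] then outnumber all of the
    semigroup up to [2 * m0]. For the finitely many [m0] below the threshold [m1] the window of [m1]
    is reused, at the cost of a smaller [c]. *)
Lemma window_lower (et : R) : 0 < et <= 1 -> exists2 c : R, 0 < c & forall m0, (0 < m0)%N ->
  exists2 m, (0 < m)%N & c * m%:R * m0%:R `^ (alpha - 1 - et) <= (window m0 m)%:R.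
Proof.
(* With this [e] one has [(1 + et)(alpha - e) >= alpha + 6 e], which leaves a factor [m0^(5 e)] over
   the count up to [2 * m0] to absorb all constants. *)
move=> /andP[et0 et1]; have [a0 a1] := andP alpha01; pose e := et * alpha / 8.
have e0 : 0 < e by rewrite !mulr_gt0 // invr_gt0.
have [C C1 hC] := cnt_bounds alpha01 semigroup1 B_index e0.
have [K K0 hK] := sqcnt_lower e0.
have C0 : 0 < C by apply: lt_le_trans C1.
have e1 : e <= 1 / 8.
  rewrite /e ler_pM2r ?invr_gt0 //; apply: le_trans (_ : et * 1 <= _); last by lra.
  by rewrite ler_wpM2l ?(ltW et0) ?(ltW a1).
pose W := 2 * K * (4 * C + 1).
have W0 : 0 < W by rewrite !mulr_gt0 // addr_gt0 // mulr_gt0.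
pose m1 := (Num.truncn (W `^ ((5 * e)^-1))).+1.
pose Rm (m0 : nat) := Num.truncn (m0%:R `^ (1 + et) : R).
have big m0 : (m1 <= m0)%N -> (0 < Rm m0)%N /\ m0%:R `^ alpha <= (window m0 (Rm m0))%:R.
  move=> m10; have m00 : (0 < m0)%N by apply: leq_trans m10.
  set X := m0%:R : R; have X1 : 1 <= X by rewrite ler1n.
  have X0 : 0 < X by apply: lt_le_trans X1.
  have XW : W <= X `^ (5 * e).
    have Wm : W `^ ((5 * e)^-1) <= X.
      apply: le_trans (_ : m1%:R <= _); last by rewrite ler_nat.
      exact/ltW/truncnS_gt.
    have e5 : 0 <= 5 * e by rewrite mulr_ge0 // ltW.
    have := powR_le2 e5 (powR_ge0 _ _) Wm; rewrite -powRrM mulVf ?powRr1 ?(ltW W0) //.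
    by rewrite gt_eqF // mulr_gt0.
  have Y1 : 1 <= X `^ (1 + et) by rewrite powR_ge1 // addr_ge0 // ltW.
  have Rm0 : (0 < Rm m0)%N by rewrite truncn_gt0.
  split=> //.
  have /truncn_itv/andP[R1 R2] : 0 <= X `^ (1 + et) by exact: powR_ge0.
  rewrite -/(Rm m0) in R1 R2.
  have Rhalf : X `^ (1 + et) / 2 <= (Rm m0)%:R.
    have : 1 <= (Rm m0)%:R :> R by rewrite ler1n.
    by move: R2; rewrite -natr1; lra.
  have [hJ _] := hC (2 * m0)%N ltac:(by rewrite muln_gt0).
  have hQ := hK _ Rm0.
  have hW : (sqcnt (Rm m0))%:R <= (window m0 (Rm m0))%:R + (cnt J (2 * m0))%:R :> R.
    by rewrite -natrD ler_nat window_ge.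
  have ae0 : 0 <= alpha - e.
    have : e <= alpha by rewrite /e ler_pdivrMr //; nra.
    by lra.
  have b1 : X `^ (alpha + 6 * e) <= 2 * K * (sqcnt (Rm m0))%:R.
    rewrite -mulrA; apply: (@le_trans _ _ (2 * (Rm m0)%:R `^ (alpha - e))); last by rewrite ler_pM2l.
    apply: (@le_trans _ _ (2 * (X `^ (1 + et) / 2) `^ (alpha - e))); last first.
      by rewrite ler_pM2l // powR_le2 // divr_ge0 // powR_ge0.
    rewrite powRM ?powR_ge0 ?invr_ge0 // -powRrM.
    apply: (@le_trans _ _ (X `^ ((1 + et) * (alpha - e)) * 1)).
      rewrite mulr1; apply: ler_powR => //; rewrite /e.
      have : 0 <= et * alpha * (1 - et) by rewrite !mulr_ge0 ?subr_ge0 ?(ltW et0) ?(ltW a0).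
      have : 0 <= et * alpha by rewrite mulr_ge0 // ltW.
      nra.
    rewrite [leRHS]mulrCA ler_wpM2l ?powR_ge0 //.
    rewrite -powR_inv1 // -powRrM -{1}[2]powRr1 // -powRDp //; apply: powR_ge1; first by lra.
    lra.
  have b2 : (cnt J (2 * m0))%:R <= 4 * C * X `^ (alpha + e).
    apply: (le_trans hJ); rewrite natrM powRM // mulrCA -[4 * C]/(4 * C) -mulrA.
    rewrite ler_wpM2r ?mulr_ge0 ?powR_ge0 ?(ltW C0) //.
    have -> : 4 = 2 `^ 2%:R :> R by rewrite powR_mulrn //; ring.
    by apply: ler_powR; lra.
  have b3 : X `^ (alpha + 6 * e) = X `^ (5 * e) * X `^ (alpha + e).
    by rewrite -powRDp //; congr powR; lra.
  have b4 : X `^ alpha <= X `^ (alpha + e) by apply: ler_powR => //; rewrite lerDl ltW.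
  have P0 : 0 <= X `^ (alpha + e) by exact: powR_ge0.
  have b5 : W * X `^ (alpha + e) <= 2 * K * (sqcnt (Rm m0))%:R.
    by apply: le_trans b1; rewrite b3 ler_wpM2r.
  have b6 : (4 * C + 1) * X `^ (alpha + e) <= (sqcnt (Rm m0))%:R.
    have K2 : 0 < 2 * K by rewrite mulr_gt0.
    by rewrite -(ler_pM2l K2) mulrA.
  move: b6 hW b2 b4; rewrite mulrDl mul1r; lra.
have [Rp win1] := big m1 (leqnn m1).
have m1R : 1 <= m1%:R :> R by rewrite ler1n.
have win1' : (1 <= window m1 (Rm m1))%N.
  rewrite -(ler_nat R); apply: le_trans win1; apply: powR_ge1 => //; exact: ltW.
have RmP : 0 < (Rm m1)%:R :> R by rewrite ltr0n.
exists (Num.min 1 (Rm m1)%:R^-1) => [|m0 m00]; first by rewrite lt_min ltr01 invr_gt0.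
have X1 : 1 <= m0%:R :> R by rewrite ler1n.
have X0 : 0 < m0%:R :> R by apply: lt_le_trans X1.
have [m01|m01] := leqP m1 m0.
  have [Rm0 win] := big m0 m01; exists (Rm m0) => //; apply: le_trans win.
  apply: (@le_trans _ _ ((Rm m0)%:R * m0%:R `^ (alpha - 1 - et))).
    by rewrite ler_wpM2r ?powR_ge0 // ler_piMl // ge_min lexx.
  apply: (@le_trans _ _ (m0%:R `^ (1 + et) * m0%:R `^ (alpha - 1 - et))).
    by rewrite ler_wpM2r ?powR_ge0 // truncn_le powR_ge0.
  by rewrite -powRDp //; apply: ler_powR => //; lra.
exists (Rm m1) => //; apply: (@le_trans _ _ 1).
  have mn0 : 0 <= (Num.min 1 (Rm m1)%:R^-1 : R) by rewrite le_min ler01 invr_ge0 ltW.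
  rewrite -[leRHS]mulr1; apply: ler_pM; [by rewrite mulr_ge0 // ltW|exact: powR_ge0| |].
    apply: (@le_trans _ _ ((Rm m1)%:R^-1 * (Rm m1)%:R)).
      by rewrite ler_pM2r // ge_min lexx orbT.
    by rewrite mulVf // gt_eqF.
  rewrite -[leRHS](powRr0 m0%:R); apply: ler_powR => //; lra.
rewrite ler1n; apply: leq_trans win1' _; rewrite /window big_mkcond [leqRHS]big_mkcond /=.
apply: leq_sum => s _; case: ifP => // /andP[-> h] /=.
by rewrite (leq_trans _ h) // leq_mul2l ltnW // orbT.
Qed.

End Squarefree.

(** * The second moment *)

Section GBounds.
Variables (R : realType) (B : set nat) (Z : R).
Hypothesis B_gt1 : forall c, B c -> (1 < c)%N.
Hypothesis B_sum : forall N, \sum_(0 <= c < N | `[< B c >]) (c%:R : R)^-1 <= Z.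

Definition gprod (n N : nat) : R :=
  \prod_(0 <= b < N | `[< B b >] && ~~ (b %| n)%N) (1 - (b%:R : R)^-1).

Lemma factor_bounds c : B c -> expR (- (2 * (c%:R : R)^-1)) <= (1 - (c%:R)^-1 : R) <= 1.
Proof.
move=> /B_gt1 c1; set u := (c%:R)^-1 : R.
have u0 : 0 <= u by rewrite invr_ge0.
have u2 : u <= 2^-1 by rewrite lef_pV2 ?posrE ?ltr0n ?(ltnW c1) // ler_nat.
rewrite gerBl u0 andbT expRN -[leRHS]invrK lef_pV2 ?posrE ?invr_gt0 ?expR_gt0 //; last by lra.
apply: le_trans (expR_ge1Dx _); rewrite -[leLHS]mul1r ler_pdivrMr; last by lra.
nra.
Qed.

Lemma gprod_bounds n N : expR (- (2 * Z)) <= gprod n N <= 1.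
Proof.
apply/andP; split.
  apply: (@le_trans _ _ (\prod_(0 <= b < N | `[< B b >] && ~~ (b %| n)%N)
      expR (- (2 * (b%:R : R)^-1)))).
    rewrite -expR_sum ler_expR sumrN lerN2 -mulr_sumr ler_pM2l //.
    apply: le_trans (B_sum N); rewrite big_mkcondr /=; apply: ler_sum => b _.
    by case: ifP => // _; rewrite invr_ge0.
  by apply: ler_prod => b /andP[/asboolP Bb _]; rewrite expR_ge0; case/andP: (factor_bounds Bb).
apply: prodr_ile1 => b /andP[/asboolP Bb _]; have /andP[h ->] := factor_bounds Bb.
by rewrite andbT (le_trans _ h) // expR_ge0.
Qed.

Lemma gprod_cvg n : cvgn (gprod n).
Proof.
apply: nonincreasing_is_cvgn => [N N' NN|]; last first.
  by exists (expR (- (2 * Z))) => _ [N _ <-]; case/andP: (gprod_bounds n N).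
rewrite /gprod [leLHS](big_cat_nat (n := N)) //=; apply: ler_piMr.
  by have /andP[h _] := gprod_bounds n N; apply: le_trans h; apply: expR_ge0.
apply: prodr_ile1 => b /andP[/asboolP Bb _]; have /andP[h ->] := factor_bounds Bb.
by rewrite andbT (le_trans _ h) // expR_ge0.
Qed.

Lemma gprod_lim n : expR (- (2 * Z)) <= limn (gprod n) <= 1.
Proof.
apply/andP; split.
  by apply: limr_ge; [exact: gprod_cvg|near=> N; case/andP: (gprod_bounds n N)].
by apply: limr_le; [exact: gprod_cvg|near=> N; case/andP: (gprod_bounds n N)].
Unshelve. all: by end_near.
Qed.

Lemma gB_norm n : `|gB R B n| = `|muB R B n| / n%:R * limn (gprod n).
Proof.
have h0 : 0 <= limn (gprod n).
  by have /andP[h _] := gprod_lim n; apply: le_trans h; apply: expR_ge0.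
have -> : gB R B n = muB R B n / n%:R * limn (gprod n) by [].
by rewrite !normrM normfV normr_nat (ger0_norm h0).
Qed.

Lemma gB_upper n : `|gB R B n| <= n%:R^-1.
Proof.
rewrite gB_norm; have /andP[h0 h1] := gprod_lim n.
have h00 := le_trans (expR_ge0 _) h0.
apply: (@le_trans _ _ (`|muB R B n| / n%:R)).
  by rewrite ler_piMr // mulr_ge0 ?invr_ge0.
rewrite ler_piMl ?invr_ge0 // /muB; case: asboolP => _; rewrite ?normr0 //.
by rewrite normrX normrN1 expr1n.
Qed.

Lemma gB_lower n : sqB R B n -> expR (- (2 * Z)) / n%:R <= `|gB R B n|.
Proof.
move=> sq; rewrite gB_norm; have /andP[h0 h1] := gprod_lim n.
have -> : `|muB R B n| = 1.
  by apply/eqP; rewrite -(@eqrXn2 _ 2) // expr1n -normrX sq normr1.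
by rewrite mul1r mulrC ler_wpM2l // invr_ge0.
Qed.

End GBounds.

Section SecondMoment.
Variables (R : realType) (n : nat) (b : 'I_n -> nat).
Hypothesis b_gt1 : forall i, (1 < b i)%N.
Hypothesis b_coprime : forall i j, i != j -> coprime (b i) (b j).
Local Notation M := (modulus b).
Local Notation rad := (rad b).
Local Notation supp := (supp b).

(** Zero-sum pairs are exactly those of the form [(a, -a)], and the weight at [-a] is the
    conjugate. *)
Lemma mom2 (w : 'I_M -> R[i]) : (forall x, w (negM b_gt1 x) = (w x)^*%C) ->
  mom w 2 = \sum_x `|w x| ^+ 2.
Proof.
move=> wc; pose h (a : 'I_M) : {ffun 'I_2 -> 'I_M} :=
  [ffun i => if i == ord0 then a else negM b_gt1 a].
rewrite /mom (reindex_onto h (fun x => x ord0)) /=; last first.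
  move=> x; rewrite /zerosum big_ord_recl big_ord1 => xz; apply/ffunP => i; rewrite ffunE.
  case: eqVneq => [-> //|i0].
  have -> : i = lift ord0 ord0 by apply: val_inj; case: i i0 => [[|[]]].
  apply: val_inj; have h1 := negM_add b_gt1 (x ord0).
  have : x ord0 + negM b_gt1 (x ord0) = x ord0 + x (lift ord0 ord0) %[mod M].
    by rewrite (eqP h1) (eqP xz).
  by move/eqP; rewrite eqn_modDl => /eqP; rewrite !modn_small.
apply: eq_big => a.
  rewrite /zerosum big_ord_recl big_ord1 !ffunE /= eqxx andbT.
  exact: negM_add.
by move=> _; rewrite big_ord_recl big_ord1 !ffunE /= wc normc_sq.
Qed.

Lemma sum_multiples (V : zmodType) (F : nat -> V) q r : (0 < q)%N ->
  \sum_(0 <= x < r * q | (q %| x)%N) F x = \sum_(a < r) F (a * q)%N.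
Proof.
move=> q0; elim: r => [|r IH]; first by rewrite mul0n big_geq // big_ord0.
rewrite big_ord_recr /= -IH (big_cat_nat (n := (r * q)%N)) //=; last by rewrite leq_mul2r leqnSn orbT.
congr (_ + _); rewrite big_ltn_cond ?mulSn ?ltn_pmul2r //; last by rewrite -[X in (X < _)%N]add0n ltn_add2r.
rewrite dvdn_mull // big_nat_cond big1 ?addr0 // => x /andP[/andP[rx xr] /dvdnP[y yE]].
have : (r < y < r.+1)%N.
  by rewrite -(ltn_pmul2r q0) -yE rx -(ltn_pmul2r q0) -yE mulSn.
by rewrite ltnS; case: ltngtP.
Qed.

Lemma supp_sub x (D : {set 'I_n}) : (supp x \subset D) = (rad (~: D) %| x)%N.
Proof.
apply/idP/idP => [/fintype.subsetP sD|dx].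
  apply: rad_dvd => // i; rewrite inE; apply: contraNT => nd.
  by apply: sD; rewrite inE.
apply/fintype.subsetP => i; rewrite inE; apply: contraNT => iD.
apply: dvdn_trans dx; rewrite rad_unfold (bigD1 i) ?inE //= dvdn_mulr //.
Qed.

(** Residues with support in [D] are the multiples of [rad (~: D)], a cyclic group of order [rad D];
    this brings the sum into the form to which Parseval applies. *)
Lemma sum_supp_sub (F : nat -> R) (D : {set 'I_n}) :
  \sum_(x < M | supp x \subset D) F x = \sum_(a < rad D) F (a * rad (~: D))%N.
Proof.
rewrite -sum_multiples; last exact: rad_gt0.
rewrite radC -(big_mkord (fun x => supp x \subset D)).
by apply: eq_bigl => x; rewrite supp_sub.
Qed.

(** Factor [rad D] as [rad D0] times [rad (D :\: D0)] and let the second set vary freely. *)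
Lemma rad_superset_sum (D0 : {set 'I_n}) (Zc : R) :
    \sum_(E : {set 'I_n}) (rad E)%:R ^- 2 <= Zc ->
  \sum_(D : {set 'I_n} | D0 \subset D) (rad D)%:R ^- 2 <= (rad D0)%:R ^- 2 * Zc.
Proof.
move=> hZ; apply: (@le_trans _ _ ((rad D0)%:R ^- 2 * \sum_(E : {set 'I_n}) (rad E)%:R ^- 2)); last first.
  by rewrite ler_wpM2l // invr_ge0 exprn_ge0.
rewrite mulr_sumr.
rewrite (eq_bigl (fun D => D \in [set E : {set 'I_n} | D0 \subset E])); last by move=> D; rewrite inE.
apply: (@ler_sum_inj R _ _ _ (fun D => D :\: D0)) => [D E|D|E].
- rewrite !inE => DD ED /setP e; apply/setP => i; have := e i; rewrite !inE.
  case: (boolP (i \in D0)) => //= i0 _.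
  by rewrite (fintype.subsetP DD) // (fintype.subsetP ED).
- rewrite inE => DD; rewrite -invfM -exprMn -natrM.
  rewrite (_ : rad D = rad D0 * rad (D :\: D0))%N //.
  by rewrite {1}(radID b D D0); congr (rad _ * _)%N; apply/setIidPr.
- by rewrite mulr_ge0 // invr_ge0 exprn_ge0.
Qed.

Lemma sum_rad_sq (Z : R) : \sum_i ((b i)%:R : R)^-1 <= Z ->
  \sum_(E : {set 'I_n}) ((rad E)%:R : R) ^- 2 <= expR Z.
Proof.
move=> hZ; apply: (@le_trans _ _ (expR (\sum_i ((b i)%:R : R)^-1))); last by rewrite ler_expR.
rewrite expR_sum.
apply: (@le_trans _ _ (\prod_i ((b i)%:R ^- 2 + 1 : R))); last first.
  apply: ler_prod => i _; rewrite addr_ge0 ?invr_ge0 ?exprn_ge0 //=.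
  apply: le_trans (expR_ge1Dx _); rewrite addrC lerD2l expr2 invfM.
  have b0 : 0 < (b i)%:R :> R by rewrite ltr0n ltnW.
  by rewrite ler_piMl ?invr_ge0 ?(ltW b0) // invf_le1 // ler1n ltnW.
rewrite bigA_distr /= le_eqVlt; apply/orP; left; apply/eqP; apply: eq_bigr => E _.
rewrite rad_unfold natr_prod -prodrXl -prodfV [RHS](bigID (mem E)) /= [X in _ = _ * X]big1 ?mulr1.
  by apply: eq_bigr => i ->.
by move=> i /negbTE ->.
Qed.

Variables (f : nat -> R) (V P Zc : R) (g : nat -> R) (m0 m : nat).
Hypothesis f_ge0 : forall x, 0 <= f x.
Hypothesis P_ge0 : 0 <= P.
Hypothesis V_ge0 : 0 <= V.
Hypothesis Zc_gt0 : 0 < Zc.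
Hypothesis sumZ : \sum_(E : {set 'I_n}) ((rad E)%:R : R) ^- 2 <= Zc.
Hypothesis g_ge : forall D : {set 'I_n}, P / (rad D)%:R <= `|g (rad D)|.
Hypothesis f0 : f 0%N <= m0%:R * V.
Hypothesis f_parseval : forall D : {set 'I_n}, (2 * m0 <= rad D)%N ->
  \sum_(a < rad D) f (a * rad (~: D))%N = (rad D)%:R * V.

(* Each x is counted by the supersets D of its support with total weight
   O(rad (supp x) ^- 2), while Parseval on the subgroup of order rad D gives
   the contribution of each D. *)
Lemma second_moment_lower :
  P ^+ 2 / (2 * Zc) * (V / m%:R) * #|[set D : {set 'I_n} | (2 * m0 <= rad D <= m)%N]|%:R <=
  \sum_(x < M | (x != 0 :> nat)%N) g (rad (supp x)) ^+ 2 * f x.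
Proof.
set S := [set D | _]; set T := \sum_(x < M | _) _.
have r0 (D : {set 'I_n}) : 0 < (rad D)%:R :> R by rewrite ltr0n rad_gt0.
pose U := \sum_(x < M | (x != 0 :> nat)%N) f x * (rad (supp x))%:R ^- 2.
have TU : P ^+ 2 * U <= T.
  rewrite mulr_sumr; apply: ler_sum => x _; rewrite mulrCA mulrC ler_wpM2r //.
  rewrite -exprVn -exprMn -(real_normK (num_real (g _))) lerXn2r ?nnegrE //.
  by rewrite divr_ge0 // ltW.
have DU : \sum_(D in S) (rad D)%:R ^- 2 * \sum_(x < M | (x != 0 :> nat)%N && (supp x \subset D)) f x <=
    Zc * U.
  under eq_bigr do rewrite mulr_sumr.
  rewrite (exchange_big_dep (fun x : 'I_M => (x != 0 :> nat)%N)) /=; last by move=> D x _ /andP[].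
  rewrite /U mulr_sumr; apply: ler_sum => x x0; rewrite x0 /= -mulr_suml mulrCA mulrC.
  rewrite ler_wpM2l // mulrC.
  apply: le_trans (rad_superset_sum (supp x) sumZ).
  rewrite big_mkcondl /=; apply: ler_sum => D _.
  by case: (D \in S); rewrite ?lexx // invr_ge0 exprn_ge0.
have DV : \sum_(D in S) V / (2 * m%:R) <= \sum_(D in S) (rad D)%:R ^- 2 *
    \sum_(x < M | (x != 0 :> nat)%N && (supp x \subset D)) f x.
  apply: ler_sum => D; rewrite inE => /andP[D1 D2].
  have full : \sum_(x < M | supp x \subset D) f x = (rad D)%:R * V.
    by rewrite sum_supp_sub f_parseval.
  (* The term at [x = 0] is at most [m0 V], which is at most half of the total since
     [2 * m0 <= rad D]. *)
  have half : (rad D)%:R * V / 2 <= \sum_(x < M | (x != 0 :> nat)%N && (supp x \subset D)) f x.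
    move: full; rewrite (bigD1 (Ordinal (modulus_gt0 b_gt1))) /=; last first.
      by rewrite supp_sub dvdn0.
    rewrite (eq_bigl (fun x : 'I_M => (x != 0 :> nat)%N && (supp x \subset D))); last first.
      by move=> x; rewrite andbC -val_eqE.
    move=> E; have : m0%:R * V * 2 <= (rad D)%:R * V.
      rewrite mulrAC ler_wpM2r // -natrM ler_nat mulnC //.
    move: E f0; lra.
  apply: (@le_trans _ _ ((rad D)%:R ^- 2 * ((rad D)%:R * V / 2))); last first.
    by rewrite ler_wpM2l // invr_ge0 exprn_ge0.
  have -> : (rad D)%:R ^- 2 * ((rad D)%:R * V / 2) = V / (2 * (rad D)%:R).
    by field; rewrite gt_eqF.
  rewrite ler_wpM2l // lef_pV2 ?posrE ?mulr_gt0 ?ler_pM2l ?ler_nat // ltr0n.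
  by rewrite (leq_trans _ D2) // rad_gt0.
have {DV DU}h := le_trans DV DU.
have {}h : V / (2 * m%:R) * #|S|%:R <= Zc * U by rewrite mulr_natr -sumr_const.
apply: le_trans TU.
rewrite [leLHS](_ : _ = P ^+ 2 * (V / (2 * m%:R) * #|S|%:R / Zc)); last first.
  rewrite !invfM; ring.
by rewrite ler_wpM2l ?exprn_ge0 // ler_pdivrMr // [leRHS]mulrC.
Qed.

End SecondMoment.

(** * Estimates uniform in the truncation *)

Section Assembly.
Variables (R : realType) (B : set nat) (alpha : R).
Hypothesis alpha01 : 0 < alpha < 1.
Hypothesis B_gt1 : forall c, B c -> (1 < c)%N.
Hypothesis B_coprime : forall c c', B c -> B c' -> c != c' -> coprime c c'.
Hypothesis B_index : has_index (semigroup_gen B) alpha.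
Local Notation bN N := (@tb B N).
Local Notation MN N := (modulus (bN N)).

Lemma tb_sum (F : nat -> R) N : \sum_i F (bN N i) = \sum_(0 <= c < N | `[< B c >]) F c.
Proof.
rewrite /index_iota subn0 -[RHS]big_filter -/(trunc_seq B N) (big_nth 0%N) big_mkord.
by apply: eq_bigr.
Qed.

Lemma B_zeta (th : R) : alpha < th -> exists2 Z : R, 0 <= Z &
  forall N, \sum_(0 <= c < N | `[< B c >]) (c%:R : R) `^ (- th) <= Z.
Proof.
move=> ath; have [a0 a1] := andP alpha01; pose e := (th - alpha) / 2.
have e0 : 0 < e by rewrite divr_gt0 // subr_gt0.
have [C C1 hC] := cnt_bounds alpha01 (semigroup1 B) B_index e0.
have hC' m : (0 < m)%N -> (cnt (semigroup_gen B) m)%:R <= C * m%:R `^ (alpha + e) by move=> /hC[].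
have ae0 : 0 <= alpha + e by rewrite addr_ge0 // ltW.
have aeth : alpha + e < th by rewrite /e; lra.
have [Z Z0 hZ] := zeta_bound (le_trans ler01 C1) ae0 aeth hC'.
exists Z => // N; apply: le_trans (hZ N).
  case: N => [|N]; first by rewrite !big_geq.
  rewrite big_ltn_cond // asboolF; last by move=> /B_gt1.
  rewrite big_mkcond [leRHS]big_mkcond /=; apply: ler_sum => c _.
  case: asboolP => [Bc|_]; last by case: ifP => // _; apply: powR_ge0.
  by rewrite asboolT //; apply: semigroup_sub.
Qed.

Lemma B_harmonic : exists2 Z : R, 0 <= Z &
  forall N, \sum_(0 <= c < N | `[< B c >]) (c%:R : R)^-1 <= Z.
Proof.
have [a0 a1] := andP alpha01; have [Z Z0 hZ] := B_zeta a1; exists Z => // N.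
apply: le_trans (hZ N); apply: ler_sum => c _; by rewrite powR_inv1.
Qed.

(** Truncation at [N > m] keeps every element of B dividing some [s <= m], so each squarefree [s] of
    the window is the radical of a set of indices. *)
Lemma card_window m0 m N : (m < N)%N ->
  (window R B m0 m <= #|[set D : {set 'I_(size (trunc_seq B N))} |
     (2 * m0 <= rad (bN N) D <= m)%N]|)%N.
Proof.
move=> mN; rewrite /window sum1_count -size_filter cardE -(size_map (rad (bN N))).
apply: uniq_leq_size; first by rewrite filter_uniq // iota_uniq.
move=> s; rewrite mem_filter mem_index_iota => /andP[/andP[/asboolP sB ms] /andP[s1 sm]].
rewrite ltnS in sm.
have [|D sD] := @sqB_rad R B N s sB.
  by move=> c Bc cs; apply: leq_ltn_trans mN; apply: leq_trans sm; apply: dvdn_leq.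
by rewrite sD; apply: map_f; rewrite mem_enum inE -sD ms.
Qed.

(** Only the bound on the weights themselves is extracted, so [moments_bound] is applied to the zero
    function with [Kw = 0]. *)
Lemma wt_moment_bound k (e0 : R) : (0 < k)%N -> 0 < e0 -> exists2 A : R, 0 <= A &
  forall N H, 1 <= H -> mom (fun v : 'I_(MN N) => wt (bN N) H v) k <= A * H `^ (k%:R * alpha / 2 + e0).
Proof.
move=> k0 e00; have [th ath /(_ _ 0 (lexx 0))] := moments_bound alpha01 k0 e00.
have [Z Z0 hZ] := B_zeta ath => /(_ Z)[A A0 hA]; exists A => // N H H1.
have zN : \sum_i (bN N i)%:R `^ (- th) <= Z by rewrite (tb_sum (fun c => c%:R `^ (- th))).
have [|h _] := hA _ (bN N) (@tb_gt1 B B_gt1 N) (@tb_coprime B B_coprime N) zN H H1 (fun=> 0).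
  by move=> x; rewrite normr0 mul0r.
exact: h.
Qed.

Section Profile.
Variables (phi : R -> R) (L Mv : R).
Hypothesis L_ge0 : 0 <= L.
Hypothesis phi_supp : forall x, phi x != 0 -> 0 <= x <= L.
Hypothesis phi_var : forall a b : R, a <= b -> (total_variation a b phi <= Mv%:E)%E.

Definition len (H : R) : nat := (Num.truncn (L * H)).+1.
Definition energy (H : R) : R := \sum_(m < len H) coef phi H m ^+ 2.

Lemma len_gt H : L * H < (len H)%:R.
Proof. exact: truncnS_gt. Qed.

Lemma len_le H : 1 <= H -> (len H)%:R <= (L + 1) * H.
Proof.
move=> H1; have /truncn_itv/andP[h _] : 0 <= L * H.
  by rewrite mulr_ge0 // (le_trans ler01).
by rewrite /len -natr1; lra.
Qed.

Lemma energy_ge0 H : 0 <= energy H.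
Proof. by apply: sumr_ge0 => m _; apply: sqr_ge0. Qed.

Section AtH.
Variable H : R.
Hypothesis H1 : 1 <= H.
Local Notation w N := (@wN R B phi H N).

Lemma wN_le (K : R) N : 0 <= K ->
    (forall x : 'I_(MN N), (0 < x)%N -> `|Phi phi H (x%:R / (MN N)%:R)| <=
       (K * Num.min H ((MN N)%:R / (ndist (bN N) x)%:R))%:C%C) ->
  forall x, `|w N x| <= (K * wt (bN N) H x)%:C%C.
Proof.
have [Z Z0 hZ] := B_harmonic.
move=> K0 hK x; rewrite /wN; case: eqVneq => [x0|x0].
  by rewrite normr0 ler0c mulr_ge0 // wt_ge0 //; apply: tb_gt1.
rewrite normrM norm_real_complex /wt.
set r := rad _ _; rewrite mulrA mulrC [leRHS]rmorphM /=.
apply: ler_pM; rewrite ?normr_ge0 ?ler0c ?normr_ge0 //.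
  by apply: hK; rewrite lt0n.
by rewrite lecR; exact: (gB_upper B_gt1 hZ).
Qed.

Lemma wN_kernel N x : `|w N x| <= ((L + 4) * Mv * wt (bN N) H x)%:C%C.
Proof.
have H0 : 0 < H by exact: lt_le_trans H1.
have M0 := Mv_ge0 phi_var.
apply: wN_le => [|y y0]; first by rewrite mulr_ge0 // addr_ge0.
have yM : (0 < y < MN N)%N by rewrite y0 ltn_ord.
apply: (le_trans (Phi_kernel_le phi_supp phi_var H1 (len_gt H) yM)); rewrite lecR.
have mn0 : 0 <= Num.min H ((MN N)%:R / (minn y (MN N - y))%:R) :> R.
  by rewrite le_min (ltW H0) divr_ge0.
rewrite ler_wpM2r // ler_wpM2r //.
have : (len H)%:R / H <= L + 1 by rewrite ler_pdivrMr // len_le.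
by lra.
Qed.

(** Meant for bounded [H], where [C_2] may be tiny. Cauchy-Schwarz bounds the kernel by the energy,
    so that the bound on [C_k] carries the same power of the energy as [C_2^(k/2)]; the weight can
    be kept because its minimum with [H] is at least 1. *)
Lemma wN_energy N x :
  `|w N x| <= (Num.sqrt ((len H)%:R * energy H) * wt (bN N) H x)%:C%C.
Proof.
have E0 : 0 <= (len H)%:R * energy H by rewrite mulr_ge0 // energy_ge0.
apply: wN_le => [|y y0]; first exact: sqrtr_ge0.
have yM := ltn_ord y.
have h1 : 1 <= Num.min H ((MN N)%:R / (ndist (bN N) y)%:R) :> R.
  have d0 : (0 < ndist (bN N) y)%N by rewrite leq_min y0 subn_gt0.
  rewrite le_min H1 ler_pdivlMr ?ltr0n // mul1r ler_nat geq_min (ltnW yM) //.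
apply: (@le_trans _ _ (Num.sqrt ((len H)%:R * energy H))%:C%C); last first.
  by rewrite lecR ler_peMr ?sqrtr_ge0.
have := Phi_sq_le phi_supp H1 (len_gt H) (y%:R / (MN N)%:R).
rewrite cnormE -rmorphXn !lecR => h.
by rewrite -[leLHS]ger0_norm ?cnorm_ge0 // -sqrtr_sqr ler_wsqrtr.
Qed.

Lemma mom_real N k : mom (w N) k = (complex.Re (mom (w N) k))%:C%C.
Proof.
have : complex.Im (mom (w N) k) = 0.
  apply: (@mom_conj R _ _ (@tb_gt1 B B_gt1 N)) => x; apply: wN_conj.
  exact: (Phi_conj phi_supp H1 (len_gt H)).
by case: (mom (w N) k) => x y /= ->.
Qed.

Lemma Ck_lim k : (0 < k)%N -> exists2 l : R, Ck B phi H k = l%:C%C &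
  (complex.Re (mom (w N) k) @[N --> \oo] --> l)%classic.
Proof.
move=> k0; have [A A0 hA] := wt_moment_bound k0 ltr01.
apply: (@Ck_limit R B B_gt1 B_coprime phi H k ((L + 4) * Mv)) => //.
- by rewrite mulr_ge0 ?addr_ge0 // (Mv_ge0 phi_var).
- exact: (Phi_conj phi_supp H1 (len_gt H)).
- exact: wN_kernel.
- by move=> N; apply: hA.
Qed.

Lemma second_moment_trunc (Z : R) m N : (m < N)%N ->
    (forall N, \sum_(0 <= c < N | `[< B c >]) (c%:R : R)^-1 <= Z) ->
  expR (- (2 * Z)) ^+ 2 / (2 * expR Z) * (energy H / m%:R) * (window R B (len H) m)%:R <=
  complex.Re (mom (w N) 2).
Proof.
move=> mN hZ; have H0 : 0 < H by exact: lt_le_trans H1.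
pose f (x : nat) : R := cnorm (Phi phi H (x%:R / (MN N)%:R)) ^+ 2.
have fE x : `|Phi phi H (x%:R / (MN N)%:R)| ^+ 2 = (f x)%:C%C.
  by rewrite cnormE -rmorphXn.
have tg := @tb_gt1 B B_gt1 N; have tc := @tb_coprime B B_coprime N.
have -> : complex.Re (mom (w N) 2) =
    \sum_(x < MN N | (x != 0 :> nat)%N) gB R B (rad (bN N) (supp (bN N) x)) ^+ 2 * f x.
  apply: complexI; rewrite -mom_real (mom2 (b_gt1 := tg)); last first.
    by move=> x; apply: wN_conj => //; exact: (Phi_conj phi_supp H1 (len_gt H)).
  rewrite [RHS]rmorph_sum /= [RHS]big_mkcond /=; apply: eq_bigr => x _.
  rewrite /wN; case: eqVneq => _ /=; first by rewrite normr0 expr0n.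
  by rewrite normrM exprMn norm_real_complex fE -rmorphXn real_normK ?num_real // -rmorphM.
apply: le_trans (@second_moment_lower R _ (bN N) tg tc f (energy H)
   (expR (- (2 * Z))) (expR Z) (gB R B) (len H) m _ _ _ _ _ _ _ _).
- rewrite ler_wpM2l ?ler_nat ?card_window //.
  by rewrite !mulr_ge0 ?invr_ge0 ?exprn_ge0 ?mulr_ge0 ?expR_ge0 ?energy_ge0.
- by move=> x; rewrite exprn_ge0 // cnorm_ge0.
- exact: expR_ge0.
- exact: energy_ge0.
- exact: expR_gt0.
- by apply: sum_rad_sq => //; rewrite (tb_sum (fun c => (c%:R)^-1)).
- by move=> D; apply: (gB_lower B_gt1 hZ); apply: rad_sqB.
- by rewrite -lecR -fE mul0r; apply: (Phi_sq_le phi_supp H1 (len_gt H)).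
- move=> D hD; apply: complexI; rewrite rmorph_sum /=.
  have r0 : (0 < rad (bN N) D)%N by apply: rad_gt0.
  have q0 : (0 < rad (bN N) (~: D))%N by apply: rad_gt0.
  rewrite /energy -(parseval (coef phi H) (_ : len H <= rad (bN N) D)%N r0); last first.
    by apply: leq_trans hD; rewrite leq_pmull.
  apply: eq_bigr => a _; rewrite -fE (Phi_sum phi_supp H1 (len_gt H)).
  have -> // : (a * rad (bN N) (~: D))%:R / (MN N)%:R = a%:R / (rad (bN N) D)%:R :> R.
  rewrite -(radC (bN N) D) !natrM; field.
  by rewrite !pnatr_eq0 -!lt0n r0 q0.
Qed.

End AtH.

(** The end [m] of the window depends on [H] alone, so the lower bound holds for all [N > m] and
    passes to the limit. *)
Lemma second_moment_limit (et : R) : 0 < et <= 1 -> exists2 c : R, 0 < c &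
  forall H l, 1 <= H -> (complex.Re (mom (@wN R B phi H N) 2) @[N --> \oo] --> l)%classic ->
    c * energy H * (len H)%:R `^ (alpha - 1 - et) <= l.
Proof.
move=> et01; have [Z Z0 hZ] := B_harmonic.
have [c c0 hc] := window_lower B_gt1 B_coprime alpha01 B_index et01.
pose q := expR (- (2 * Z)) ^+ 2 / (2 * expR Z).
have q0 : 0 < q by rewrite divr_gt0 ?exprn_gt0 ?mulr_gt0 ?expR_gt0.
exists (q * c) => [|H l H1 hl]; first by rewrite mulr_gt0.
have [m mp hm] := hc (len H) isT.
have mR : 0 < m%:R :> R by rewrite ltr0n.
rewrite -(cvg_lim _ hl) //; apply: limr_ge; first by apply/cvg_ex; exists l.
exists m.+1 => // N /= mN; apply: le_trans (second_moment_trunc H1 mN hZ).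
rewrite -/q.
have -> : q * c * energy H * (len H)%:R `^ (alpha - 1 - et) =
    q * (energy H / m%:R) * (c * m%:R * (len H)%:R `^ (alpha - 1 - et)).
  by field; rewrite gt_eqF.
by rewrite ler_wpM2l // mulr_ge0 ?(ltW q0) // divr_ge0 // energy_ge0.
Qed.

End Profile.

End Assembly.

Section Limits.
Variable R : realType.

Lemma cvg_norm_le (u : nat -> R) (l X : R) : (u N @[N --> \oo] --> l)%classic ->
  (forall N, `|u N| <= X) -> `|l| <= X.
Proof.
move=> ul uX; have uc : cvgn u by apply/cvg_ex; exists l.
rewrite -(cvg_lim _ ul) // ler_norml; apply/andP; split.
  by apply: limr_ge => //; near=> N; have := uX N; rewrite ler_norml => /andP[].
by apply: limr_le => //; near=> N; have := uX N; rewrite ler_norml => /andP[].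
Unshelve. all: by end_near.
Qed.

Lemma gmom_cvg k (u : nat -> R) (l : R) : (u N @[N --> \oo] --> l)%classic ->
  (gmom (u N) k @[N --> \oo] --> gmom l k)%classic.
Proof.
move=> ul; rewrite /gmom; case: (odd k); first exact: cvg_cst.
apply: cvgM; first exact: cvg_cst.
exact: (cvg_comp u (fun x => x ^+ k./2) ul (@exprn_continuous R _ l)).
Qed.

Lemma gmom_complex (x : R) k : gmom x%:C%C k = (gmom x k)%:C%C.
Proof.
rewrite /gmom; case: (odd k); first by [].
rewrite [RHS]rmorphM rmorphXn rmorph_prod; congr (_ * _); apply: eq_bigr => i _.
by rewrite rmorph_nat.
Qed.

Lemma gmom_gauss (x : R) k : 0 <= x -> gmom x k = gauss_moment R k * x `^ (k%:R / 2).
Proof.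
move=> x0; rewrite /gmom /gauss_moment; case: ifP => ok; first by rewrite mul0r.
congr (_ * _); rewrite -powR_mulrn //; congr powR.
rewrite -[in RHS](odd_double_half k) ok add0n -muln2 natrM mulfK //.
Qed.

End Limits.

(** * Comparison with Gaussian moments *)

Section Moments.
Variables (R : realType) (B : set nat) (alpha : R).
Hypothesis alpha01 : 0 < alpha < 1.
Hypothesis B_gt1 : forall c, B c -> (1 < c)%N.
Hypothesis B_coprime : forall c c', B c -> B c' -> c != c' -> coprime c c'.
Hypothesis B_index : has_index (semigroup_gen B) alpha.
Variables (phi : R -> R) (L Mv : R).
Hypothesis L_ge0 : 0 <= L.
Hypothesis phi_supp : forall x, phi x != 0 -> 0 <= x <= L.
Hypothesis phi_var : forall a b : R, a <= b -> (total_variation a b phi <= Mv%:E)%E.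
Local Notation remom H k N := (complex.Re (mom (@wN R B phi H N) k)).

Lemma limit_error k (e0 : R) : (0 < k)%N -> 0 < e0 -> exists2 A : R, 0 <= A &
  forall (H lk l2 : R), 1 <= H -> (remom H k N @[N --> \oo] --> lk)%classic ->
    (remom H 2 N @[N --> \oo] --> l2)%classic ->
  `|lk - gmom l2 k| <= A * H `^ (k%:R * alpha / 2 + k%:R * e0 - saving alpha / k.+1%:R).
Proof.
move=> k0 e00; have [th ath hth] := moments_bound alpha01 k0 e00.
have K0 : 0 <= (L + 4) * Mv by rewrite mulr_ge0 ?addr_ge0 // (Mv_ge0 phi_var).
have [Z Z0 hZ] := B_zeta alpha01 B_gt1 B_index ath.
have [A A0 hA] := hth Z _ K0; exists A => // H lk l2 H1 ck c2.
apply: (@cvg_norm_le R (fun N => remom H k N - gmom (remom H 2 N) k)).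
  by apply: cvgB => //; apply: gmom_cvg.
move=> N.
have zN : \sum_i (@tb B N i)%:R `^ (- th) <= Z by rewrite (tb_sum B (fun c => c%:R `^ (- th))).
have [_] := hA _ _ (@tb_gt1 B B_gt1 N) (@tb_coprime B B_coprime N) zN H H1 _
  (wN_kernel alpha01 B_gt1 B_index L_ge0 phi_supp phi_var H1 (N := N)).
have re j := mom_real B_gt1 phi_supp H1 N j.
by rewrite re [mom _ 2]re gmom_complex -rmorphB norm_real_complex lecR.
Qed.

Lemma limit_energy k : (0 < k)%N -> exists2 A : R, 0 <= A &
  forall (H lk : R), 1 <= H -> (remom H k N @[N --> \oo] --> lk)%classic ->
  `|lk| <= ((len L H)%:R * energy phi L H) `^ (k%:R / 2) * (A * H `^ (k%:R * alpha / 2 + 1)).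
Proof.
move=> k0; have [A A0 hA] := wt_moment_bound alpha01 B_gt1 B_coprime B_index k0 ltr01.
exists A => // H lk H1 ck; apply: (cvg_norm_le ck) => N.
have X0 : 0 <= (len L H)%:R * energy phi L H by rewrite mulr_ge0 // energy_ge0.
have := norm_mom_le (wN_energy alpha01 B_gt1 B_index phi_supp H1 (N := N)) k.
rewrite (mom_real B_gt1 phi_supp H1 N k) norm_real_complex lecR => /le_trans; apply.
rewrite -powR12_sqrt // -powR_mulrn ?powR_ge0 // -powRrM [2^-1 * _]mulrC.
by rewrite ler_wpM2l ?powR_ge0 // hA.
Qed.

(** For [H >= H0] the second moment is at least a constant times [H^(alpha - et)], and dividing the
    error by its power [k / 2] keeps most of the saving. For [1 <= H < H0] a bounded error is
    enough, and it follows by comparing both moments with the energy. *)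
Lemma gaussian_moments k (a b : R) : (0 < k)%N -> a < b ->
    (forall x, a < x < b -> phi x != 0) ->
  exists A : R, forall H : R, 1 <= H -> exists E : R,
    `|E| <= A * H `^ (- (saving alpha / 4 / k%:R)) /\
    Ck B phi H k =
      (complex.Re (Ck B phi H 2) `^ (k%:R / 2) * (gauss_moment R k + E))%:C%C.
Proof.
move=> k0 ab nz; have [a0 a1] := andP alpha01.
have g0 := saving_gt0 alpha01; have ga := saving_le alpha01.
have [g gE] : {x | x = saving alpha} by exists (saving alpha).
rewrite -gE in g0 ga *.
have kR : 1 <= k%:R :> R by rewrite ler1n.
have k0R : 0 < k%:R :> R by apply: lt_le_trans kR.
have k1R : 0 < k.+1%:R :> R by rewrite ltr0n.
have kk0 : 0 < k%:R * k.+1%:R :> R by rewrite mulr_gt0.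
have kk1 : 1 <= k%:R * k.+1%:R :> R by rewrite -natrM ler1n muln_gt0 k0.
(* The losses [k et / 2] and [k e0] both equal [g / (8 (k + 1))]; what remains of [g / (k + 1)] is
   still at least [g / (4 k)]. *)
have [et etE] : {x | x = g / (4 * (k%:R * k.+1%:R))} by eexists.
have [e0 e0E] : {x | x = g / (8 * (k%:R * k.+1%:R))} by eexists.
have et01 : 0 < et <= 1.
  rewrite etE; apply/andP; split; first exact: divr_gt0 g0 (mulr_gt0 _ kk0).
  rewrite ler_pdivrMr ?(mulr_gt0 _ kk0) // mul1r.
  by apply: (le_trans ga); apply: (le_trans (ltW a1)); apply: (le_trans kk1); rewrite ler_peMl ?(ltW kk0) // ler1n.
have e00 : 0 < e0 by rewrite e0E; exact: divr_gt0 g0 (mulr_gt0 _ kk0).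
have [c2 c20 hc2] := second_moment_limit alpha01 B_gt1 B_coprime B_index phi_supp et01.
have [cV [H0 [cV0 H01 hV]]] := sum_sq_lower phi_var ab nz phi_supp.
have [A1 A10 hA1] := limit_error k0 e00.
have [A2 A20 hA2] := limit_energy k0.
have H00 : 0 < H0 by apply: lt_le_trans H01.
have L1 : 0 < L + 1 by rewrite ltr_wpDl.
have [y yE] : {x | x = alpha - 1 - et} by eexists.
have y0 : y <= 0 by rewrite yE; case/andP: et01 => h _; lra.
have [gm gmE] : {x | x = gauss_moment R k} by eexists.
have [h hE] : {x : R | x = k%:R / 2} by eexists.
have h0 : 0 <= h by rewrite hE divr_ge0.
have [c3 c3E] : {x | x = c2 * cV * (L + 1) `^ y} by eexists.
have c30 : 0 < c3 by rewrite c3E !mulr_gt0 // powR_gt0.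
have [c5 c5E] : {x | x = c2 * ((L + 1) * H0) `^ y} by eexists.
have c50 : 0 < c5 by rewrite c5E; exact: mulr_gt0 c20 (powR_gt0 _ (mulr_gt0 L1 H00)).
have [A3 A3E] : {x | x = ((L + 1) * H0) `^ h * (A2 * H0 `^ (k%:R * alpha / 2 + 1)) / c5 `^ h} by eexists.
have A30 : 0 <= A3 by rewrite A3E !mulr_ge0 ?invr_ge0 ?powR_ge0.
have len0 H : 0 < (len L H)%:R :> R by rewrite ltr0n.
exists (A1 / c3 `^ h + (A3 + `|gm|) * H0 `^ (g / 4 / k%:R)) => H H1.
have Hp : 0 < H by apply: lt_le_trans H1.
have [lk -> ck] := Ck_lim alpha01 B_gt1 B_coprime B_index L_ge0 phi_supp phi_var H1 k0.
have [l2 -> cl2] := Ck_lim alpha01 B_gt1 B_coprime B_index L_ge0 phi_supp phi_var H1 (isT : 0 < 2)%N.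
have l2_ge := hc2 H l2 H1 cl2; rewrite -yE in l2_ge.
have en0 := energy_ge0 phi L H.
have l20 : 0 <= l2.
  by apply: le_trans l2_ge; rewrite !mulr_ge0 ?powR_ge0 // ltW.
have lenH := len_le L_ge0 H1.
have powy (u v : R) : 0 < u -> u <= v -> v `^ y <= u `^ y.
  by move=> u0 uv; rewrite -[y]opprK powR_le2N // oppr_ge0.
have A1c : 0 <= A1 / c3 `^ h by rewrite divr_ge0 // powR_ge0.
have A3g : 0 <= (A3 + `|gm|) * H0 `^ (g / 4 / k%:R).
  by rewrite mulr_ge0 ?powR_ge0 // addr_ge0.
have [HH|HH] := leP H0 H.
  have enH : cV * H <= energy phi L H by apply: hV => //; apply: len_gt.
  have l2H : c3 * H `^ (alpha - et) <= l2.
    apply: le_trans l2_ge.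
    apply: (@le_trans _ _ (c2 * (cV * H) * ((L + 1) * H) `^ y)).
      rewrite powRM ?(ltW L1) ?(ltW Hp) // c3E le_eqVlt; apply/orP; left; apply/eqP.
      have -> : H `^ (alpha - et) = H * H `^ y.
        by rewrite -{2}[H]powRr1 ?(ltW Hp) // -powRDp //; congr powR; rewrite yE; ring.
      ring.
    apply: ler_pM; rewrite ?powR_ge0 ?mulr_ge0 ?(ltW c20) ?(ltW cV0) ?(ltW Hp) //.
      by rewrite ler_pM2l.
    exact: powy.
  have l2p : 0 < l2 by apply: lt_le_trans l2H; rewrite mulr_gt0 // powR_gt0.
  have [D DE] : {x | x = l2 `^ h} by eexists.
have D0 : 0 < D by rewrite DE powR_gt0.
  have D_ge : c3 `^ h * H `^ ((alpha - et) * h) <= D.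
    rewrite DE powRrM -powRM ?powR_ge0 ?(ltW c30) //.
    by apply: powR_le2 => //; rewrite mulr_ge0 ?powR_ge0 ?(ltW c30).
  exists (lk / D - gm); split; last by rewrite /= -hE -DE -gmE addrC subrK mulrC divfK ?gt_eqF.
  have -> : lk / D - gm = (lk - gm * D) / D by rewrite mulrBl mulfK ?gt_eqF.
  rewrite normrM normfV (gtr0_norm D0).
  apply: (@le_trans _ _ (A1 / c3 `^ h * H `^ (- (g / 4 / k%:R)))); last first.
    by rewrite ler_wpM2r ?powR_ge0 // lerDl.
  rewrite ler_pdivrMr //.
  have := hA1 H lk l2 H1 ck cl2; rewrite gmom_gauss // -gmE -hE -DE -gE => /le_trans; apply.
  have ch0 : 0 < c3 `^ h by rewrite powR_gt0.
  apply: (@le_trans _ _ (A1 / c3 `^ h * H `^ (- (g / 4 / k%:R)) * (c3 `^ h * H `^ ((alpha - et) * h)))); last first.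
    by rewrite ler_wpM2l // mulr_ge0 // powR_ge0.
  have -> : A1 / c3 `^ h * H `^ (- (g / 4 / k%:R)) * (c3 `^ h * H `^ ((alpha - et) * h)) =
      A1 * H `^ (- (g / 4 / k%:R) + (alpha - et) * h).
    by rewrite powRDp //; field; rewrite gt_eqF.
  rewrite ler_wpM2l //; apply: ler_powR => //; rewrite hE etE e0E.
  have k1E : k.+1%:R = k%:R + 1 :> R by rewrite natr1.
  rewrite -subr_ge0.
  have -> : - (g / 4 / k%:R) + (alpha - g / (4 * (k%:R * k.+1%:R))) * (k%:R / 2) -
      (k%:R * alpha / 2 + k%:R * (g / (8 * (k%:R * k.+1%:R))) - g / k.+1%:R) =
      g * (2 * k%:R - 1) / (4 * (k%:R * k.+1%:R)).
    by rewrite k1E; field; rewrite ?(gt_eqF k0R) //= -k1E gt_eqF.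
  by rewrite divr_ge0 ?mulr_ge0 ?(ltW kk0) ?(ltW g0) //; lra.
(* On [[1, H0]] the target power of [H] is bounded below, so any bounded error is admissible
   there. *)
have Hpow : 1 <= H0 `^ (g / 4 / k%:R) * H `^ (- (g / 4 / k%:R)).
  have gk0 : 0 <= g / 4 / k%:R by rewrite !divr_ge0 ?(ltW g0) ?(ltW k0R).
  apply: (@le_trans _ _ (H0 `^ (g / 4 / k%:R) * H0 `^ (- (g / 4 / k%:R)))).
    by rewrite -powRDp // subrr powRr0.
  by rewrite ler_wpM2l ?powR_ge0 // powR_le2N // ltW.
have small (E : R) : `|E| <= A3 + `|gm| ->
    `|E| <= (A1 / c3 `^ h + (A3 + `|gm|) * H0 `^ (g / 4 / k%:R)) * H `^ (- (g / 4 / k%:R)).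
  move=> Ele; apply: (le_trans Ele); rewrite mulrDl -[leLHS]add0r; apply: lerD.
    by rewrite mulr_ge0 // powR_ge0.
  by rewrite -mulrA ler_peMr // addr_ge0.
have lk_le := hA2 H lk H1 ck; rewrite -hE in lk_le.
move: en0; rewrite le_eqVlt => /orP[/eqP enz|enp].
  (* [C_k] vanishes together with the energy, so the error is chosen to cancel the Gaussian
     moment. *)
  exists (- gm); split; first by apply: small; rewrite normrN lerDr.
  move: lk_le; rewrite -enz mulr0 powR0 ?mul0r ?normr_le0; last first.
    by rewrite hE gt_eqF // divr_gt0.
  by move=> /eqP ->; rewrite -gmE subrr mulr0.
have l2e : c5 * energy phi L H <= l2.
  apply: le_trans l2_ge; rewrite c5E mulrAC ler_pM2l ?mulr_gt0 //; apply: powy => //.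
  by apply: (le_trans lenH); rewrite ler_pM2l // ltW.
have l2p : 0 < l2 by apply: lt_le_trans l2e; rewrite mulr_gt0.
have [D DE] : {x | x = l2 `^ h} by eexists.
have D0 : 0 < D by rewrite DE powR_gt0.
have D_ge : c5 `^ h * energy phi L H `^ h <= D.
  rewrite DE -powRM ?(ltW c50) ?(ltW enp) //.
  by apply: powR_le2 => //; rewrite mulr_ge0 ?(ltW c50) ?(ltW enp).
exists (lk / D - gm); split; last by rewrite /= -hE -DE -gmE addrC subrK mulrC divfK ?gt_eqF.
apply: small; apply: (le_trans (ler_normB _ _)); rewrite lerD2r.
rewrite normrM normfV (gtr0_norm D0) ler_pdivrMr //; apply: (le_trans lk_le).
apply: (@le_trans _ _ (A3 * (c5 `^ h * energy phi L H `^ h))); last by rewrite ler_wpM2l.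
have c5h : 0 < c5 `^ h by rewrite powR_gt0.
have -> : A3 * (c5 `^ h * energy phi L H `^ h) =
   (((L + 1) * H0) `^ h * energy phi L H `^ h) * (A2 * H0 `^ (k%:R * alpha / 2 + 1)).
  by rewrite A3E; field; rewrite gt_eqF.
have ex0 : 0 <= k%:R * alpha / 2 + 1.
  by rewrite addr_ge0 // divr_ge0 // mulr_ge0 // ltW.
apply: ler_pM; rewrite ?powR_ge0 ?mulr_ge0 ?powR_ge0 //.
  rewrite -powRM ?mulr_ge0 ?(ltW L1) ?(ltW H00) ?(ltW enp) //.
  apply: powR_le2 => //; first by rewrite mulr_ge0 // ltW.
  by rewrite ler_pM2r // (le_trans lenH) // ler_pM2l // ltW.
by rewrite ler_wpM2l // powR_le2 // ltW.
Qed.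

End Moments.

Theorem theorem6p1 (R : realType) (alpha : R) (halpha : 0 < alpha < 1) :
  exists c : R, 0 < c /\
    forall (B : set nat) (phi : R -> R),
      sieving_set R B ->
      has_index (semigroup_gen B) alpha ->
      bounded_variation_line phi ->
      compact_support_nonneg phi ->
      nonvanishing_somewhere phi ->
      forall k : nat, (0 < k)%N ->
      exists A : R, forall H : R, 1 <= H ->
      exists E : R,
        `|E| <= A * H `^ (- (c / k%:R)) /\
        Ck B phi H k =
          (complex.Re (Ck B phi H 2) `^ (k%:R / 2) * (gauss_moment R k + E))%:C%C.
Proof.
(* The division by 4 pays for the two small losses and for passing from [k + 1] to [k]. *)
exists (saving alpha / 4); split; first by rewrite divr_gt0 // saving_gt0.
move=> B phi [_ B_gt1 B_coprime _] B_index [Mv phi_var] [K [Kc Kpos Ksupp]] [a [b [ab nz]]] k k0.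
have [M [_ hM]] := compact_bounded Kc.
have phi_supp x : phi x != 0 -> 0 <= x <= `|M| + 1.
  move=> /Ksupp Kx; rewrite Kpos //=; apply: le_trans (ler_norm _) _.
  by apply: hM => //; rewrite (le_lt_trans (ler_norm M)) // ltrDl.
by apply: (gaussian_moments halpha B_gt1 B_coprime B_index _ phi_supp phi_var k0 ab nz); rewrite addr_ge0.
Qed.
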